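(* Let $0<\nu<1$, $\alpha>0$, $\omega\in\mathbb{R}$, and let $z(t)$ be the solution of the complex stochastic differential equation $$\mathrm{d}z=\big[(-\nu+i\omega)z+2z|z|^2-z|z|^4\big]\mathrm{d}t+\alpha\,\mathrm{d}W(t),\qquad z(0)=0.$$ Let the threshold be $\xi=R_c^0:=\sqrt{1-\sqrt{1-\nu}}$ or, when the potential $V$ given in the context has three critical points $0<R_{\min}<R_c<R_{\max}$ in $R>0$, any $\xi$ with $R_c<\xi<R_{\max}$. Let $T(\nu,\alpha)=\mathbb{E}\big(\inf\{t>0: |z(t)|\ge \xi\}\big)$ be the mean escape time. Then $$T(\nu,\alpha)=\frac{2}{\alpha^2}\int_{x=0}^{\xi}\int_{y=0}^{x}\frac{y}{x}\exp\left(\frac{\nu(x^2-y^2)+(y^4-x^4)+(x^6-y^6)/3}{\alpha^2}\right)\mathrm{d}y\,\mathrm{d}x,$$ equivalently $$T(\nu,\alpha)=\frac{1}{\alpha^2}\int_{q=0}^{2\xi^2}\int_{p=0}^{\min(q,2\xi^2-q)}\frac{1}{2(p+q)}\exp\left(\frac{p(\nu-q+p^2/12+q^2/4)}{\alpha^2}\right)\mathrm{d}p\,\mathrm{d}q,$$ and $$T_l(\nu,\alpha)<T(\nu,\alpha)<T_u(\nu,\alpha),$$ where $$T_l(\nu,\alpha)=\int_{0}^{\xi^2}\int_{0}^{q}\frac{1}{4q\alpha^2}\exp\left(\frac{p(\nu-q+q^2/4)}{\alpha^2}\right)\mathrm{d}p\,\mathrm{d}q=\int_{0}^{\xi^2}\frac{e^{q(\nu-q+q^2/4)/\alpha^2}-1}{4q(\nu-q+q^2/4)}\,\mathrm{d}q,$$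 $$T_u(\nu,\alpha)=\int_{0}^{2\xi^2}\int_{0}^{q}\frac{1}{2q\alpha^2}\exp\left(\frac{p(\nu-q+q^2/3)}{\alpha^2}\right)\mathrm{d}p\,\mathrm{d}q=\int_{0}^{2\xi^2}\frac{e^{q(\nu-q+q^2/3)/\alpha^2}-1}{2q(\nu-q+q^2/3)}\,\mathrm{d}q.$$
   Context: $W(t)=u(t)+iv(t)$ is a complex Wiener process, with $u,v$ independent standard real Wiener processes. In polar form the modulus $R=|z|$ satisfies $\mathrm{d}R=\big[-\nu R+2R^3-R^5+\frac{\alpha^2}{2R}\big]\mathrm{d}t+\alpha\,\mathrm{d}W_R=-V'(R)\,\mathrm{d}t+\alpha\,\mathrm{d}W_R$, with $W_R$ a standard real Wiener process and potential $V(R)=\frac{\nu R^2}{2}-\frac{R^4}{2}+\frac{R^6}{6}-\frac{\alpha^2}{2}\ln R$ for $R>0$; so $T(\nu,\alpha)$ does not depend on $\omega$. When $V$ has three critical points $0<R_{\min}<R_c<R_{\max}$, the points $R_{\min}$ and $R_{\max}$ are local minima of $V$ and $R_c$ is a local maximum. The number $R_c^0$ is the radius of the unstable limit cycle of the noise-free system ($\alpha=0$), and for $\alpha>0$ one has $R_c<R_c^0$ whenever $R_c$ exists. In the single integrals for $T_l$ and $T_u$, the integrands are understood as extended by continuity where the denominator vanishes. *)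

(* Defs.v *)
From HB Require Import structures.
From mathcomp Require Import all_boot all_order all_algebra.
From mathcomp Require Import all_classical all_reals all_analysis.
From mathcomp.real_closed Require Import complex.

Set Implicit Arguments.
Unset Strict Implicit.
Unset Printing Implicit Defensive.

Import Order.TTheory GRing.Theory Num.Theory.
Import numFieldNormedType.Exports.

Local Open Scope classical_set_scope.
Local Open Scope ring_scope.
Local Open Scope complex_scope.

(* Processes are maps X : R -> Omega -> R (or R[i]), of which only the values
   X t with 0 <= t are meaningful.  No measurable structure is needed on R[i]:
   complex processes are handled through their real and imaginary parts. *)
Section Processes.
Context {d : measure_display} {Omega : measurableType d} {R : realType}.
Variable P : probability Omega R.

Definition generated_sigma (H : set (Omega -> R)) : set (set Omega) :=
  <<s \bigcup_(f in H) preimage_set_system setT f measurable >>.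

Definition independent_sigma (G H : set (set Omega)) :=
  forall A B, G A -> H B -> P (A `&` B) = (P A * P B)%E.

Definition continuous_paths (X : R -> Omega -> R) :=
  {ae P, forall w, {within `[0, +oo[, continuous (X ^~ w)}}.

Definition standard_wiener (X : R -> Omega -> R) :=
  [/\ forall t : R, 0 <= t -> measurable_fun setT (X t),
      {ae P, forall w, X 0 w = 0},
      forall s t : R, 0 <= s -> s < t ->
        forall B, measurable B ->
          P ((X t \- X s) @^-1` B) = normal_prob 0 (Num.sqrt (t - s)) B,
      forall s t : R, 0 <= s -> s < t ->
        independent_sigma (generated_sigma [set X r | r in `[0, s]])
                          (generated_sigma [set X t \- X s])
    & continuous_paths X].

Definition re_part (Z : R -> Omega -> R[i]) : R -> Omega -> R :=
  fun t w => complex.Re (Z t w).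
Definition im_part (Z : R -> Omega -> R[i]) : R -> Omega -> R :=
  fun t w => complex.Im (Z t w).

Definition complex_wiener (W : R -> Omega -> R[i]) :=
  [/\ standard_wiener (re_part W), standard_wiener (im_part W)
    & independent_sigma (generated_sigma [set re_part W r | r in `[0, +oo[])
                        (generated_sigma [set im_part W r | r in `[0, +oo[])].

Definition filtration (F : R -> set (set Omega)) :=
  [/\ forall t : R, 0 <= t -> sigma_algebra setT (F t),
      forall t : R, 0 <= t -> F t `<=` measurable
    & forall s t : R, 0 <= s -> s <= t -> F s `<=` F t].

Definition adapted (F : R -> set (set Omega)) (Z : R -> Omega -> R[i]) :=
  forall t : R, 0 <= t ->
    generated_sigma [set re_part Z t; im_part Z t] `<=` F t.

(* W is a complex Wiener process relative to the filtration F. *)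
Definition complex_wiener_wrt (F : R -> set (set Omega))
    (W : R -> Omega -> R[i]) :=
  [/\ complex_wiener W, filtration F, adapted F W
    & forall s t : R, 0 <= s -> s < t ->
        independent_sigma (F s)
          (generated_sigma [set re_part W t \- re_part W s;
                                im_part W t \- im_part W s])].

Definition complex_integral (a b : R) (f : R -> R[i]) : R[i] :=
  Rintegral (@lebesgue_measure R) `[a, b] (fun s => complex.Re (f s)) +i*
  Rintegral (@lebesgue_measure R) `[a, b] (fun s => complex.Im (f s)).

(* Z solves dZ = b(Z) dt + alpha dW with Z(0) = z0.  The noise is additive, so
   the stochastic integral of the constant alpha is alpha * (W t - W 0) and the
   equation in integrated form needs no Ito integral. *)
Definition sde_solution (F : R -> set (set Omega)) (W : R -> Omega -> R[i])
    (b : R[i] -> R[i]) (alpha : R) (z0 : R[i]) (Z : R -> Omega -> R[i]) :=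
  [/\ adapted F Z,
      continuous_paths (re_part Z) /\ continuous_paths (im_part Z),
      {ae P, forall w, Z 0 w = z0}
    & {ae P, forall w (t : R), 0 <= t ->
        Z t w = Z 0 w + complex_integral 0 t (fun s => b (Z s w))
                + alpha%:C * (W t w - W 0 w)}].

(* The infimum of the empty set is +oo. *)
Definition escape_time (Z : R -> Omega -> R[i]) (xi : R) (w : Omega) : \bar R :=
  ereal_inf [set t%:E | t in [set t : R | 0 < t /\ xi%:C <= `|Z t w|]].

Definition mean_escape_time (Z : R -> Omega -> R[i]) (xi : R) : \bar R :=
  (\int[P]_w escape_time Z xi w)%E.

End Processes.

Section Model.
Context {R : realType}.
Implicit Types nu omega alpha xi : R.

Definition drift nu omega (z : R[i]) : R[i] :=
  ((- nu) +i* omega) * z + 2 * z * `|z| ^+ 2 - z * `|z| ^+ 4.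

Definition potential nu alpha (r : R) : R :=
  nu * r ^+ 2 / 2 - r ^+ 4 / 2 + r ^+ 6 / 6 - alpha ^+ 2 / 2 * ln r.

Definition three_critical_points nu alpha (Rmin Rc Rmax : R) :=
  [/\ 0 < Rmin, Rmin < Rc, Rc < Rmax
    & [set r | 0 < r /\ derive1 (potential nu alpha) r = 0]
      = [set Rmin; Rc; Rmax]].

Definition Rc0 nu : R := Num.sqrt (1 - Num.sqrt (1 - nu)).

Definition admissible_threshold nu alpha xi :=
  xi = Rc0 nu \/
  exists Rmin Rc Rmax,
    three_critical_points nu alpha Rmin Rc Rmax /\ Rc < xi /\ xi < Rmax.

(* The quotient num / den, extended by continuity to the zeros of den. *)
Definition quotient_ext (num den : R -> R) (q : R) : R :=
  if den q == 0 then lim ((fun x => num x / den x) @ q^') else num q / den q.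

Definition T_l nu alpha xi : \bar R :=
  (\int[@lebesgue_measure R]_(q in `[0%R, (xi ^+ 2)%R])
     \int[@lebesgue_measure R]_(p in `[0%R, q])
       ((4 * q * alpha ^+ 2)^-1 *
        expR (p * (nu - q + q ^+ 2 / 4) / alpha ^+ 2))%R%:E)%E.

Definition T_u nu alpha xi : \bar R :=
  (\int[@lebesgue_measure R]_(q in `[0%R, (2 * xi ^+ 2)%R])
     \int[@lebesgue_measure R]_(p in `[0%R, q])
       ((2 * q * alpha ^+ 2)^-1 *
        expR (p * (nu - q + q ^+ 2 / 3) / alpha ^+ 2))%R%:E)%E.

End Model.

(* Main.v *)
Require Import Defs.
From HB Require Import structures.
From mathcomp Require Import all_boot all_order all_algebra.
From mathcomp Require Import all_classical all_reals all_analysis.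
From mathcomp Require Import measurable_realfun.
From mathcomp Require Import ring lra.
From mathcomp.real_closed Require Import complex.

Set Implicit Arguments.
Unset Strict Implicit.
Unset Printing Implicit Defensive.

Import Order.TTheory GRing.Theory Num.Theory.
Import numFieldNormedType.Exports.

Local Open Scope classical_set_scope.
Local Open Scope ring_scope.

(* With c = alpha^2 and phi q = nu q - q^2 + q^3/3, the generator of the process
   applied to p(|z|^2) is 2 (c (p' + q p'') - q phi' p') at q = |z|^2, so an exact
   solution of "generator = -1" gives T = p(0) - p(xi^2), which is the double
   integral.  It is not polynomial, but Picard iteration yields polynomials p
   for which the generator is uniformly close to -1 on [0, xi^2].
   For such p no stochastic integral is needed: along an explicit Euler scheme
   driven by truncated increments of W and stopped on leaving the disc, Taylor
   expansion and independence give a discrete Dynkin formula with error O(sqrt h).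
   As the noise is additive, the scheme follows the path uniformly while
   stopped, so the expected discrete exit times converge to T.
   The second form is the substitution (x, y) |-> (q, p) = (x^2 + y^2, x^2 - y^2)
   (the inner one twice, with Tonelli in between); the bounds compare its
   integrand with those of T_l and T_u, strictness coming from rectangles of
   positive area that are lost in the comparison. *)

(** * Integrals of possibly non-measurable functions *)

(** The obstacle that shapes the proof is the escape time itself: an infimum over uncountably many
    times, whose measurability is nowhere established. Its integral is therefore handled as the
    supremum over simple functions below it. The upper bound of the mean tests an arbitrary bounded
    measurable minorant against sampled exit times; the lower bound constructs one measurable
    minorant, the upper limit of the sampled exit times from a slightly smaller disc.

    The Euler scheme takes its drift at the path and not at itself. It is thus a left Riemann sum of
    the integrated equation, and uniform continuity of the path makes it close to the path. The
    price is an extra term in the Dynkin formula, [drift_defect], which vanishes in the limit.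

    A finite horizon t keeps all quantities bounded. If K bounds the test polynomial, then by
    Markov's inequality the surviving paths contribute at most 2K/t times the mean exit time; with t
    of order K/e this is absorbed into the mean exit time itself. *)

Section LowerIntegral.
Context d (T : measurableType d) (R : realType) (mu : {measure set T -> \bar R}).
Local Open Scope ereal_scope.
Import HBNNSimple.

Lemma ge0_integral_le (D : set T) (f g : T -> \bar R) :
  (forall x, D x -> 0 <= f x) -> (forall x, D x -> f x <= g x) ->
  \int[mu]_(x in D) f x <= \int[mu]_(x in D) g x.
Proof.
move=> f0 fg; have g0 x : D x -> 0 <= g x.
  by move=> Dx; exact: le_trans (f0 _ Dx) (fg _ Dx).
rewrite !ge0_integralE//; apply: ge_ereal_sup => _ [h hf <-].
apply: ereal_sup_ubound; exists h => // x; apply: le_trans (hf x) _.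
exact: lee_restrict.
Qed.

Lemma ge0_integral_le_nnsfun (f : T -> \bar R) (a : \bar R) :
  (forall x, 0 <= f x) ->
  (forall h : {nnsfun T >-> R}, (forall x, (h x)%:E <= f x) ->
    \int[mu]_x (h x)%:E <= a) ->
  \int[mu]_x f x <= a.
Proof.
move=> f0 ha; rewrite ge0_integralTE//; apply: ge_ereal_sup => _ [h hf <-].
by rewrite -integralT_nnsfun; exact: ha.
Qed.

(** As [f] need not be measurable, the null set is removed from each simple function below [f]
    rather than from [f] itself. *)
Lemma ge0_integral_null_le (D : set T) (N : set T) (f g : T -> \bar R) :
  measurable N -> mu N = 0 ->
  (forall x, D x -> 0 <= f x) -> (forall x, D x -> 0 <= g x) ->
  (forall x, D x -> ~ N x -> f x <= g x) ->
  \int[mu]_(x in D) f x <= \int[mu]_(x in D) g x.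
Proof.
move=> mN N0 f0 g0 fg.
rewrite integral_mkcond [leRHS]integral_mkcond.
apply: ge0_integral_le_nnsfun => [x|h hf]; first exact: erestrict_ge0.
rewrite (ge0_negligible_integral mN)//; last 2 first.
  exact/measurable_EFinP.
  by move=> x _; rewrite lee_fin.
rewrite setTD integral_mkcond; apply: ge0_integral_le => x _.
  by apply: erestrict_ge0 => ? _; rewrite lee_fin.
rewrite /patch; case: ifPn => [|_]; last exact: (@erestrict_ge0 _ _ D g).
rewrite inE => Nx; apply: le_trans (hf x) _.
rewrite /patch; case: ifPn => //; rewrite inE => Dx; exact: fg.
Qed.

Lemma integral_null_eq (D : set T) (N : set T) (f g : T -> \bar R) :
  measurable N -> mu N = 0 ->
  (forall x, D x -> ~ N x -> f x = g x) ->
  \int[mu]_(x in D) f x = \int[mu]_(x in D) g x.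
Proof.
move=> mN N0 fg; rewrite integralE [RHS]integralE.
by congr (_ - _); apply/eqP; rewrite eq_le; apply/andP; split;
  apply: (ge0_integral_null_le mN N0) => // x Dx Nx; rewrite ?(funeposE, funenegE) fg.
Qed.

End LowerIntegral.

(** * Polynomial test functions *)

Section Antiderivative.
Context {R : realType}.
Implicit Types p f : {poly R}.

(* The coefficient of index 0 is [f`_0 / 0 = 0]. *)
Definition antideriv f : {poly R} := \poly_(i < (size f).+1) (f`_i.-1 / i%:R).

Lemma deriv_antideriv f : (antideriv f)^`() = f.
Proof.
apply/polyP => i; rewrite coef_deriv coef_poly ltnS /=.
case: ltnP => [_|si]; last by rewrite mul0rn nth_default.
by rewrite -[LHS]mulr_natr mulfVK// pnatr_eq0.
Qed.

Lemma antideriv0 f : (antideriv f).[0] = 0.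
Proof. by rewrite horner_coef0 coef_poly /= invr0 mulr0. Qed.


Lemma horner_bounded p (M : R) :
  exists2 L, 0 < L & forall x : R, `|x| <= M -> `|p.[x]| <= L.
Proof.
exists (1 + \sum_(i < size p) `|p`_i| * `|M| ^+ i).
  by rewrite ltr_pwDl// sumr_ge0// => i _; rewrite mulr_ge0// exprn_ge0.
move=> x xM; rewrite horner_coef; apply: le_trans (ler_norm_sum _ _ _) _.
apply: (@le_trans _ _ (\sum_(i < size p) `|p`_i| * `|M| ^+ i)).
  apply: ler_sum => i _; rewrite normrM normrX ler_wpM2l//.
  by rewrite lerXn2r ?nnegrE// (le_trans xM)// ler_norm.
by rewrite lerDr.
Qed.

Lemma horner_deriv_ge0 p (M x : R) :
  (forall y, 0 <= y <= M -> 0 <= p^`().[y]) -> 0 <= x <= M -> p.[0] <= p.[x].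
Proof.
move=> p0 /andP[x0 xM].
have [|c] := @MVT_segment R (horner p) (horner p^`()) 0 x x0.
  by apply: continuous_subspaceT => y; exact: continuous_horner.
rewrite in_itv/= => /andP[c0 cx] pE; rewrite -subr_ge0 pE subr0 mulr_ge0//.
by apply: p0; rewrite c0 (le_trans cx).
Qed.

Lemma horner_deriv_le p f (M x : R) :
  p.[0] = 0 -> f.[0] = 0 ->
  (forall y, 0 <= y <= M -> `|p^`().[y]| <= f^`().[y]) ->
  0 <= x <= M -> `|p.[x]| <= f.[x].
Proof.
move=> p0 f0 pf xM; rewrite ler_norml; apply/andP; split.
- suff : (f + p).[0] <= (f + p).[x] by rewrite !hornerE p0 f0; lra.
  apply: horner_deriv_ge0 xM => y /pf.
  by rewrite derivD hornerD ler_norml => /andP[]; lra.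
- suff : (f - p).[0] <= (f - p).[x] by rewrite !hornerE p0 f0; lra.
  apply: horner_deriv_ge0 xM => y /pf.
  by rewrite derivB hornerD hornerN ler_norml => /andP[]; lra.
Qed.

Section Picard.
Variables (psi : {poly R}) (M L : R).
Hypothesis psiL : forall x : R, 0 <= x <= M -> `|psi.[x]| <= L.

(** Terms of the Picard series of P' = 1 + psi P, P(0) = 0; its partial sums are the Picard
    iterates. *)
Fixpoint picard n : {poly R} :=
  if n is m.+1 then antideriv (psi * picard m) else 'X.

Lemma picard_at0 n : (picard n).[0] = 0.
Proof. by case: n => [|n] /=; rewrite ?hornerX ?antideriv0. Qed.

Lemma picard_bound n (x : R) : 0 <= x <= M ->
  `|(picard n).[x]| <= L ^+ n * x ^+ n.+1 / n.+1`!%:R.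
Proof.
elim: n x => [|n IHn] x xM.
  by case/andP: (xM) => x0 _; rewrite hornerX ger0_norm// expr0 expr1 mul1r divr1.
pose g : {poly R} := (L ^+ n.+1 / n.+2`!%:R) *: 'X^(n.+2).
have -> : L ^+ n.+1 * x ^+ n.+2 / n.+2`!%:R = g.[x].
  by rewrite /g hornerZ hornerXn mulrAC.
apply: horner_deriv_le xM => [||y yM].
- exact: picard_at0.
- by rewrite hornerZ hornerXn expr0n mulr0.
rewrite /= deriv_antideriv hornerM normrM derivZ derivXn hornerZ hornerMn hornerXn.
apply: (@le_trans _ _ (L * (L ^+ n * y ^+ n.+1 / n.+1`!%:R))).
  by apply: ler_pM => //; [exact: psiL|exact: IHn].
rewrite le_eqVlt; apply/orP; left; apply/eqP.
rewrite -(mulr_natr (y ^+ n.+1)) (factS n.+1) natrM !exprS invfM.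
have n0 : n.+2%:R != 0 :> R by rewrite pnatr_eq0.
have f0 : (n.+1`!)%:R != 0 :> R by rewrite pnatr_eq0 -lt0n fact_gt0.
move: (n.+2%:R : R) (n.+1`!%:R : R) n0 f0 => a b a0 b0; field; exact/andP.
Qed.

(** Each term differentiates to [psi] times its predecessor, so only one product is left over: the
    whole error of the approximation. *)
Lemma deriv_sum_picard n :
  (\sum_(k < n.+1) picard k)^`() =
    1 + psi * (\sum_(k < n.+1) picard k) - psi * picard n.
Proof.
elim: n => [|n IHn]; first by rewrite !big_ord1 derivX; ring.
rewrite !(big_ord_recr n.+1)/= derivD IHn deriv_antideriv. ring.
Qed.

End Picard.

(** The leftover is at most (L M)^(N+1) / (N+1)!, a term of the exponential series at L M, hence
    small for large N. *)
Lemma linear_ode_poly_approx (psi : {poly R}) (M e : R) : 0 < e ->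
  exists P : {poly R}, P.[0] = 0 /\
    forall q, 0 <= q <= M -> `|P^`().[q] - psi.[q] * P.[q] - 1| <= e.
Proof.
move=> e0.
have [M0|M0] := ltP M 0.
  exists 0; rewrite horner0; split => // q /andP[q0 qM].
  by move: (le_lt_trans (le_trans q0 qM) M0); rewrite ltxx.
have [L L0 psiL] := horner_bounded psi M.
have psiL' (x : R) : 0 <= x <= M -> `|psi.[x]| <= L.
  by move=> /andP[x0 xM]; apply: psiL; rewrite ger0_norm.
have : \forall n \near \oo, `|0 - exp_coeff (L * M) n| < e.
  by move/cvgrPdist_lt: (@cvg_exp_coeff R (L * M)); exact.
case=> N _ /(_ N.+1 (leqnSn _)); rewrite sub0r normrN => eN.
exists (\sum_(k < N.+1) picard psi k); split.
  by rewrite horner_sum big1// => k _; exact: picard_at0.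
move=> q qM; rewrite deriv_sum_picard !hornerE.
rewrite [X in `|X|](_ : _ = - (psi.[q] * (picard psi N).[q])); last by ring.
rewrite normrN normrM.
have [q0 qM'] := andP qM.
apply: (@le_trans _ _ (L * (L ^+ N * M ^+ N.+1 / N.+1`!%:R))); last first.
  rewrite [leLHS](_ : _ = exp_coeff (L * M) N.+1); last first.
    by rewrite /exp_coeff /= exprMn [L ^+ N.+1]exprS !mulrA.
  by apply: le_trans (ltW eN); exact: ler_norm.
apply: ler_pM => //; first exact: psiL'.
apply: le_trans (picard_bound psiL' N qM) _.
  rewrite ler_pM2r ?invr_gt0 ?ltr0n ?fact_gt0//.
apply: ler_wpM2l; first exact/exprn_ge0/ltW.
by rewrite lerXn2r ?nnegrE.
Qed.

(** The second-order equation for p is of first order in P = -2 c q p', where it reads P' = 1 + psi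
    P. The initial value P(0) = 0 makes P divisible by ['X], so that p' is again a polynomial. *)
Lemma test_poly_approx (psi : {poly R}) (c M e : R) : 0 < c -> 0 < e ->
  exists p : {poly R}, forall q, 0 <= q <= M ->
    `|1 + 2 * c * (p^`().[q] + q * p^`()^`().[q]) - 2 * c * q * psi.[q] * p^`().[q]|
      <= e.
Proof.
move=> c0 e0; have [P [P0 Pe]] := linear_ode_poly_approx psi M e0.
have /factor_theorem[K PE] : root P 0 by rewrite /root P0.
exists (antideriv (- (2 * c)^-1 *: K)) => q /Pe.
rewrite deriv_antideriv  {}PE derivM derivB derivX derivC derivZ !(hornerZ, hornerM, hornerD, hornerN, hornerX, hornerC).
rewrite -normrN; congr (`|_| <= e). field.
by rewrite (gt_eqF c0).
Qed.

End Antiderivative.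

(** * Antiderivatives of the form polynomial times exponential of a polynomial *)

Section ExpPoly.
Context {R : realType}.
Notation mu := (@lebesgue_measure R).
Implicit Types p A B : {poly R}.

Lemma FTC2_is_derive (F f : R -> R) (a b : R) : a <= b ->
  (forall x : R, is_derive x 1 F (f x)) -> continuous f ->
  (\int[mu]_(x in `[a, b]) (f x)%:E = (F b - F a)%:E)%E.
Proof.
move=> ab Ff cf; have dF (x : R) : derivable F x 1 by have [] := Ff x.
have [->|anb] := eqVneq a b.
  by rewrite set_itv1 integral_set1 subrr.
have {anb}ab : a < b by rewrite lt_neqAle anb.
rewrite (continuous_FTC2 (F := F))//.
- exact: continuous_subspaceT.
- split; first by move=> x _; exact: dF.
  + by apply: cvg_at_right_filter; apply/differentiable_continuous/derivable1_diffP.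
  + by apply: cvg_at_left_filter; apply/differentiable_continuous/derivable1_diffP.
- by move=> x _; rewrite derive1E; have [] := Ff x.
Qed.

(** The exit kernel, the Gaussian densities and the closed forms of the bounds are all of this
    shape. The class is closed under derivation, so each explicit integral reduces to exhibiting [A]
    and [B]. *)
Definition exp_poly A B (x : R) : R := A.[x] * expR B.[x].

Lemma is_derive_exp_poly A B (x : R) :
  is_derive x 1 (exp_poly A B) (exp_poly (A^`() + A * B^`()) B x).
Proof.
have dA := is_derive_poly A x.
have dB : is_derive x 1 (fun y => expR B.[y]) (expR B.[x] * B^`().[x]).
  by have := @is_derive1_comp R expR (horner B) x; apply.
have := is_deriveM dA dB; rewrite /exp_poly hornerD hornerM.
rewrite (_ : _ *: _ + _ *: _ = (A^`().[x] + A.[x] * B^`().[x]) * expR B.[x]) //.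
by rewrite /GRing.scale /=; ring.
Qed.

Lemma continuous_exp_poly A B : continuous (exp_poly A B).
Proof.
move=> x; apply: (@continuousM R R (horner A) (expR \o horner B)).
  exact: continuous_horner.
by apply: continuous_comp; [exact: continuous_horner|exact: continuous_expR].
Qed.

Lemma measurable_exp_poly D A B : measurable D ->
  measurable_fun D (exp_poly A B).
Proof.
move=> mD; apply: measurable_funTS.
by apply: continuous_measurable_fun; apply: continuous_exp_poly.
Qed.

Lemma integral_exp_poly A B (a b : R) : a <= b ->
  (\int[mu]_(x in `[a, b]) (exp_poly (A^`() + A * B^`()) B x)%:E
    = (exp_poly A B b - exp_poly A B a)%:E)%E.
Proof.
move=> ab; apply: FTC2_is_derive => //; [exact: is_derive_exp_poly|].
exact: continuous_exp_poly.
Qed.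

End ExpPoly.

(** * The double integral squeezed by test polynomials *)

Section ExitIntegral.
Context {R : realType}.
Notation mu := (@lebesgue_measure R).
Variables (phi : {poly R}) (c : R).
Hypothesis c_gt0 : 0 < c.

Definition exit_kernel (x y : R) : R :=
  y / x * expR ((phi.[x ^+ 2] - phi.[y ^+ 2]) / c).

Definition exit_integral (xi : R) : \bar R :=
  (\int[mu]_(x in `[0%R, xi]) \int[mu]_(y in `[0%R, x]) (exit_kernel x y)%:E)%E.

(** One plus the generator on p(|z|^2): it is zero for an exact solution of the equation. *)
Definition residual (p : {poly R}) (q : R) : R :=
  1 + 2 * c * (p^`().[q] + q * p^`()^`().[q]) - 2 * q * phi^`().[q] * p^`().[q].

Lemma residual_approx (M e : R) : 0 < e ->
  exists p, forall q, 0 <= q <= M -> `|residual p q| <= e.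
Proof.
move=> e0; have [p pe] := test_poly_approx (c^-1 *: phi^`()) M c_gt0 e0.
exists p => q /pe; rewrite hornerZ /residual.
congr (`|_| <= e); field; exact: lt0r_neq0.
Qed.

Lemma exit_kernel_ge0 x y : 0 <= x -> 0 <= y -> 0 <= exit_kernel x y.
Proof. by move=> x0 y0; rewrite mulr_ge0 ?expR_ge0// divr_ge0. Qed.

Lemma measurable_exit_kernel x D : measurable D -> measurable_fun D (exit_kernel x).
Proof.
move=> mD; rewrite [exit_kernel x](_ : _ = exp_poly (x^-1 *: 'X)
  (c^-1 *: (phi.[x ^+ 2]%:P - (phi \Po 'X^2)))); first exact: measurable_exp_poly.
apply/funext => y; rewrite /exit_kernel /exp_poly hornerZ hornerX mulrC.
rewrite hornerZ hornerD hornerC hornerN horner_comp hornerXn.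
by rewrite (mulrC _ c^-1) [RHS]mulrC (mulrC x^-1).
Qed.

(** The kernel is an integrating factor of the first-order equation for p': its product with
    [1 - residual] is the y-derivative of -(c/x) y^2 p'(y^2) exp((phi(x^2) - phi(y^2))/c), which
    vanishes at y = 0. *)
Lemma integral_exit_kernel p x : 0 < x ->
  (\int[mu]_(y in `[0%R, x]) (exit_kernel x y * (1 - residual p (y ^+ 2)))%:E
    = (- c * (x * p^`().[x ^+ 2]))%:E)%E.
Proof.
move=> x0.
pose A : {poly R} := (- c / x) *: ('X^2 * (p^`() \Po 'X^2)).
pose B : {poly R} := c^-1 *: (phi.[x ^+ 2]%:P - (phi \Po 'X^2)).
have BE y : B.[y] = (phi.[x ^+ 2] - phi.[y ^+ 2]) / c.
  by rewrite hornerZ hornerD hornerC hornerN horner_comp hornerXn mulrC.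
transitivity (\int[mu]_(y in `[0%R, x]) (exp_poly (A^`() + A * B^`()) B y)%:E)%E.
  apply: eq_integral => y _; congr (_%:E); rewrite /exp_poly BE /exit_kernel.
  rewrite mulrAC; congr (_ * expR _).
  rewrite /A /B /residual !(derivZ, derivM, derivB, deriv_comp, derivC, derivX).
  rewrite !(hornerZ, hornerM, hornerD, hornerN, horner_comp, hornerX, hornerC).
  by rewrite -!expr2; field; rewrite !lt0r_neq0.
have AE y : A.[y] = - c / x * (y ^+ 2 * p^`().[y ^+ 2]).
  by rewrite hornerZ hornerM horner_comp hornerXn.
rewrite integral_exp_poly ?ltW//; congr (_%:E).
rewrite /exp_poly BE subrr mul0r expR0 !AE expr0n/= mul0r mulr0 mul0r subr0 mulr1.
by field; exact: lt0r_neq0.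
Qed.

(** The factor [1 - residual] lies between 1 - e and 1 + e and the kernel is nonnegative, so the
    exact value of the weighted integral pins down the unweighted one. *)
Lemma inner_exit_bounds p e x : 0 < x -> 0 < e < 1 ->
  (forall q, 0 <= q <= x ^+ 2 -> `|residual p q| <= e) ->
  (((1 + e)^-1 * (- c * (x * p^`().[x ^+ 2])))%:E <=
     \int[mu]_(y in `[0%R, x]) (exit_kernel x y)%:E <=
   ((1 - e)^-1 * (- c * (x * p^`().[x ^+ 2])))%:E)%E.
Proof.
move=> x0 /andP[e0 e1] pe.
rewrite (EFinM (1 + e)^-1) (EFinM (1 - e)^-1) -integral_exit_kernel//.
have k0 y : `[0%R, x]%classic y -> 0 <= exit_kernel x y.
  by rewrite /= in_itv/= => /andP[y0 _]; rewrite exit_kernel_ge0// ltW.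
have r_e y : `[0%R, x]%classic y -> `|residual p (y ^+ 2)| <= e.
  rewrite /= in_itv/= => /andP[y0 yx]; apply: pe; rewrite sqr_ge0/=.
  by rewrite ler_sqr// nnegrE ?(le_trans y0).
have mk : measurable_fun `[0%R, x] (exit_kernel x) by exact: measurable_exit_kernel.
have mr : measurable_fun `[0%R, x] (fun y => exit_kernel x y * (1 - residual p (y ^+ 2))).
  apply: measurable_funM => //; apply: measurable_funTS.
  apply: continuous_measurable_fun => y.
  rewrite /residual.
  pose Q : {poly R} := 1 + (2 * c) *: (p^`() + 'X * p^`()^`()) - 2 *: ('X * phi^`() * p^`()).
  rewrite [X in continuous_at y X](_ : _ = horner (1 - (Q \Po 'X^2))).
    exact: continuous_horner.
  apply/funext => z.
  rewrite !(hornerZ, hornerM, hornerD, hornerN, horner_comp, hornerXn, hornerC, hornerX).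
  by rewrite !mulrA.
have kr y : `[0%R, x]%classic y ->
    (1 - e) * exit_kernel x y <= exit_kernel x y * (1 - residual p (y ^+ 2))
      <= (1 + e) * exit_kernel x y.
  move=> xy; have := k0 _ xy; have := r_e _ xy; rewrite ler_norml => /andP[? ?] ?.
  by rewrite mulrC ler_wpM2l//= ?(mulrC (1 + e)) ?ler_wpM2l//; lra.
apply/andP; split.
- rewrite lee_pdivrMl; last by lra.
  rewrite -ge0_integralZl//.
  + apply: ge0_integral_le => y xy; rewrite -?EFinM !lee_fin.
      by have /andP[+ _] := kr _ xy; apply: le_trans; rewrite mulr_ge0 ?k0//; lra.
    by have /andP[] := kr _ xy.
  + exact/measurable_EFinP.
  + by rewrite lee_fin; lra.
- rewrite lee_pdivlMl; last by lra.
  rewrite -ge0_integralZl//.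
  + apply: ge0_integral_le => y xy; rewrite -?EFinM !lee_fin.
      by rewrite mulr_ge0 ?k0//; lra.
    by have /andP[] := kr _ xy.
  + exact/measurable_EFinP.
  + by rewrite lee_fin; lra.
Qed.

(** Since -c x p'(x^2) is the derivative of -(c/2) p(x^2), the outer integral yields c/2 times the
    drop of p. At x = 0 the inner domain is a point and both sides of the comparison are 0. *)
Lemma exit_integral_bounds p e xi : 0 <= xi -> 0 < e < 1 ->
  (forall q, 0 <= q <= xi ^+ 2 -> `|residual p q| <= e) ->
  (((1 + e)^-1 * (c / 2 * (p.[0] - p.[xi ^+ 2])))%:E <= exit_integral xi
    <= ((1 - e)^-1 * (c / 2 * (p.[0] - p.[xi ^+ 2])))%:E)%E.
Proof.
move=> xi0 /[dup] e01 /andP[e0 e1] pe.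
have HE k : (\int[mu]_(x in `[0%R, xi]) (k * (- c * (x * p^`().[x ^+ 2])))%:E
    = (k * (c / 2 * (p.[0] - p.[xi ^+ 2])))%:E)%E.
  pose A : {poly R} := (- k * c / 2) *: (p \Po 'X^2).
  transitivity (\int[mu]_(x in `[0%R, xi]) (exp_poly (A^`() + A * 0^`()) 0 x)%:E)%E.
    apply: eq_integral => x _; congr (_%:E).
    rewrite /exp_poly horner0 expR0 mulr1 deriv0 mulr0 addr0 derivZ deriv_comp derivXn.
    by rewrite !(hornerZ, hornerM, horner_comp, hornerXn, hornerMn) expr1; field.
  rewrite integral_exp_poly//; congr (_%:E).
  rewrite /exp_poly !horner0 expR0 !mulr1 /A !hornerZ !horner_comp !hornerXn.
  by rewrite expr0n/=; field.
have inner x : 0 < x -> x <= xi -> 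
  (((1 + e)^-1 * (- c * (x * p^`().[x ^+ 2])))%:E <=
     \int[mu]_(y in `[0%R, x]) (exit_kernel x y)%:E <=
   ((1 - e)^-1 * (- c * (x * p^`().[x ^+ 2])))%:E)%E.
  move=> x0 xxi; apply: inner_exit_bounds => // q /andP[q0 qx]; apply: pe.
  by rewrite q0 (le_trans qx)// lerXn2r ?nnegrE// ltW.
have inner0 x : `[0%R, xi]%classic x ->
    (0 <= \int[mu]_(y in `[0%R, x]) (exit_kernel x y)%:E)%E.
  rewrite /= in_itv/= => /andP[x0 _]; apply: integral_ge0 => y.
  by rewrite /= in_itv/= => /andP[y0 _]; rewrite lee_fin exit_kernel_ge0.
have H0 k x : 0 <= k -> `[0%R, xi]%classic x ->
    (0 <= (k * (- c * (x * p^`().[x ^+ 2])))%:E)%E.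
  move=> k0 xx; have := inner0 _ xx; move: xx; rewrite /= in_itv/= => /andP[].
  rewrite le_eqVlt => /predU1P[<- _ _|x0 xxi i0]; first by rewrite mul0r !mulr0.
  have /andP[_ +] := inner _ x0 xxi => /(le_trans i0).
  by rewrite !lee_fin pmulr_rge0 ?invr_gt0 ?subr_gt0// => ?; rewrite mulr_ge0.
have in0 : (\int[mu]_(y in `[0%R, 0%R]) (exit_kernel 0 y)%:E = 0)%E.
  by rewrite set_itv1 integral_set1.
apply/andP; split; rewrite -HE; apply: ge0_integral_le => // x xx.
- by apply: H0 => //; rewrite invr_ge0; lra.
- move: xx; rewrite /= in_itv/= => /andP[].
  rewrite le_eqVlt => /predU1P[<- _|x0 xxi]; last by have /andP[] := inner _ x0 xxi.
  by rewrite in0 mul0r !mulr0.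
- move: xx; rewrite /= in_itv/= => /andP[].
  rewrite le_eqVlt => /predU1P[<- _|x0 xxi]; last by have /andP[] := inner _ x0 xxi.
  by rewrite in0 mul0r !mulr0.
Qed.

End ExitIntegral.

(** * Expectations and noise *)

Section BoundedExpectation.
Context d (T : measurableType d) (R : realType) (P : probability T R).
Implicit Types f g : T -> R.

(** Truncation of the noise and stopping make every random variable of the scheme bounded. Bounded
    measurable functions are closed under the ring operations, so integrability is never argued case
    by case. *)
Definition bmeas f := measurable_fun setT f /\ exists C : R, forall w, `|f w| <= C.

Definition Ex f : R := Rintegral P setT f.

Lemma bmeas_cst (k : R) : bmeas (fun=> k).
Proof. by split => //; exists `|k|. Qed.

Lemma bmeasD f g : bmeas f -> bmeas g -> bmeas (fun w => f w + g w).
Proof.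
move=> [mf [C fC]] [mg [D gD]]; split; first exact: measurable_funD.
by exists (C + D) => w; rewrite (le_trans (ler_normD _ _))// lerD.
Qed.

Lemma bmeasM f g : bmeas f -> bmeas g -> bmeas (fun w => f w * g w).
Proof.
move=> [mf [C fC]] [mg [D gD]]; split; first exact: measurable_funM.
by exists (C * D) => w; rewrite normrM ler_pM.
Qed.

Lemma bmeasZ (k : R) f : bmeas f -> bmeas (fun w => k * f w).
Proof. exact: bmeasM (bmeas_cst k). Qed.

Lemma bmeasN f : bmeas f -> bmeas (fun w => - f w).
Proof.
move=> [mf [C fC]]; split; first exact: measurableT_comp.
by exists C => w; rewrite normrN.
Qed.

Lemma bmeasB f g : bmeas f -> bmeas g -> bmeas (fun w => f w - g w).
Proof. by move=> mf mg; apply: bmeasD => //; exact: bmeasN. Qed.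

Lemma bmeasX f n : bmeas f -> bmeas (fun w => f w ^+ n).
Proof.
move=> [mf [C fC]]; split; first exact: measurable_funX.
by exists (C ^+ n) => w; rewrite normrX lerXn2r ?nnegrE// (le_trans _ (fC w)).
Qed.

Lemma bmeas_norm f : bmeas f -> bmeas (fun w => `|f w|).
Proof.
move=> [mf [C fC]]; split; first exact: measurableT_comp.
by exists C => w; rewrite normr_id.
Qed.

Lemma bmeas_horner (p : {poly R}) f : bmeas f -> bmeas (fun w => p.[f w]).
Proof.
move=> [mf [C fC]]; split.
  apply: measurableT_comp mf; apply: continuous_measurable_fun => x.
  exact: continuous_horner.
by have [L _ pL] := horner_bounded p C; exists L => w; exact: pL.
Qed.

Lemma bmeas_sum n (F : nat -> T -> R) :
  (forall k, (k < n)%N -> bmeas (F k)) -> bmeas (fun w => \sum_(k < n) F k w).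
Proof.
elim: n => [|n IHn] mF.
  by under eq_fun do rewrite big_ord0; exact: bmeas_cst.
under eq_fun do rewrite big_ord_recr; apply: bmeasD; last exact: mF.
by apply: IHn => k kn; apply: mF; exact: ltnW.
Qed.

Lemma bmeas_integrable f : bmeas f -> P.-integrable setT (EFin \o f).
Proof.
move=> [mf [C fC]]; apply: measurable_bounded_integrable => //.
  by rewrite (le_lt_trans (probability_le1 _ _))// ltry.
exists C; split; first exact: num_real.
move=> x Cx w _ /=; exact: le_trans (fC w) (ltW Cx).
Qed.

Lemma EFin_Ex f : bmeas f -> ((Ex f)%:E = \int[P]_w (f w)%:E)%E.
Proof.
move=> mf; rewrite /Ex /Rintegral fineK//.
exact/integrable_fin_num/bmeas_integrable.
Qed.

Lemma Ex_cst (k : R) : Ex (fun=> k) = k.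
Proof. by rewrite /Ex Rintegral_cst// /= probability_setT mulr1. Qed.

Lemma ExD f g : bmeas f -> bmeas g -> Ex (fun w => f w + g w) = Ex f + Ex g.
Proof. by move=> mf mg; rewrite /Ex RintegralD//; exact: bmeas_integrable. Qed.

Lemma ExB f g : bmeas f -> bmeas g -> Ex (fun w => f w - g w) = Ex f - Ex g.
Proof. by move=> mf mg; rewrite /Ex RintegralB//; exact: bmeas_integrable. Qed.

Lemma ExZ (k : R) f : bmeas f -> Ex (fun w => k * f w) = k * Ex f.
Proof. by move=> mf; rewrite /Ex RintegralZl//; exact: bmeas_integrable. Qed.

Lemma le_Ex f g : bmeas f -> bmeas g -> (forall w, f w <= g w) -> Ex f <= Ex g.
Proof.
by move=> mf mg fg; apply: le_Rintegral => //; exact: bmeas_integrable.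
Qed.

Lemma Ex_ge0 f : (forall w, 0 <= f w) -> 0 <= Ex f.
Proof. by move=> f0; exact: Rintegral_ge0. Qed.

Lemma le_normr_Ex f g : bmeas f -> bmeas g -> (forall w, `|f w| <= g w) ->
  `|Ex f| <= Ex g.
Proof.
move=> mf mg fg; rewrite ler_norml -mulN1r -ExZ//.
apply/andP; split; apply: le_Ex => //; first exact: bmeasZ.
  by move=> w; have := fg w; rewrite ler_norml mulN1r => /andP[].
by move=> w; have := fg w; rewrite ler_norml => /andP[].
Qed.

Lemma Ex_cvg (f : nat -> T -> R) (C : R) (g : T -> R) :
  (forall n, bmeas (f n)) -> (forall n w, `|f n w| <= C) -> measurable_fun setT g ->
  {ae P, forall w, f ^~ w @ \oo --> g w} ->
  Ex (f n) @[n --> \oo] --> Ex g.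
Proof.
move=> mf fC mg fg.
have := @dominated_convergence _ _ _ P setT measurableT
  (fun n w => (f n w)%:E) (EFin \o g) (cst C%:E).
case.
- by move=> n; apply/measurable_EFinP; case: (mf n).
- exact/measurable_EFinP.
- case: fg => N [mN N0 sN]; exists N; split => // w nw; apply: sN => /= fw.
  by apply: nw => _; apply: cvg_EFin => //; exact: nearW.
- exact: (bmeas_integrable (bmeas_cst C)).
- by apply/aeW => w n _ /=; rewrite lee_fin.
- move=> ig _ cf; apply: (@fine_cvg _ _ \oo _ (fun n => (\int[P]_w (f n w)%:E)%E)).
  by rewrite fineK//; exact: integrable_fin_num ig.
Qed.

End BoundedExpectation.

(** * Expectation of a product under independence *)

Section Independence.
Context d (T : measurableType d) (R : realType) (P : probability T R).
Local Open Scope ereal_scope.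

(** The joint law agrees with the product of the two laws on rectangles, hence everywhere, and
    Fubini splits the integral of x y. *)
Lemma Ex_indep (G H : set (set T)) (X Y : T -> R) :
  independent_sigma P G H ->
  (forall B, measurable B -> G (X @^-1` B)) ->
  (forall B, measurable B -> H (Y @^-1` B)) ->
  bmeas X -> bmeas Y ->
  Ex P (fun w => X w * Y w)%R = (Ex P X * Ex P Y)%R.
Proof.
move=> GH GX HY bX bY.
have [mX [C XC]] := bX; have [mY [D YD]] := bY.
have mXY : measurable_fun setT (fun w => (X w, Y w)) by exact: measurable_fun_pair.
pose X' : {RV P >-> R} := HB.pack X (isMeasurableFun.Build _ _ _ _ X mX).
pose Y' : {RV P >-> R} := HB.pack Y (isMeasurableFun.Build _ _ _ _ Y mY).
pose m1 := distribution P X'; pose m2 := distribution P Y'.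
pose XY : {mfun T >-> (R * R)%type} :=
  HB.pack (fun w => (X w, Y w)) (isMeasurableFun.Build _ _ _ _ _ mXY).
pose m12 := distribution P XY.
have m12E A : measurable A -> (m1 \x m2) A = m12 A.
  apply: product_measure_unique => A1 A2 mA1 mA2.
  rewrite /m12 /m1 /m2 /distribution /pushforward.
  rewrite -(GH _ _ (GX _ mA1) (HY _ mA2)).
  by congr (P _); apply/seteqP; split => w /=.
pose f (z : R * R) := (z.1 * z.2)%:E.
have mf : measurable_fun setT f.
  by apply/measurable_EFinP; apply: measurable_funM;
    [exact: measurable_fst|exact: measurable_snd].
have if12 : (m1 \x m2)%E.-integrable setT f.
  apply/integrableP; split => //.
  rewrite (eq_measure_integral m12); last by move=> A mA _; exact: m12E.
  rewrite /m12 /distribution ge0_integral_pushforward//=; last first.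
    by apply/measurable_EFinP; apply: (measurableT_comp (@normr_measurable R setT)); move/measurable_EFinP: mf.
  have /integrableP[_] := bmeas_integrable P (bmeasM bX bY).
  by rewrite preimage_setT.
apply: EFin_inj; rewrite (EFin_Ex P (bmeasM bX bY)) EFinM !EFin_Ex//.
have -> : \int[P]_w (X w * Y w)%:E = \int[m12]_z f z.
  rewrite /m12 /distribution integral_pushforward//=.
  by have := bmeas_integrable P (bmeasM bX bY); rewrite preimage_setT.
rewrite (eq_measure_integral (m1 \x m2)); last by move=> A mA _; apply/esym/m12E.
rewrite -integral12_prod_meas1// /fubini_F /f /=.
have iY : m2.-integrable setT EFin.
  apply/integrable_pushforward => //; rewrite preimage_setT.
  exact: bmeas_integrable.
have iX : m1.-integrable setT EFin.
  apply/integrable_pushforward => //; rewrite preimage_setT.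
  exact: bmeas_integrable.
have EY : \int[m2]_y y%:E = \int[P]_w (Y w)%:E.
  by rewrite /m2 /distribution integral_pushforward//= preimage_setT; exact: bmeas_integrable.
have EX : \int[m1]_x x%:E = \int[P]_w (X w)%:E.
  by rewrite /m1 /distribution integral_pushforward//= preimage_setT; exact: bmeas_integrable.
under eq_integral => x _.
  under eq_integral do rewrite EFinM.
  rewrite integralZl// EY -(EFin_Ex P bY). over.
by rewrite integralZr// EX (EFin_Ex P bY).
Qed.

End Independence.

(** * Moments of truncated Gaussian increments *)

Section GaussianMoments.
Context {R : realType}.
Notation mu := (@lebesgue_measure R).

Lemma integral_normal_prob (m s : R) (f : R -> \bar R) :
  (normal_prob m s).-integrable setT f ->
  (\int[normal_prob m s]_x f x = \int[mu]_x (f x * (normal_pdf m s x)%:E))%E.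
Proof.
move=> intf; have mf := measurable_int _ intf.
rewrite -(Radon_Nikodym_change_of_variables (normal_prob_dominates m s))//=.
apply: ae_eq_integral => //.
- apply: emeasurable_funM => //; apply: (measurable_int mu).
  by apply: Radon_Nikodym_integrable => /=; exact: normal_prob_dominates.
- apply: emeasurable_funM => //; apply/measurable_EFinP.
  exact: measurable_normal_pdf.
- apply: ae_eqe_mul2l => /=.
  rewrite Radon_NikodymE//=; first exact: normal_prob_dominates.
  move=> abmu; case: cid => /= h [h1 h2 h3].
  apply: integral_ae_eq => //=.
  + by apply/measurable_EFinP; exact: measurable_normal_pdf.
  + by move=> E _ mE; rewrite -h3.
Qed.

(* The antiderivative [A * exp B] must not be evaluated at infinity, so the
   moments are those of the variable cut off outside [[-K, K]]. *)
Definition cutoff (K x : R) : R := if `|x| <= K then x else 0.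

Lemma measurable_cutoff K D : measurable D -> measurable_fun D (cutoff K).
Proof.
move=> mD; apply: measurable_funTS; rewrite /cutoff.
apply: measurable_fun_ifT => //.
by apply: measurable_fun_ler => //; exact: normr_measurable.
Qed.

Lemma cutoff_le K x : 0 <= K -> `|cutoff K x| <= K.
Proof. by move=> K0; rewrite /cutoff; case: ifP => //; rewrite normr0. Qed.

Definition gauss_exponent (h : R) : {poly R} := - (2 * h)^-1 *: 'X^2.

Lemma normal_pdf_exp_poly (h : R) (A : {poly R}) (x : R) : 0 < h ->
  A.[x] * normal_pdf 0 (Num.sqrt h) x =
  exp_poly (normal_peak (Num.sqrt h) *: A) (gauss_exponent h) x.
Proof.
move=> h0; have s0 : Num.sqrt h != 0 by rewrite gt_eqF// sqrtr_gt0.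
rewrite /normal_pdf (negbTE s0) /exp_poly hornerZ /normal_fun.
rewrite hornerZ hornerXn subr0 sqr_sqrtr ?ltW// mulrCA mulrA.
by congr (_ * expR _); rewrite -mulr_natl; field; exact: lt0r_neq0.
Qed.

Section Increment.
Context d (T : measurableType d) (P : probability T R) (D : T -> R) (h : R).
Hypothesis mD : measurable_fun setT D.
Hypothesis h_gt0 : 0 < h.
Hypothesis lawD : forall B, measurable B ->
  P (D @^-1` B) = normal_prob 0 (Num.sqrt h) B.

Let cutpoly (K : R) (A : {poly R}) (x : R) : R := if `|x| <= K then A.[x] else 0.

Let mcutpoly K A : measurable_fun setT (cutpoly K A).
Proof.
apply: measurable_fun_ifT => //.
  by apply: measurable_fun_ler => //; exact: normr_measurable.
apply: continuous_measurable_fun => x; exact: continuous_horner.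
Qed.

Let bcutpoly K A : exists C : R, forall x, `|cutpoly K A x| <= C.
Proof.
have [L L0 AL] := horner_bounded A K; exists L => x; rewrite /cutpoly.
by case: ifPn => [/AL//|_]; rewrite normr0 ltW.
Qed.

Lemma bmeas_cutpoly K A : bmeas (fun w => cutpoly K A (D w)).
Proof.
split; first exact: measurableT_comp.
by have [C AC] := bcutpoly K A; exists C => w.
Qed.

(** Gaussian integration by parts: (A' - x A / h) times the density of variance h is the derivative
    of A times the density, so only a boundary term remains. The choices A = -h, -h x and -h x^3
    give the moments of order 1, 2 and 4 below. *)
Lemma Ex_gaussian_cutoff (K : R) (A : {poly R}) : 0 <= K ->
  Ex P (fun w => cutpoly K (A^`() - h^-1 *: (A * 'X)) (D w)) =
  normal_peak (Num.sqrt h) * (A.[K] - A.[- K]) * expR (- K ^+ 2 / (2 * h)).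
Proof.
move=> K0; set A' := _ - _.
apply: EFin_inj; rewrite EFin_Ex; last exact: bmeas_cutpoly.
have mD' : @measurable_fun _ _ T (measurableTypeR R) setT D by exact: mD.
pose D' : {RV P >-> measurableTypeR R} := HB.pack D (isMeasurableFun.Build _ _ _ (measurableTypeR R) D mD').
have lawE B : measurable B -> distribution P D' B = normal_prob 0 (Num.sqrt h) B.
  by move=> mB; rewrite /distribution /pushforward -lawD.
have -> : (\int[P]_w (cutpoly K A' (D w))%:E =
    \int[distribution P D']_x (cutpoly K A' x)%:E)%E.
  rewrite /distribution integral_pushforward//=.
    by apply/measurable_EFinP; exact: mcutpoly.
  by rewrite preimage_setT; exact/bmeas_integrable/bmeas_cutpoly.
transitivity (\int[normal_prob 0 (Num.sqrt h)]_x (cutpoly K A' x)%:E)%E.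
  have := @eq_measure_integral _ _ R setT (normal_prob 0 (Num.sqrt h)) (distribution P D') (fun x => (cutpoly K A' x)%:E).
  apply=> B mB _; exact: lawE.
rewrite integral_normal_prob; last first.
  have b : @bmeas _ (measurableTypeR R) R (cutpoly K A').
    by split; [exact: mcutpoly|exact: bcutpoly].
  exact: (bmeas_integrable (normal_prob 0 (Num.sqrt h)) b).
transitivity (\int[mu]_(x in `[(- K)%R, K]) (A'.[x] * normal_pdf 0 (Num.sqrt h) x)%:E)%E.
  rewrite [RHS]integral_mkcond; apply: eq_integral => x _.
  rewrite patchE /cutpoly mem_setE in_itv/= ler_norml.
  by case: ifP => _; rewrite ?mul0e.
pose A1 := normal_peak (Num.sqrt h) *: A.
transitivity (\int[mu]_(x in `[(- K)%R, K])
    (exp_poly (A1^`() + A1 * (gauss_exponent h)^`()) (gauss_exponent h) x)%:E)%E.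
  apply: eq_integral => x _; rewrite normal_pdf_exp_poly//; congr (_%:E).
  rewrite /exp_poly /A1 /A' /gauss_exponent; congr (_ * _).
  rewrite !(derivZ, derivM, derivX) !(hornerZ, hornerM, hornerD, hornerN, hornerX, hornerC).
  by field; exact: lt0r_neq0.
rewrite integral_exp_poly; last by lra.
congr (_%:E); rewrite /exp_poly /A1 /gauss_exponent !hornerZ !hornerXn sqrrN.
have -> : - (2 * h)^-1 * K ^+ 2 = - K ^+ 2 / (2 * h) by ring.
by ring.
Qed.

Let cutpolyE (A : {poly R}) (F : R -> R) : (forall x, A.[x] = F x) ->
  forall K w, cutpoly K A (D w) = if `|D w| <= K then F (D w) else 0.
Proof. by move=> AF K w; rewrite /cutpoly AF. Qed.

Definition noise (w : T) : R := cutoff 1 (D w).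

Lemma bmeas_noise : bmeas noise.
Proof.
split; first by apply: measurableT_comp mD; exact: measurable_cutoff.
by exists 1 => w; exact: cutoff_le.
Qed.

Lemma Ex_noise : Ex P noise = 0.
Proof.
have := @Ex_gaussian_cutoff 1 (- h)%:P ler01.
rewrite !hornerC subrr mulr0 mul0r => <-; congr Ex; apply/funext => w.
rewrite (@cutpolyE _ id) // => x.
rewrite derivC hornerD horner0 hornerN hornerZ hornerM hornerC hornerX.
by field; exact: lt0r_neq0.
Qed.

Let ind K (w : T) : R := cutpoly K 1 (D w).

Let indE K w : ind K w = if `|D w| <= K then 1 else 0.
Proof. by rewrite /ind (@cutpolyE _ (fun=> 1)) // => x; rewrite hornerC. Qed.

Let Ex_sqr (K : R) : 0 <= K ->
  Ex P (fun w => cutpoly K 'X^2 (D w)) =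
  h * Ex P (ind K) - 2 * h * K * normal_peak (Num.sqrt h) * expR (- K ^+ 2 / (2 * h)).
Proof.
move=> K0; have := @Ex_gaussian_cutoff K (- h *: 'X) K0.
rewrite !hornerZ !hornerX.
set A := (X in cutpoly K X) => EA.
have AE x : A.[x] = x ^+ 2 - h.
  rewrite /A derivZ derivX !(hornerD, hornerN, hornerZ, hornerM, hornerX, hornerC).
  by field; exact: lt0r_neq0.
have -> : (fun w => cutpoly K 'X^2 (D w)) =
    (fun w => cutpoly K A (D w) + h * ind K w).
  apply/funext => w; rewrite indE (cutpolyE AE).
  rewrite (@cutpolyE _ (fun x => x ^+ 2)); last by move=> x; rewrite hornerXn.
  by case: ifP => _; lra.
rewrite ExD; [|exact: bmeas_cutpoly|exact/bmeasZ/bmeas_cutpoly].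
by rewrite EA ExZ; [ring|exact: bmeas_cutpoly].
Qed.

Let peak_ge0 : 0 <= normal_peak (Num.sqrt h).
Proof. exact: normal_peak_ge0. Qed.

Let ind_le1 K w : 0 <= ind K w <= 1.
Proof. by rewrite indE; case: ifP => _; rewrite lexx ler01. Qed.

Let Ex_ind_le1 K : Ex P (ind K) <= 1.
Proof.
rewrite -(Ex_cst P 1); apply: le_Ex; [exact: bmeas_cutpoly|exact: bmeas_cst|].
by move=> w; have /andP[] := ind_le1 K w.
Qed.

Let Ex_sqr_le (K : R) : 0 <= K -> Ex P (fun w => cutpoly K 'X^2 (D w)) <= h.
Proof.
move=> K0; rewrite Ex_sqr// lerBlDr.
apply: (@le_trans _ _ h); first by rewrite ger_pMr.
by rewrite lerDl !mulr_ge0 ?expR_ge0 ?(ltW h_gt0).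
Qed.

Let noise_sqrE : (fun w => noise w ^+ 2) = (fun w => cutpoly 1 'X^2 (D w)).
Proof.
apply/funext => w; rewrite (@cutpolyE _ (fun x => x ^+ 2)).
  by rewrite /noise /cutoff; case: ifP => // _; rewrite expr0n.
by move=> x; rewrite hornerXn.
Qed.

Lemma Ex_noise_sqr_le : Ex P (fun w => noise w ^+ 2) <= h.
Proof. by rewrite noise_sqrE Ex_sqr_le. Qed.

(** Chebyshev's inequality, from second moments that are available only under a cut-off: on 1 < |D|
    <= n the square is at least 1, so this event has probability at most h; then n tends to
    infinity. *)
Let Ex_ind1_ge : 1 - h <= Ex P (ind 1).
Proof.
have cv : Ex P (ind n%:R) @[n --> \oo] --> Ex P (cst 1 : T -> R).
  apply: (@Ex_cvg _ _ _ P (fun n => ind n%:R) 1).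
  - by move=> n; exact: bmeas_cutpoly.
  - by move=> n w; have /andP[i0 i1] := ind_le1 n%:R w; rewrite ger0_norm.
  - exact: measurable_cst.
  - apply/aeW => w; apply: cvg_near_cst.
    near=> n; rewrite indE ifT//; apply: (@le_trans _ _ (Num.truncn `|D w|).+1%:R).
      exact/ltW/truncnS_gt.
    by rewrite ler_nat; near: n; exact: nbhs_infty_ge.
rewrite Ex_cst in cv; rewrite lerBlDr.
apply: (ler_cvg_to cv (cvg_cst _)); near=> n.
have n1 : 1 <= n%:R :> R by rewrite ler1n; near: n; exact: nbhs_infty_gt.
rewrite -lerBlDl -ExB; [|exact: bmeas_cutpoly|exact: bmeas_cutpoly].
apply: le_trans (@Ex_sqr_le n%:R _); last exact: ler0n.
apply: le_Ex; [exact/bmeasB/bmeas_cutpoly/bmeas_cutpoly|exact: bmeas_cutpoly|move=> w].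
rewrite !indE (@cutpolyE _ (fun x => x ^+ 2)); last by move=> x; rewrite hornerXn.
case: (leP `|D w| n%:R) => Dn; last first.
  by case: ifP => // D1; rewrite ?subrr//; move: (le_trans D1 n1); rewrite leNgt Dn.
case: (leP `|D w| 1) => D1; first by rewrite subrr sqr_ge0.
by rewrite subr0 -[D w ^+ 2]real_normK ?num_real// exprn_ege1// ltW.
Unshelve. all: by end_near. Qed.

Hypothesis h_le1 : h <= 1.

(** The exact value is h P(|D| <= 1) - 2 h p e, with p the peak of the density and e = exp(-1/(2h)).
    The first term falls short of h by at most h^2. As p <= 1/h, and as exp(y) >= y^2/2 at y =
    1/(2h) gives e <= 8 h^2, the second is at most 16 h^2. *)
Lemma Ex_noise_sqr : `|Ex P (fun w => noise w ^+ 2) - h| <= 17 * h ^+ 2.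
Proof.
have h2 := sqr_ge0 h; have EI := Ex_ind1_ge; have EI1 := Ex_ind_le1 1.
have := Ex_noise_sqr_le; rewrite noise_sqrE Ex_sqr//.
set p := normal_peak _; set e := expR _ => Eh.
have p_le : p <= h^-1.
  rewrite /p /normal_peak lef_pV2 ?posrE//; last first.
    by rewrite sqrtr_gt0 sqr_sqrtr ?ltW// pmulrn_lgt0// mulr_gt0// pi_gt0.
  rewrite -[leLHS](ger0_norm (ltW h_gt0)) -sqrtr_sqr ler_sqrt; last first.
    by rewrite pmulrn_lge0// mulr_ge0 ?sqr_ge0// pi_ge0.
  rewrite sqr_sqrtr ?(ltW h_gt0)// expr2 -mulrnAr ler_wpM2l ?(ltW h_gt0)//.
  apply: le_trans h_le1 _; have := @pi_ge2 R; rewrite -mulr_natr; lra.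
have e_le : e <= 8 * h ^+ 2.
  rewrite /e expr1n mulNr mul1r expRN.
  have h20 : 0 < 2 * h by rewrite mulr_gt0.
  have ey := @expR_ge1Dxn R (2 * h)^-1 1 (ltW _).
  rewrite -[leRHS]invrK lef_pV2 ?posrE ?expR_gt0 ?invr_gt0 ?mulr_gt0 ?exprn_gt0//.
  apply: le_trans (ey _); last by rewrite invr_gt0.
  rewrite (_ : (2 * h)^-1 ^+ 2 / 2`!%:R = (8 * h ^+ 2)^-1) ?lerDr//.
  by rewrite (_ : 2`!%:R = 2%:R :> R)//; field; exact: lt0r_neq0.
have pe : p * e <= 8 * h.
  apply: (@le_trans _ _ (h^-1 * (8 * h ^+ 2))).
    by rewrite ler_pM// expR_ge0.
  by rewrite le_eqVlt; apply/orP; left; apply/eqP; field; exact: lt0r_neq0.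
have pe0 : 0 <= p * e by rewrite mulr_ge0 ?expR_ge0.
rewrite ler_norml; apply/andP; split; last by nra.
have h1 : h * (1 - h) <= h * Ex P (ind 1) by rewrite ler_pM2l.
have h2' : h * (p * e) <= h * (8 * h) by rewrite ler_pM2l.
nra.
Qed.

(** For A = -h x^3 the boundary term is nonpositive, which leaves 3 h times the second moment. *)
Lemma Ex_noise_pow4 : Ex P (fun w => noise w ^+ 4) <= 3 * h ^+ 2.
Proof.
have := @Ex_gaussian_cutoff 1 (- h *: 'X^3) ler01.
rewrite !hornerZ !hornerXn.
set A := (X in cutpoly _ X) => EA.
have AE x : A.[x] = x ^+ 4 - 3 * h * x ^+ 2.
  rewrite /A derivZ derivXn !(hornerD, hornerN, hornerZ, hornerM, hornerMn, hornerXn, hornerX).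
  by field; exact: lt0r_neq0.
have -> : (fun w => noise w ^+ 4) =
    (fun w => cutpoly 1 A (D w) + 3 * h * noise w ^+ 2).
  apply/funext => w; rewrite (cutpolyE AE) /noise /cutoff.
  by case: ifP => _; lra.
rewrite ExD; [|exact: bmeas_cutpoly|exact/bmeasZ/bmeasX/bmeas_noise].
rewrite ExZ; last exact/bmeasX/bmeas_noise.
have := Ex_noise_sqr_le; have : 0 <= normal_peak (Num.sqrt h) * expR (- 1 ^+ 2 / (2 * h)).
  by rewrite mulr_ge0 ?expR_ge0.
rewrite EA; move: (normal_peak _) (expR _) (Ex _ _) => p e x pe xh.
have h0 := h_gt0; have : h * x <= h * h by rewrite ler_pM2l.
have : 0 <= h * (p * e) by rewrite mulr_ge0// ltW.
rewrite !expr1n (_ : (-1) ^+ 3 = -1); last by rewrite -signr_odd.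
nra.
Qed.

End Increment.

End GaussianMoments.

(** * The stopped scheme *)

Section OneStep.
Context {R : realType}.
Implicit Types p : {poly R}.

(** By induction on the polynomial: passing from p to p X + c turns the remainder r into (q + e) r +
    p''(q) e^3 / 2. *)
Lemma poly_taylor2 p (M E : R) : exists2 K, 0 <= K &
  forall q e, `|q| <= M -> `|e| <= E ->
  `|p.[q + e] - (p.[q] + p^`().[q] * e + p^`()^`().[q] / 2 * e ^+ 2)|
    <= K * `|e| ^+ 3.
Proof.
elim/poly_ind: p => [|p c [K K0 IH]].
  exists 0 => // q e _ _; rewrite !deriv0 !horner0.
  by rewrite !mul0r !addr0 subrr normr0.
have [L L0 pL] := horner_bounded p^`()^`() M.
exists ((`|M| + `|E|) * K + L); first by rewrite addr_ge0 ?(ltW L0)// mulr_ge0.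
move=> q e qM eE; have := IH _ _ qM eE; set r := p.[q + e] - _ => rK.
rewrite !(derivD, derivM, derivX, derivC) !(hornerD, hornerM, hornerX, hornerC).
rewrite [X in `|X|](_ : _ = (q + e) * r + p^`()^`().[q] / 2 * e ^+ 3); last first.
  by rewrite /r; field.
rewrite (le_trans (ler_normD _ _))// [leRHS]mulrDl lerD//.
- rewrite normrM -mulrA ler_pM// (le_trans (ler_normD _ _))// lerD//.
    by rewrite (le_trans qM)// ler_norm.
  by rewrite (le_trans eE)// ler_norm.
- rewrite normrM normrX ler_wpM2r ?exprn_ge0// normrM.
  have := pL _ qM; have := normr_ge0 p^`()^`().[q].
  by rewrite (ger0_norm (_ : 0 <= 2^-1)) ?invr_ge0//; lra.
Qed.

Lemma normr_le_sqr (x M : R) : x ^+ 2 <= M -> `|x| <= 1 + M.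
Proof. by move=> xM; rewrite ler_norml; apply/andP; split; nra. Qed.

Lemma sqr_le_norm (x y C : R) : `|x| <= C -> `|y| <= C -> `|x * y| <= C ^+ 2.
Proof. by move=> xC yC; rewrite normrM expr2 ler_pM. Qed.

(** Only even moments of the noise are controlled, so odd powers of m are traded for even ones with
    weights in s, the square root of the time step h: m^3 against s m^2 and m^4 / s. With m^2 of
    mean order h and m^4 of mean order h^2, everything on the right has mean order h s. *)
Lemma young_bounds (s a b : R) (m := `|a| + `|b|) : 0 < s <= 1 ->
  m ^+ 3 + s ^+ 2 * m + s ^+ 4 <=
  4 * (s * (s ^+ 2 + a ^+ 2 + b ^+ 2) + (a ^+ 4 + b ^+ 4) / s).
Proof.
move=> /andP[s0 s1].
have m0 : 0 <= m by rewrite addr_ge0.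
have m2 : m ^+ 2 <= 2 * (a ^+ 2 + b ^+ 2).
  rewrite /m -(real_normK (num_real a)) -(real_normK (num_real b)).
  by have := sqr_ge0 (`|a| - `|b|); nra.
have m4 : m ^+ 4 <= 8 * (a ^+ 4 + b ^+ 4).
  have -> : m ^+ 4 = (m ^+ 2) ^+ 2 by rewrite -exprM.
  apply: (@le_trans _ _ ((2 * (a ^+ 2 + b ^+ 2)) ^+ 2)).
    by rewrite lerXn2r ?nnegrE ?mulr_ge0 ?addr_ge0 ?sqr_ge0.
  by have := sqr_ge0 (a ^+ 2 - b ^+ 2); nra.
have h1 : s ^+ 2 * m <= s * (s ^+ 2 + m ^+ 2) / 2.
  have := sqr_ge0 (s - m); nra.
have h2 : m ^+ 3 <= (s * m ^+ 2 + m ^+ 4 / s) / 2.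
  rewrite ler_pdivlMr// -(ler_pM2r s0) mulrDl mulfVK ?gt_eqF//.
  have := mulr_ge0 (sqr_ge0 m) (sqr_ge0 (s - m)); nra.
have h3 : s ^+ 4 <= s * s ^+ 2 by rewrite -exprS ler_wiXn2l// ltW.
have h4 : m ^+ 4 / s <= 8 * ((a ^+ 4 + b ^+ 4) / s).
  by rewrite mulrA ler_wpM2r// invr_ge0 ltW.
have h5 : s * m ^+ 2 <= 2 * (s * (a ^+ 2 + b ^+ 2)).
  by rewrite [leRHS]mulrCA ler_wpM2l// ltW.
have h6 : 0 <= s * (a ^+ 2 + b ^+ 2) by rewrite mulr_ge0 ?addr_ge0 ?sqr_ge0// ltW.
have h7 : 0 <= s * s ^+ 2 by rewrite mulr_ge0 ?sqr_ge0// ltW.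
have h8 : 0 <= (a ^+ 4 + b ^+ 4) / s.
  by apply: divr_ge0; [rewrite addr_ge0// exprn_even_ge0|exact: ltW].
lra.
Qed.

(** Write the increment of X^2 + Y^2 as L + g, with L linear in the noise. The expansion keeps p'
    times the leading part of L + g and p'' L^2 / 2. The error collects the cubic Taylor remainder,
    the part g1 of g of order h m and h^2, and the terms of (L + g)^2 that contain g. *)
Lemma one_step p (M B al : R) : 0 <= M -> 0 <= B -> exists2 C, 0 <= C &
  forall X Y u v a b s (h := s ^+ 2) (Q := X ^+ 2 + Y ^+ 2),
  Q <= M -> `|u| <= B -> `|v| <= B -> `|a| <= 1 -> `|b| <= 1 -> 0 < s <= 1 ->
  `|p.[(X + (h * u + al * a)) ^+ 2 + (Y + (h * v + al * b)) ^+ 2] -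
    (p.[Q] + p^`().[Q] * (2 * al * (X * a + Y * b) + 2 * h * (X * u + Y * v)
                          + al ^+ 2 * (a ^+ 2 + b ^+ 2))
     + 2 * al ^+ 2 * p^`()^`().[Q] * (X * a + Y * b) ^+ 2)|
  <= C * (s * (h + a ^+ 2 + b ^+ 2) + (a ^+ 4 + b ^+ 4) / s).
Proof.
move=> M0 B0.
(* With m = |a| + |b| these constants bound the increments: |L| <= C1 m, |g| <= G (h + m^2) and |L +
   g| <= D (m + h). As m <= 2 and h <= 1, the Taylor expansion is needed for increments up to 3
   D. *)
pose A := `|al|; pose N := 1 + M; pose C1 := 2 * A * N.
pose G := 4 * N * B + A ^+ 2 + 4 * A * B + 2 * B ^+ 2.
pose D := C1 + 2 * G.
have A0 : 0 <= A by exact: normr_ge0.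
have N0 : 0 <= N by rewrite addr_ge0.
have NB0 : 0 <= N * B by rewrite mulr_ge0.
have AB0 : 0 <= A * B by rewrite mulr_ge0.
have AN0 : 0 <= A * N by rewrite mulr_ge0.
have A20 : 0 <= A ^+ 2 by rewrite sqr_ge0.
have B20 : 0 <= B ^+ 2 by rewrite sqr_ge0.
have C10 : 0 <= C1 by rewrite /C1; lra.
have G0 : 0 <= G by rewrite /G; lra.
have D0 : 0 <= D by rewrite /D; lra.
have [K K0 pK] := poly_taylor2 p M (3 * D).
have [L1 L10 p1] := horner_bounded p^`() M.
have [L2 L20 p2] := horner_bounded p^`()^`() M.
pose C2 := 4 * K * D ^+ 3 + L1 * (2 * A * B + 2 * B ^+ 2) + L2 * (C1 * G + 2 * G ^+ 2).
have KD : 0 <= K * D ^+ 3 by rewrite mulr_ge0// exprn_ge0.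
have C20 : 0 <= C2.
  have L1p : 0 <= L1 * (2 * (A * B) + 2 * B ^+ 2) by apply: mulr_ge0; lra.
  have CG : 0 <= C1 * G by apply: mulr_ge0.
  have G2 : 0 <= G ^+ 2 by apply: sqr_ge0.
  have L2p : 0 <= L2 * (C1 * G + 2 * G ^+ 2) by apply: mulr_ge0; lra.
  by rewrite /C2; lra.
exists (4 * C2) => [|X Y u v a b s h Q QM uB vB a1 b1 s01]; first by lra.
have [s0 s1] := andP s01.
have h0 : 0 <= h by rewrite sqr_ge0.
have h1 : h <= 1 by rewrite exprn_ile1// ltW.
have hs : h = s ^+ 2 by [].
have Q0 : 0 <= Q by rewrite addr_ge0 ?sqr_ge0.
clearbody h.
have Q_M : `|Q| <= M by rewrite ger0_norm.
have XN : `|X| <= N.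
  by apply: normr_le_sqr; apply: le_trans QM; rewrite lerDl sqr_ge0.
have YN : `|Y| <= N.
  by apply: normr_le_sqr; apply: le_trans QM; rewrite lerDr sqr_ge0.
pose m := `|a| + `|b|.
have m0 : 0 <= m by rewrite addr_ge0.
have m2 : m <= 2 by rewrite /m; lra.
have hm2 : h * m <= 2 * h by rewrite mulrC ler_wpM2r.
have hm0 : 0 <= h * m by rewrite mulr_ge0.
have hh : h ^+ 2 <= h by rewrite expr2 -[leRHS]mul1r ler_wpM2r.
have hh0 : 0 <= h ^+ 2 by rewrite sqr_ge0.
have mm0 : 0 <= m ^+ 2 by rewrite sqr_ge0.
have mm : m ^+ 2 <= 2 * m by rewrite expr2 ler_wpM2r.
have ab2 : a ^+ 2 + b ^+ 2 <= m ^+ 2.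
  rewrite /m -(real_normK (num_real a)) -(real_normK (num_real b)).
  by have := mulr_ge0 (normr_ge0 a) (normr_ge0 b); nra.
have lin x y (c : R) : `|x| <= c -> `|y| <= c -> `|x * a + y * b| <= c * m.
  move=> xc yc; rewrite (le_trans (ler_normD _ _))// !normrM /m mulrDr.
  by rewrite lerD// ler_wpM2r.
pose L := 2 * al * (X * a + Y * b).
have LE : `|L| <= C1 * m.
  rewrite /L normrM [`|2 * al|]normrM ger0_norm// /C1 -!mulrA.
  by rewrite !ler_wpM2l// lin.
pose g1 := 2 * h * al * (u * a + v * b) + h ^+ 2 * (u ^+ 2 + v ^+ 2).
have uv2 : `|u ^+ 2 + v ^+ 2| <= 2 * B ^+ 2.
  rewrite (le_trans (ler_normD _ _))// !expr2.
  by have := sqr_le_norm uB uB; have := sqr_le_norm vB vB; rewrite !expr2; lra.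
have g1E : `|g1| <= 2 * A * B * (h * m) + 2 * B ^+ 2 * h ^+ 2.
  rewrite (le_trans (ler_normD _ _))// lerD//.
    rewrite !normrM (ger0_norm h0) ger0_norm//.
    rewrite [leRHS](_ : _ = 2 * h * A * (B * m)); last by ring.
    by rewrite ler_wpM2l ?mulr_ge0// lin.
  by rewrite normrM (ger0_norm hh0) mulrC ler_wpM2r.
pose g := 2 * h * (X * u + Y * v) + al ^+ 2 * (a ^+ 2 + b ^+ 2) + g1.
have gE : `|g| <= G * (h + m ^+ 2).
  have e1 : `|2 * h * (X * u + Y * v)| <= 4 * (N * B) * h.
    rewrite normrM ger0_norm ?mulr_ge0//.
    have : `|X * u + Y * v| <= 2 * (N * B).
      rewrite (le_trans (ler_normD _ _))// !normrM.
      have : `|X| * `|u| <= N * B by rewrite ler_pM.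
      have : `|Y| * `|v| <= N * B by rewrite ler_pM.
      lra.
    by move=> /(ler_wpM2l (mulr_ge0 (ler0n R 2) h0)); lra.
  have e2 : `|al ^+ 2 * (a ^+ 2 + b ^+ 2)| <= A ^+ 2 * m ^+ 2.
    rewrite normrM normrX (ger0_norm (_ : 0 <= a ^+ 2 + b ^+ 2)) ?addr_ge0 ?sqr_ge0//.
    by rewrite ler_wpM2l.
  have e3 : A * B * (h * m) <= A * B * (2 * h) by rewrite ler_wpM2l.
  have e4 : B ^+ 2 * h ^+ 2 <= B ^+ 2 * h by rewrite ler_wpM2l.
  have e5 : 0 <= (N * B) * m ^+ 2 by rewrite mulr_ge0.
  have e6 : 0 <= (A * B) * m ^+ 2 by rewrite mulr_ge0.
  have e7 : 0 <= (B ^+ 2) * m ^+ 2 by rewrite mulr_ge0.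
  have e8 : 0 <= (A ^+ 2) * h by rewrite mulr_ge0.
  rewrite (le_trans (ler_normD _ _))// (le_trans (lerD (ler_normD _ _) (lexx _)))//.
  by rewrite /G; lra.
have gE' : `|g| <= G * (h + 2 * m).
  by rewrite (le_trans gE)// ler_wpM2l// lerD2l.
have eE : `|L + g| <= D * (m + h).
  rewrite (le_trans (ler_normD _ _))//.
  have : 0 <= C1 * h by rewrite mulr_ge0.
  have : 0 <= G * h by rewrite mulr_ge0.
  by rewrite /D; lra.
have eE3 : `|L + g| <= 3 * D.
  by rewrite (le_trans eE)// [leRHS]mulrC ler_wpM2l//; lra.
have mh3 : (m + h) ^+ 3 <= 4 * (m ^+ 3 + h ^+ 3).
  by have := mulr_ge0 (addr_ge0 m0 h0) (sqr_ge0 (m - h)); nra.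
have h32 : h ^+ 3 <= h ^+ 2 by rewrite exprS ler_piMl.
have m30 : 0 <= m ^+ 3 by rewrite exprn_ge0.
have R1 : K * `|L + g| ^+ 3 <= 4 * K * D ^+ 3 * (m ^+ 3 + h ^+ 2).
  have : `|L + g| ^+ 3 <= (D * (m + h)) ^+ 3.
    by rewrite lerXn2r ?nnegrE// mulr_ge0// addr_ge0.
  rewrite exprMn => /(ler_wpM2l K0) k; apply: (le_trans k).
  rewrite [leLHS](_ : _ = K * D ^+ 3 * (m + h) ^+ 3); last by ring.
  rewrite [leRHS](_ : _ = K * D ^+ 3 * (4 * (m ^+ 3 + h ^+ 2))); last by ring.
  by rewrite ler_wpM2l//; lra.
have R2 : `|p^`().[Q] * g1| <= L1 * (2 * A * B + 2 * B ^+ 2) * (h * m + h ^+ 2).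
  rewrite normrM -mulrA ler_pM ?p1//.
  have : 0 <= A * B * h ^+ 2 by rewrite mulr_ge0.
  have : 0 <= B ^+ 2 * (h * m) by rewrite mulr_ge0.
  by lra.
have R3 : `|p^`()^`().[Q] / 2 * (2 * L * g + g ^+ 2)| <=
    L2 * (C1 * G + 2 * G ^+ 2) * (h * m + m ^+ 3 + h ^+ 2).
  have Lg : `|L * g| <= C1 * G * (h * m + m ^+ 3).
    rewrite normrM (le_trans (ler_pM _ _ LE gE))//.
    by rewrite le_eqVlt; apply/orP; left; apply/eqP; ring.
  have gg : `|g ^+ 2| <= G ^+ 2 * (4 * m ^+ 3 + 2 * h ^+ 2).
    rewrite normrX (@le_trans _ _ ((G * (h + m ^+ 2)) ^+ 2))//.
      by rewrite lerXn2r ?nnegrE// mulr_ge0// addr_ge0.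
    rewrite exprMn ler_wpM2l ?sqr_ge0//.
    have : m ^+ 2 * m ^+ 2 <= 2 * m ^+ 3.
      by have := ler_wpM2r m30 m2; lra.
    by have := sqr_ge0 (h - m ^+ 2); nra.
  rewrite [X in `|X|](_ : _ = p^`()^`().[Q] * (L * g + g ^+ 2 / 2)); last by field.
  rewrite normrM -mulrA ler_pM ?p2//.
  rewrite (le_trans (ler_normD _ _))// [`|g ^+ 2 / 2|]normrM (ger0_norm (_ : 0 <= 2^-1)) ?invr_ge0//.
  have CG0 : 0 <= C1 * G by rewrite mulr_ge0.
  have : 0 <= C1 * G * h ^+ 2 by rewrite mulr_ge0.
  have : 0 <= G ^+ 2 * (h * m) by rewrite mulr_ge0 ?sqr_ge0.
  have : 0 <= G ^+ 2 * h ^+ 2 by rewrite mulr_ge0 ?sqr_ge0.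
  by lra.
have R4 := pK _ _ Q_M eE3.
have -> : (X + (h * u + al * a)) ^+ 2 + (Y + (h * v + al * b)) ^+ 2 = Q + (L + g).
  by rewrite /Q /L /g /g1; ring.
set p0 := p.[Q + (L + g)]; set p1Q := p^`().[Q]; set p2Q := p^`()^`().[Q].
rewrite [X in `|X|](_ : _ =
    (p0 - (p.[Q] + p1Q * (L + g) + p2Q / 2 * (L + g) ^+ 2))
    + p1Q * g1 + p2Q / 2 * (2 * L * g + g ^+ 2)); last first.
  by rewrite /g /L; field.
have := young_bounds a b s01; rewrite -/m -hs => /(ler_wpM2l C20) yb.
have h4 : s ^+ 4 = h ^+ 2 by rewrite hs -exprM.
rewrite (le_trans (ler_normD _ _))// (le_trans (lerD (ler_normD _ _) (lexx _)))//.
have := lerD (lerD (le_trans R4 R1) R2) R3 => /le_trans; apply.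
rewrite [4 * C2]mulrC -(mulrA C2); apply: le_trans yb; rewrite h4 /C2.
have w1 : 0 <= K * D ^+ 3 * (h * m) by rewrite mulr_ge0.
have L1' : 0 <= L1 * (2 * A * B + 2 * B ^+ 2).
  by apply: mulr_ge0; [exact: ltW|lra].
have w2 : 0 <= L1 * (2 * A * B + 2 * B ^+ 2) * m ^+ 3 by rewrite mulr_ge0.
rewrite !mulrDl; lra.
Qed.

End OneStep.

(** * Measurability with respect to a sub-sigma-algebra *)

Section SubSigmaAlgebra.
Context d (T : measurableType d).
Implicit Types G H : set (set T).

(** Changing the measurable structure of the source makes the closure properties of measurable
    functions apply unchanged to a sub-sigma-algebra. *)
Definition meas_wrt (G : set (set T)) d' (U : measurableType d') (f : T -> U) :=
  @measurable_fun _ _ (g_sigma_algebraType G) U setT f.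

Lemma meas_wrtP G d' (U : measurableType d') (f : T -> U) :
  sigma_algebra setT G ->
  meas_wrt G f <-> (forall B, measurable B -> G (f @^-1` B)).
Proof.
move=> sG; split=> [mf B mB|mf _ B mB].
  by have := mf measurableT B mB; rewrite setTI /measurable /= sigma_algebra_id.
by rewrite setTI; apply: sub_gen_smallest; exact: mf.
Qed.

Lemma meas_wrt_sub G H d' (U : measurableType d') (f : T -> U) :
  G `<=` H -> meas_wrt G f -> meas_wrt H f.
Proof.
move=> GH mf _ B mB; have := mf measurableT B mB.
exact: (@sub_smallest2r _ _ G H) _ GH _.
Qed.

Lemma meas_wrt_measurable G d' (U : measurableType d') (f : T -> U) :
  sigma_algebra setT G -> G `<=` measurable ->
  meas_wrt G f -> measurable_fun setT f.
Proof.
move=> sG Gm mf _ B mB; rewrite setTI; apply: Gm.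
by have /(meas_wrtP _ sG)/(_ _ mB) := mf.
Qed.

Lemma meas_wrt_generated (R : realType) (H : set (T -> R)) f :
  H f -> meas_wrt (generated_sigma H) f.
Proof.
move=> Hf; apply/meas_wrtP; first exact: smallest_sigma_algebra.
move=> B mB; apply: sub_gen_smallest; exists f => //; exists B => //.
by rewrite setTI.
Qed.

End SubSigmaAlgebra.

(** * The abstract stopped scheme and its Dynkin formula *)

Section StoppedScheme.
Context d (T : measurableType d) (R : realType) (P : probability T R).
Variables (G : nat -> set (set T)).
Hypothesis G_sigma : forall k, sigma_algebra setT (G k).
Hypothesis G_meas : forall k, G k `<=` measurable.
Hypothesis G_incr : forall k, G k `<=` G k.+1.
Variables (a b xs ys u v : nat -> T -> R) (s al eta2 M B : R).
Let h := s ^+ 2.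
Hypothesis s01 : 0 < s <= 1.
Hypotheses (M_gt0 : 0 < M) (B_ge0 : 0 <= B).
Hypothesis a_meas : forall k, meas_wrt (G k.+1) (a k).
Hypothesis b_meas : forall k, meas_wrt (G k.+1) (b k).
Hypothesis xs_meas : forall k, meas_wrt (G k) (xs k).
Hypothesis ys_meas : forall k, meas_wrt (G k) (ys k).
Hypothesis u_meas : forall k, meas_wrt (G k) (u k).
Hypothesis v_meas : forall k, meas_wrt (G k) (v k).
Hypothesis a_le1 : forall k w, `|a k w| <= 1.
Hypothesis b_le1 : forall k w, `|b k w| <= 1.
Hypothesis uv_le : forall k w, xs k w ^+ 2 + ys k w ^+ 2 < eta2 ->
  `|u k w| <= B /\ `|v k w| <= B.

Let ok k (X Y : R) w := (xs k w ^+ 2 + ys k w ^+ 2 < eta2) && (X ^+ 2 + Y ^+ 2 < M).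

(** Here [xs], [ys] stand for samples of the path and [u], [v] for its drift at them. The flag falls
    when the path leaves the disc of squared radius [eta2], the event of interest, or when the
    scheme reaches squared radius [M], a guard that keeps the test polynomial on a compact set. A
    step is taken if the flag was up before it, so the first point outside is recorded; afterwards
    the state is frozen. *)
Fixpoint scheme k (w : T) : R * R * bool :=
  if k is j.+1 then
    let: (X, Y, l) := scheme j w in
    let X' := X + l%:R * (h * u j w + al * a j w) in
    let Y' := Y + l%:R * (h * v j w + al * b j w) in
    (X', Y', l && ok k X' Y' w)
  else (0, 0, ok 0 0 0 w).

Definition schX k w := (scheme k w).1.1.
Definition schY k w := (scheme k w).1.2.
Definition alive k w := (scheme k w).2.
Definition schQ k w := schX k w ^+ 2 + schY k w ^+ 2.
Definition schS k w : R := (alive k w)%:R.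

Lemma schQ_ge0 k w : 0 <= schQ k w.
Proof. by rewrite addr_ge0 ?sqr_ge0. Qed.

Lemma schX_S k w :
  schX k.+1 w = schX k w + schS k w * (h * u k w + al * a k w).
Proof. by rewrite /schX /schS /alive /=; case: (scheme k w) => -[X Y] l. Qed.

Lemma schY_S k w :
  schY k.+1 w = schY k w + schS k w * (h * v k w + al * b k w).
Proof. by rewrite /schY /schS /alive /=; case: (scheme k w) => -[X Y] l. Qed.

Lemma schSE k : schS k = fun w => if alive k w then 1 else 0.
Proof. by apply/funext => w; rewrite /schS; case: (alive k w). Qed.

Lemma alive_S k w : alive k.+1 w = alive k w &&
  ((xs k.+1 w ^+ 2 + ys k.+1 w ^+ 2 < eta2) && (schQ k.+1 w < M)).
Proof.
by rewrite /schQ /schX /schY /alive /=; case: (scheme k w) => -[X Y] l.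
Qed.

Lemma alive_lt k w : alive k w ->
  (xs k w ^+ 2 + ys k w ^+ 2 < eta2) && (schQ k w < M).
Proof. by case: k => [//|k]; rewrite alive_S => /andP[]. Qed.

Lemma alive_mono j k w : (j <= k)%N -> alive k w -> alive j w.
Proof.
move/subnK <-; elim: (k - j)%N => [//|i IH]; rewrite addSn alive_S => /andP[+ _].
exact: IH.
Qed.

Lemma scheme_meas k :
  [/\ meas_wrt (G k) (schX k), meas_wrt (G k) (schY k) & meas_wrt (G k) (alive k)].
Proof.
have mok j (X Y : T -> R) : meas_wrt (G j) X -> meas_wrt (G j) Y ->
    meas_wrt (G j) (fun w => ok j (X w) (Y w) w).
  move=> mX mY; apply: measurable_and; apply: measurable_fun_ltr => //;
    apply: measurable_funD; apply: measurable_funX.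
  - exact: xs_meas.
  - exact: ys_meas.
  - exact: mX.
  - exact: mY.
elim: k => [|k [mX mY ml]].
  split; [exact: measurable_cst|exact: measurable_cst|].
  by apply: (mok 0%N (fun=> 0) (fun=> 0)); exact: measurable_cst.
have mS : meas_wrt (G k.+1) (schS k).
  rewrite schSE; apply: measurable_fun_ifT; last 2 first.
  - exact: measurable_cst.
  - exact: measurable_cst.
  - exact: (meas_wrt_sub (@G_incr k) ml).
have mX' : meas_wrt (G k.+1) (schX k.+1).
  rewrite (_ : schX k.+1 = fun w => schX k w + schS k w * (h * u k w + al * a k w)); last first.
    by apply/funext => w; exact: schX_S.
  apply: measurable_funD; first exact: (meas_wrt_sub (@G_incr k)).
  apply: measurable_funM => //; apply: measurable_funD; apply: measurable_funM => //.
    exact: (meas_wrt_sub (@G_incr k)).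
  exact: a_meas.
have mY' : meas_wrt (G k.+1) (schY k.+1).
  rewrite (_ : schY k.+1 = fun w => schY k w + schS k w * (h * v k w + al * b k w)); last first.
    by apply/funext => w; exact: schY_S.
  apply: measurable_funD; first exact: (meas_wrt_sub (@G_incr k)).
  apply: measurable_funM => //; apply: measurable_funD; apply: measurable_funM => //.
    exact: (meas_wrt_sub (@G_incr k)).
  exact: b_meas.
split => //.
rewrite (_ : alive k.+1 = fun w => alive k w && ok k.+1 (schX k.+1 w) (schY k.+1 w) w).
  apply: measurable_and; first exact: (meas_wrt_sub (@G_incr k)).
  exact: mok.
by apply/funext => w; rewrite alive_S.
Qed.

Let bG k (f : T -> R) := @bmeas _ (g_sigma_algebraType (G k)) R f.

Lemma bmeas_wrt_bmeas k f : bG k f -> bmeas f.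
Proof.
case=> mf [C fC]; split; last by exists C.
exact: (meas_wrt_measurable (@G_sigma k) (@G_meas k)).
Qed.

Let h_ge0 : 0 <= h. Proof. exact: sqr_ge0. Qed.

Let h_le1 : h <= 1.
Proof. by case/andP: s01 => s0 s1; rewrite /h exprn_ile1// ltW. Qed.

Let s_gt0 : 0 < s. Proof. by case/andP: s01. Qed.

Lemma schS_01 k w : 0 <= schS k w <= 1.
Proof. by rewrite /schS; case: (alive k w); rewrite /= ?lexx ?ler01. Qed.

(** A living state has coordinates at most 1 + M in absolute value; the step on which it dies can
    add B + |al|. *)
Definition sch_bound := 1 + M + B + `|al|.

Lemma scheme_bound k w : `|schX k w| <= sch_bound /\ `|schY k w| <= sch_bound.
Proof.
have A0 := normr_ge0 al; have M0 := ltW M_gt0.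
elim: k => [|k [IHX IHY]].
  have : 0 <= sch_bound by rewrite /sch_bound !addr_ge0.
  by rewrite /schX /schY /= normr0.
rewrite schX_S schY_S /schS; case: (boolP (alive k w)) => [l|_]; last first.
  by rewrite !mul0r !addr0.
have /andP[xy Q] := alive_lt l; have [uB vB] := uv_le xy; rewrite !mul1r.
have X1 : `|schX k w| <= 1 + M.
  apply: normr_le_sqr; apply: le_trans (ltW Q).
  by rewrite lerDl sqr_ge0.
have Y1 : `|schY k w| <= 1 + M.
  apply: normr_le_sqr; apply: le_trans (ltW Q).
  by rewrite lerDr sqr_ge0.
have step c e : `|c| <= B -> `|e| <= 1 -> `|h * c + al * e| <= B + `|al|.
  move=> cB e1; rewrite (le_trans (ler_normD _ _))// (normrM h) (normrM al) lerD//.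
    by rewrite (ger0_norm h_ge0); apply: le_trans cB; rewrite ler_piMl.
  by rewrite ler_piMr.
have sx := step _ _ uB (a_le1 k w); have sy := step _ _ vB (b_le1 k w).
by split; rewrite (le_trans (ler_normD _ _))// /sch_bound -addrA lerD.
Qed.

Lemma bG_schX k : bG k (schX k).
Proof.
by split; [case: (scheme_meas k)|exists sch_bound => w; case: (scheme_bound k w)].
Qed.

Lemma bG_schY k : bG k (schY k).
Proof.
by split; [case: (scheme_meas k)|exists sch_bound => w; case: (scheme_bound k w)].
Qed.

Lemma bG_schS k : bG k (schS k).
Proof.
split; last first.
  by exists 1 => w; have /andP[S0 S1] := schS_01 k w; rewrite ger0_norm.
rewrite schSE; apply: measurable_fun_ifT; last 2 first.
- exact: measurable_cst.
- exact: measurable_cst.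
- by case: (scheme_meas k).
Qed.

Lemma bG_schQ k : bG k (schQ k).
Proof. by apply: bmeasD; apply: bmeasX; [exact: bG_schX|exact: bG_schY]. Qed.

Let bG_Su k : bG k (fun w => schS k w * u k w).
Proof.
split; first by apply: measurable_funM; [case: (bG_schS k)|exact: u_meas].
exists B => w; rewrite /schS; case: (boolP (alive k w)) => [l|_].
  by rewrite mul1r; have /andP[xy _] := alive_lt l; have [] := uv_le xy.
by rewrite mul0r normr0.
Qed.

Let bG_Sv k : bG k (fun w => schS k w * v k w).
Proof.
split; first by apply: measurable_funM; [case: (bG_schS k)|exact: v_meas].
exists B => w; rewrite /schS; case: (boolP (alive k w)) => [l|_].
  by rewrite mul1r; have /andP[xy _] := alive_lt l; have [] := uv_le xy.
by rewrite mul0r normr0.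
Qed.

Let bmeas_a k : bmeas (a k).
Proof. by apply: (@bmeas_wrt_bmeas k.+1); split; [exact: a_meas|exists 1]. Qed.

Let bmeas_b k : bmeas (b k).
Proof. by apply: (@bmeas_wrt_bmeas k.+1); split; [exact: b_meas|exists 1]. Qed.

(** The interface to the Wiener process: given the past, both noises are centred and uncorrelated,
    their squares factor out, and their second and fourth moments are those of variance [h] up to
    terms of order [h ^+ 2]. *)
Hypothesis Ex_ga : forall k g, bG k g -> Ex P (fun w => g w * a k w) = 0.
Hypothesis Ex_gb : forall k g, bG k g -> Ex P (fun w => g w * b k w) = 0.
Hypothesis Ex_gab : forall k g, bG k g ->
  Ex P (fun w => g w * (a k w * b k w)) = 0.
Hypothesis Ex_ga2 : forall k g, bG k g ->
  Ex P (fun w => g w * a k w ^+ 2) = Ex P g * Ex P (fun w => a k w ^+ 2).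
Hypothesis Ex_gb2 : forall k g, bG k g ->
  Ex P (fun w => g w * b k w ^+ 2) = Ex P g * Ex P (fun w => b k w ^+ 2).
Hypothesis Ex_a2 : forall k, `|Ex P (fun w => a k w ^+ 2) - h| <= 17 * h ^+ 2.
Hypothesis Ex_b2 : forall k, `|Ex P (fun w => b k w ^+ 2) - h| <= 17 * h ^+ 2.
Hypothesis Ex_a2_le : forall k, Ex P (fun w => a k w ^+ 2) <= h.
Hypothesis Ex_b2_le : forall k, Ex P (fun w => b k w ^+ 2) <= h.
Hypothesis Ex_a4 : forall k, Ex P (fun w => a k w ^+ 4) <= 3 * h ^+ 2.
Hypothesis Ex_b4 : forall k, Ex P (fun w => b k w ^+ 4) <= 3 * h ^+ 2.

Variables (p : {poly R}) (C L1 L2 : R).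
Hypotheses (C_ge0 : 0 <= C).
Hypothesis C_step : forall X Y u v a b s (h := s ^+ 2) (Q := X ^+ 2 + Y ^+ 2),
  Q <= M -> `|u| <= B -> `|v| <= B -> `|a| <= 1 -> `|b| <= 1 -> 0 < s <= 1 ->
  `|p.[(X + (h * u + al * a)) ^+ 2 + (Y + (h * v + al * b)) ^+ 2] -
    (p.[Q] + p^`().[Q] * (2 * al * (X * a + Y * b) + 2 * h * (X * u + Y * v)
                          + al ^+ 2 * (a ^+ 2 + b ^+ 2))
     + 2 * al ^+ 2 * p^`()^`().[Q] * (X * a + Y * b) ^+ 2)|
  <= C * (s * (h + a ^+ 2 + b ^+ 2) + (a ^+ 4 + b ^+ 4) / s).
Hypothesis p1_le : forall q, `|q| <= M -> `|p^`().[q]| <= L1.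
Hypothesis p2_le : forall q, `|q| <= M -> `|p^`()^`().[q]| <= L2.

(** Coefficients of the one-step expansion: [G1], [G2] of the noises, [G0] of [h], [G3], [G4] of the
    squared noises, [G5] of their product. The extra factors [schS] in [G0] do not change its value,
    but make its ingredients bounded, as the drift is bounded only while alive. *)
Let P1 k w := schS k w * p^`().[schQ k w].
Let P2 k w := schS k w * p^`()^`().[schQ k w].
Let G1 k w := 2 * al * (P1 k w * schX k w).
Let G2 k w := 2 * al * (P1 k w * schY k w).
Let G0 k w := 2 * (P1 k w * (schX k w * (schS k w * u k w) + schY k w * (schS k w * v k w))).
Let G3 k w := al ^+ 2 * P1 k w + 2 * al ^+ 2 * (P2 k w * schX k w ^+ 2).
Let G4 k w := al ^+ 2 * P1 k w + 2 * al ^+ 2 * (P2 k w * schY k w ^+ 2).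
Let G5 k w := 4 * al ^+ 2 * (P2 k w * (schX k w * schY k w)).

Let bP1 k : bG k (P1 k).
Proof. exact: (bmeasM (bG_schS k) (bmeas_horner p^`() (bG_schQ k))). Qed.
Let bP2 k : bG k (P2 k).
Proof. exact: (bmeasM (bG_schS k) (bmeas_horner p^`()^`() (bG_schQ k))). Qed.
Let bG1 k : bG k (G1 k).
Proof. exact: (bmeasZ _ (bmeasM (bP1 k) (bG_schX k))). Qed.
Let bG2 k : bG k (G2 k).
Proof. exact: (bmeasZ _ (bmeasM (bP1 k) (bG_schY k))). Qed.
Let bG0 k : bG k (G0 k).
Proof.
apply: bmeasZ; apply: bmeasM (bP1 k) _; apply: bmeasD; apply: bmeasM.
- exact: bG_schX.
- exact: bG_Su.
- exact: bG_schY.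
- exact: bG_Sv.
Qed.
Let bG3 k : bG k (G3 k).
Proof.
exact: (bmeasD (bmeasZ _ (bP1 k)) (bmeasZ _ (bmeasM (bP2 k) (bmeasX 2 (bG_schX k))))).
Qed.
Let bG4 k : bG k (G4 k).
Proof.
exact: (bmeasD (bmeasZ _ (bP1 k)) (bmeasZ _ (bmeasM (bP2 k) (bmeasX 2 (bG_schY k))))).
Qed.
Let bG5 k : bG k (G5 k).
Proof.
exact: (bmeasZ _ (bmeasM (bP2 k) (bmeasM (bG_schX k) (bG_schY k)))).
Qed.

Definition KG := al ^+ 2 * L1 + 2 * al ^+ 2 * (L2 * M).

Let M_ge0 : 0 <= M. Proof. exact: ltW. Qed.
Let L1_ge0 : 0 <= L1.
Proof. by apply: le_trans (p1_le (_ : `|0| <= M)); rewrite ?normr0. Qed.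
Let L2_ge0 : 0 <= L2.
Proof. by apply: le_trans (p2_le (_ : `|0| <= M)); rewrite ?normr0. Qed.

Let P1_le k w : `|P1 k w| <= L1.
Proof.
rewrite /P1 /schS; case: (boolP (alive k w)) => [l|_]; last by rewrite mul0r normr0.
have /andP[_ Q] := alive_lt l; rewrite mul1r; apply: p1_le.
by rewrite (ger0_norm (schQ_ge0 k w)) ltW.
Qed.

Let P2_le k w e : 0 <= e <= schQ k w -> `|P2 k w * e| <= L2 * M.
Proof.
move=> /andP[e0 eQ].
rewrite /P2 /schS; case: (boolP (alive k w)) => [l|_]; last first.
  by rewrite !mul0r normr0 mulr_ge0.
have /andP[_ Q] := alive_lt l; rewrite mul1r normrM ler_pM//.
  apply: p2_le.
  by rewrite (ger0_norm (schQ_ge0 k w)) ltW.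
by rewrite ger0_norm// (le_trans eQ) ?ltW.
Qed.

Let KG_bound k w e : 0 <= e <= schQ k w ->
  `|al ^+ 2 * P1 k w + 2 * al ^+ 2 * (P2 k w * e)| <= KG.
Proof.
move=> eQ; have al2 := sqr_ge0 al.
have al22 : 0 <= 2 * al ^+ 2 by rewrite mulr_ge0.
rewrite (le_trans (ler_normD _ _))// /KG (normrM (al ^+ 2)) (normrM (2 * al ^+ 2)).
by rewrite (ger0_norm al2) (ger0_norm al22) lerD// ler_wpM2l// P2_le.
Qed.

Let G3_le k w : `|G3 k w| <= KG.
Proof. by apply: KG_bound; rewrite sqr_ge0 lerDl sqr_ge0. Qed.
Let G4_le k w : `|G4 k w| <= KG.
Proof. by apply: KG_bound; rewrite sqr_ge0 lerDr sqr_ge0. Qed.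

Let err k w := C * (s * (h + a k w ^+ 2 + b k w ^+ 2) + (a k w ^+ 4 + b k w ^+ 4) / s).

Let lin k w := G1 k w * a k w + G2 k w * b k w + h * G0 k w + G3 k w * a k w ^+ 2
  + G4 k w * b k w ^+ 2 + G5 k w * (a k w * b k w).

Let step_le k w : `|p.[schQ k.+1 w] - p.[schQ k w] - lin k w| <= err k w.
Proof.
rewrite /err /lin /G1 /G2 /G0 /G3 /G4 /G5 /P1 /P2 /schQ schX_S schY_S /schS.
case: (boolP (alive k w)) => [l|_]; last first.
  rewrite !(mul0r, mulr0, addr0) !subrr normr0 mulr_ge0//.
  have := sqr_ge0 (a k w); have := sqr_ge0 (b k w) => b2 a2.
  apply: addr_ge0; first by apply: mulr_ge0; [exact: ltW|rewrite !addr_ge0].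
  by apply: divr_ge0; [rewrite addr_ge0// exprn_even_ge0|exact: ltW].
have /andP[xy Q] := alive_lt l; have [uB vB] := uv_le xy.
have := @C_step (schX k w) (schY k w) (u k w) (v k w) (a k w) (b k w) s (ltW Q)
  uB vB (a_le1 k w) (b_le1 k w) s01.
rewrite /schQ !mul1r -/h; congr (`|_| <= _); ring.
Qed.

Let bmeas_pQ k : bmeas (fun w => p.[schQ k w]).
Proof. exact: bmeas_wrt_bmeas (bmeas_horner p (bG_schQ k)). Qed.

Let bmeas_lin k : bmeas (lin k).
Proof.
have bw f : bG k f -> bmeas f by exact: bmeas_wrt_bmeas.
rewrite /lin; repeat apply: bmeasD.
- by apply: bmeasM; [exact: bw|exact: bmeas_a].
- by apply: bmeasM; [exact: bw|exact: bmeas_b].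
- by apply: bmeasZ; exact: bw.
- by apply: bmeasM; [exact: bw|exact/bmeasX/bmeas_a].
- by apply: bmeasM; [exact: bw|exact/bmeasX/bmeas_b].
- by apply: bmeasM; [exact: bw|apply: bmeasM].
Qed.

Let Ex_lin k : Ex P (lin k) = h * Ex P (G0 k)
  + Ex P (G3 k) * Ex P (fun w => a k w ^+ 2) + Ex P (G4 k) * Ex P (fun w => b k w ^+ 2).
Proof.
have bw f : bG k f -> bmeas f by exact: bmeas_wrt_bmeas.
have i1 : bmeas (fun w => G1 k w * a k w) by apply: bmeasM; [exact: bw|exact: bmeas_a].
have i2 : bmeas (fun w => G2 k w * b k w) by apply: bmeasM; [exact: bw|exact: bmeas_b].
have i0 : bmeas (fun w => h * G0 k w) by apply: bmeasZ; exact: bw.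
have i3 : bmeas (fun w => G3 k w * a k w ^+ 2).
  by apply: bmeasM; [exact: bw|exact/bmeasX/bmeas_a].
have i4 : bmeas (fun w => G4 k w * b k w ^+ 2).
  by apply: bmeasM; [exact: bw|exact/bmeasX/bmeas_b].
have i5 : bmeas (fun w => G5 k w * (a k w * b k w)).
  by apply: bmeasM; [exact: bw|apply: bmeasM].
have j1 := bmeasD i1 i2; have j2 := bmeasD j1 i0; have j3 := bmeasD j2 i3.
have j4 := bmeasD j3 i4.
rewrite /lin (ExD P j4 i5) (ExD P j3 i4) (ExD P j2 i3) (ExD P j1 i0) (ExD P i1 i2).
rewrite Ex_ga// Ex_gb// Ex_gab// Ex_ga2// Ex_gb2// ExZ; last exact: bw.
by rewrite !add0r addr0.
Qed.

(** The three terms of mean at most h contribute 3 h s, the fourth moments 6 h^2 / s = 6 h s. *)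
Let Ex_err k : Ex P (err k) <= 9 * C * (h * s).
Proof.
have ba := bmeas_a k; have bb := bmeas_b k.
have b2 : bmeas (fun w => h + a k w ^+ 2 + b k w ^+ 2).
  by repeat apply: bmeasD; [exact: bmeas_cst|exact: bmeasX|exact: bmeasX].
have b4 : bmeas (fun w => s^-1 * (a k w ^+ 4 + b k w ^+ 4)).
  by apply: bmeasZ; apply: bmeasD; exact: bmeasX.
have -> : err k = fun w => C * (s * (h + a k w ^+ 2 + b k w ^+ 2) +
    s^-1 * (a k w ^+ 4 + b k w ^+ 4)).
  by apply/funext => w; rewrite /err [_ / s]mulrC.
rewrite ExZ; last by apply: bmeasD => //; exact: bmeasZ.
rewrite ExD//; last exact: bmeasZ.
rewrite (ExZ _ s)// ExZ; last by apply: bmeasD; exact: bmeasX.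
rewrite !ExD//; try exact: bmeasX; try exact: bmeas_cst; last first.
  by apply: bmeasD; [exact: bmeas_cst|exact: bmeasX].
rewrite Ex_cst (mulrC 9) -mulrA; apply: ler_wpM2l => //.
have e1 : s * (h + Ex P (fun w => a k w ^+ 2) + Ex P (fun w => b k w ^+ 2)) <= s * (3 * h).
  by apply: ler_wpM2l; [exact: ltW|have := Ex_a2_le k; have := Ex_b2_le k; lra].
have e2 : s^-1 * (Ex P (fun w => a k w ^+ 4) + Ex P (fun w => b k w ^+ 4)) <=
    s^-1 * (6 * h ^+ 2).
  apply: ler_wpM2l; first by rewrite invr_ge0 ltW.
  by have := Ex_a4 k; have := Ex_b4 k; lra.
have e3 : s^-1 * (6 * h ^+ 2) = 6 * (h * s).
  by rewrite /h; field; rewrite gt_eqF.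
lra.
Qed.

(** The part [34 * KG] pays for replacing the variances of the two noises by h, at a cost of 17 h^2
    <= 17 h s each. *)
Definition step_const := 9 * C + 34 * KG.

(** The generator applied to the test function at the scheme, except that the drift is that of the
    path. *)
Let gen k w := G0 k w + G3 k w + G4 k w.

Let bgen k : bG k (gen k).
Proof. exact: (bmeasD (bmeasD (bG0 k) (bG3 k)) (bG4 k)). Qed.

Lemma scheme_step k :
  `|Ex P (fun w => p.[schQ k.+1 w]) - Ex P (fun w => p.[schQ k w]) - h * Ex P (gen k)|
   <= step_const * (h * s).
Proof.
have bw f : bG k f -> bmeas f by exact: bmeas_wrt_bmeas.
have berr : bmeas (err k).
  apply: bmeasZ; apply: bmeasD.
    apply: bmeasZ; repeat apply: bmeasD.
    - exact: bmeas_cst.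
    - exact/bmeasX/bmeas_a.
    - exact/bmeasX/bmeas_b.
  apply: bmeasM; last exact: bmeas_cst.
  by apply: bmeasD; apply: bmeasX.
have bd : bmeas (fun w => p.[schQ k.+1 w] - p.[schQ k w]) by exact: bmeasB.
have := le_normr_Ex P (bmeasB bd (bmeas_lin k)) berr (step_le k).
rewrite !ExB// Ex_lin => /le_trans/(_ (Ex_err k)) le1.
have -> : Ex P (gen k) = Ex P (G0 k) + Ex P (G3 k) + Ex P (G4 k).
  have g0 := bw _ (bG0 k); have g3 := bw _ (bG3 k); have g4 := bw _ (bG4 k).
  by rewrite /gen (ExD P (bmeasD g0 g3) g4) (ExD P g0 g3).
have g3 : `|Ex P (G3 k)| <= KG.
  by rewrite -(Ex_cst P KG); apply: le_normr_Ex; [exact: bw|exact: bmeas_cst|exact: G3_le].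
have g4 : `|Ex P (G4 k)| <= KG.
  by rewrite -(Ex_cst P KG); apply: le_normr_Ex; [exact: bw|exact: bmeas_cst|exact: G4_le].
have e3 : `|Ex P (G3 k) * (Ex P (fun w => a k w ^+ 2) - h)| <= KG * (17 * h ^+ 2).
  by rewrite normrM ler_pM.
have e4 : `|Ex P (G4 k) * (Ex P (fun w => b k w ^+ 2) - h)| <= KG * (17 * h ^+ 2).
  by rewrite normrM ler_pM.
have hs : h ^+ 2 <= h * s.
  rewrite (expr2 h); apply: ler_wpM2l => //; have [s0 s1] := andP s01.
  by rewrite /h expr2 -[leRHS]mulr1; apply: ler_wpM2l => //; exact: ltW.
have kg0 : 0 <= KG by apply: le_trans g3.
have e5 : KG * (17 * h ^+ 2) <= KG * (17 * (h * s)) by rewrite ler_wpM2l// ler_wpM2l.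
set E1 := Ex _ _ - Ex _ _ in le1 *.
rewrite [X in `|X|](_ : _ = (E1 - (h * Ex P (G0 k) +
    Ex P (G3 k) * Ex P (fun w => a k w ^+ 2) + Ex P (G4 k) * Ex P (fun w => b k w ^+ 2)))
  + Ex P (G3 k) * (Ex P (fun w => a k w ^+ 2) - h)
  + Ex P (G4 k) * (Ex P (fun w => b k w ^+ 2) - h)); last by ring.
rewrite (le_trans (ler_normD _ _))// (le_trans (lerD (ler_normD _ _) (lexx _)))//.
have := lerD (lerD le1 e3) e4 => /le_trans; apply.
by rewrite /step_const mulrDl; lra.
Qed.

Variables (phi : {poly R}) (eps : R).
Hypothesis eps_residual : forall q, 0 <= q <= M -> `|residual phi (al ^+ 2) p q| <= eps.

(** With path and scheme at the same point this would be zero, the radial drift being - q phi'(q) in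
    the squared radius q. It measures the effect of taking the drift at the path. *)
Definition drift_defect k w := schS k w * (schX k w * (schS k w * u k w)
  + schY k w * (schS k w * v k w) + schQ k w * phi^`().[schQ k w]).

Definition exit_time n w := h * \sum_(k < n) schS k w.

Definition total_defect n w := h * \sum_(k < n) `|drift_defect k w|.

Let gen_le k w : `|gen k w + schS k w| <= eps * schS k w + 2 * L1 * `|drift_defect k w|.
Proof.
have res : schS k w * `|residual phi (al ^+ 2) p (schQ k w)| <= schS k w * eps.
  rewrite /schS; case: (boolP (alive k w)) => [l|_]; last by rewrite !mul0r.
  have /andP[_ Q] := alive_lt l; rewrite !mul1r; apply: eps_residual.
  by rewrite schQ_ge0 ltW.
have /andP[S0 S1] := schS_01 k w.
have SS : schS k w * schS k w = schS k w.
  by rewrite /schS; case: (alive k w); rewrite /= ?mulr1 ?mulr0.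
have -> : gen k w + schS k w = schS k w * residual phi (al ^+ 2) p (schQ k w)
    + 2 * p^`().[schQ k w] * drift_defect k w.
  rewrite /gen /G0 /G3 /G4 /P1 /P2 /residual /drift_defect /schQ.
  move: SS; rewrite /schS; case: (alive k w) => _ /=; ring.
rewrite (le_trans (ler_normD _ _))// normrM (ger0_norm S0) [eps * _]mulrC lerD//.
have -> : 2 * p^`().[schQ k w] * drift_defect k w = 2 * P1 k w * drift_defect k w.
  by rewrite /P1 /drift_defect /schS; case: (alive k w) => /=; ring.
rewrite (normrM (2 * P1 k w)) (normrM 2) (ger0_norm (ler0n R 2)).
by apply: ler_wpM2r => //; apply: ler_wpM2l.
Qed.

Let bG_defect k : bG k (drift_defect k).
Proof.
exact: (bmeasM (bG_schS k) (bmeasD (bmeasD (bmeasM (bG_schX k) (bG_Su k))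
  (bmeasM (bG_schY k) (bG_Sv k))) (bmeasM (bG_schQ k) (bmeas_horner phi^`() (bG_schQ k))))).
Qed.

Lemma bmeas_exit_time n : bmeas (exit_time n).
Proof.
apply: bmeasZ; apply: (bmeas_sum (F := schS)) => k _.
exact: bmeas_wrt_bmeas (bG_schS k).
Qed.

Lemma bmeas_total_defect n : bmeas (total_defect n).
Proof.
apply: bmeasZ; apply: (bmeas_sum (F := fun k w => `|drift_defect k w|)) => k _.
exact: bmeas_wrt_bmeas (bmeas_norm (bG_defect k)).
Qed.

Lemma bmeas_pschQ n : bmeas (fun w => p.[schQ n w]).
Proof. exact: bmeas_pQ. Qed.

Lemma bmeas_schS n : bmeas (schS n).
Proof. exact: bmeas_wrt_bmeas (bG_schS n). Qed.

(** A living step changes the expectation of p by -h, up to the residual, the drift defect and the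
    local error; the sum over the steps telescopes. When n h is a fixed horizon, the accumulated
    local error is of order s, the square root of h. *)
Lemma discrete_dynkin n :
  `|Ex P (fun w => p.[schQ n w]) - p.[0] + Ex P (exit_time n)| <=
    eps * Ex P (exit_time n) + 2 * L1 * Ex P (total_defect n)
    + step_const * (n%:R * h * s).
Proof.
have bS k : bmeas (schS k) by exact: bmeas_schS.
have bD k : bmeas (fun w => `|drift_defect k w|).
  exact: bmeas_wrt_bmeas (bmeas_norm (bG_defect k)).
have bE k : bmeas (gen k) by exact: bmeas_wrt_bmeas (bgen k).
elim: n => [|n IH].
  have -> : (fun w => p.[schQ 0 w]) = (fun=> p.[0]).
    by apply/funext => w; rewrite /schQ /schX /schY /= expr0n addr0.
  have -> : exit_time 0 = fun=> 0 by apply/funext => w; rewrite /exit_time big_ord0 mulr0.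
  have -> : total_defect 0 = fun=> 0 by apply/funext => w; rewrite /total_defect big_ord0 mulr0.
  by rewrite !Ex_cst subrr addr0 normr0 !(mulr0, mul0r) !addr0.
have eT : Ex P (exit_time n.+1) = Ex P (exit_time n) + h * Ex P (schS n).
  rewrite -ExZ// -ExD//; [|exact: bmeas_exit_time|exact: bmeasZ].
  by congr Ex; apply/funext => w; rewrite /exit_time big_ord_recr mulrDr.
have eD : Ex P (total_defect n.+1) =
    Ex P (total_defect n) + h * Ex P (fun w => `|drift_defect n w|).
  rewrite -ExZ// -ExD//; [|exact: bmeas_total_defect|exact: bmeasZ].
  by congr Ex; apply/funext => w; rewrite /total_defect big_ord_recr mulrDr.
have st := scheme_step n.
have ge : `|Ex P (gen n) + Ex P (schS n)| <=
    eps * Ex P (schS n) + 2 * L1 * Ex P (fun w => `|drift_defect n w|).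
  rewrite -!ExZ// -!ExD//; try exact: bmeasZ.
  apply: le_normr_Ex (gen_le n); first exact: bmeasD.
  by apply: bmeasD; exact: bmeasZ.
have := ler_wpM2l h_ge0 ge; rewrite -{1}(ger0_norm h_ge0) -normrM => {}ge.
rewrite eT eD -natr1.
set q1 := Ex P (fun w => p.[schQ n.+1 w]) in st *.
set q0 := Ex P (fun w => p.[schQ n w]) in st IH *.
rewrite [X in `|X|](_ : _ = (q0 - p.[0] + Ex P (exit_time n)) +
  (q1 - q0 - h * Ex P (gen n)) + h * (Ex P (gen n) + Ex P (schS n))); last by ring.
rewrite (le_trans (ler_normD _ _))// (le_trans (lerD (ler_normD _ _) (lexx _)))//.
have := lerD (lerD IH st) ge => /le_trans; apply.
by rewrite le_eqVlt; apply/orP; left; apply/eqP; ring.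
Qed.

End StoppedScheme.

(** * The stochastic differential equation *)

Section WienerIncrements.
Context d (T : measurableType d) (R : realType) (P : probability T R).
Variables (F : R -> set (set T)) (W : R -> T -> R[i]).
Hypothesis WF : complex_wiener_wrt P F W.
Let U := re_part W.
Let V := im_part W.

Lemma filtration_sigma t : 0 <= t -> sigma_algebra setT (F t).
Proof. by case: WF => _ [s _ _] _ _; exact: s. Qed.

Lemma filtration_meas t : 0 <= t -> F t `<=` measurable.
Proof. by case: WF => _ [_ m _] _ _; exact: m. Qed.

Lemma filtration_incr s t : 0 <= s -> s <= t -> F s `<=` F t.
Proof. by case: WF => _ [_ _ i] _ _; exact: i. Qed.

Lemma adapted_re Z t : adapted F Z -> 0 <= t -> meas_wrt (F t) (re_part Z t).
Proof.
move=> aZ t0; apply: meas_wrt_sub (aZ t t0) _.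
by apply: meas_wrt_generated; left.
Qed.

Lemma adapted_im Z t : adapted F Z -> 0 <= t -> meas_wrt (F t) (im_part Z t).
Proof.
move=> aZ t0; apply: meas_wrt_sub (aZ t t0) _.
by apply: meas_wrt_generated; right.
Qed.

Section Step.
Variables (t t' : R).
Hypotheses (t_ge0 : 0 <= t) (tt' : t < t') (tt'1 : t' - t <= 1).
Let h := t' - t.
Let DU := U t' \- U t.
Let DV := V t' \- V t.
Let a := noise DU.
Let b := noise DV.

Let h_gt0 : 0 < h. Proof. by rewrite subr_gt0. Qed.
Let t'_ge0 : 0 <= t'. Proof. exact: le_trans (ltW tt'). Qed.

Let aW : adapted F W. Proof. by case: WF. Qed.

Let mU s : 0 <= s -> meas_wrt (F s) (U s). Proof. exact: adapted_re. Qed.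
Let mV s : 0 <= s -> meas_wrt (F s) (V s). Proof. exact: adapted_im. Qed.

Let wrt_measurable s (f : T -> R) : 0 <= s -> meas_wrt (F s) f -> measurable_fun setT f.
Proof.
by move=> s0; apply: meas_wrt_measurable; [exact: filtration_sigma|exact: filtration_meas].
Qed.

Let mDU : measurable_fun setT DU.
Proof.
apply: measurable_funB.
  exact: (wrt_measurable t'_ge0 (mU t'_ge0)).
exact: (wrt_measurable t_ge0 (mU t_ge0)).
Qed.

Let mDV : measurable_fun setT DV.
Proof.
apply: measurable_funB.
  exact: (wrt_measurable t'_ge0 (mV t'_ge0)).
exact: (wrt_measurable t_ge0 (mV t_ge0)).
Qed.

Lemma noise_wrt (G : set (set T)) (D : T -> R) : meas_wrt G D -> meas_wrt G (noise D).
Proof.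
move=> mD; apply: (@measurableT_comp _ _ _ (g_sigma_algebraType G) R R (cutoff 1)) mD.
exact: measurable_cutoff.
Qed.

Lemma noise_re_wrt : meas_wrt (F t') a.
Proof.
apply: noise_wrt; apply: measurable_funB; first exact: mU.
apply: meas_wrt_sub (mU t_ge0); apply: filtration_incr => //; exact: ltW.
Qed.

Lemma noise_im_wrt : meas_wrt (F t') b.
Proof.
apply: noise_wrt; apply: measurable_funB; first exact: mV.
apply: meas_wrt_sub (mV t_ge0); apply: filtration_incr => //; exact: ltW.
Qed.

Let lawU B : measurable B -> P (DU @^-1` B) = normal_prob 0 (Num.sqrt h) B.
Proof. by case: WF => -[[_ _ law _ _] _ _] _ _ _; exact: law. Qed.

Let lawV B : measurable B -> P (DV @^-1` B) = normal_prob 0 (Num.sqrt h) B.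
Proof. by case: WF => -[_ [_ _ law _ _] _] _ _ _; exact: law. Qed.

Let Hinc := generated_sigma [set DU; DV].

Let aH : meas_wrt Hinc a.
Proof. by apply: noise_wrt; apply: meas_wrt_generated; left. Qed.
Let bH : meas_wrt Hinc b.
Proof. by apply: noise_wrt; apply: meas_wrt_generated; right. Qed.

Let Ex_prod (g f : T -> R) : @bmeas _ (g_sigma_algebraType (F t)) R g ->
  meas_wrt Hinc f -> bmeas f -> Ex P (fun w => g w * f w) = Ex P g * Ex P f.
Proof.
move=> bg mf bf.
have ind : independent_sigma P (F t) Hinc by case: WF => _ _ _; exact.
apply: (Ex_indep ind) => //.
- by case: bg => mg _; apply/meas_wrtP => //; exact: filtration_sigma.
- by apply/meas_wrtP => //; exact: smallest_sigma_algebra.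
- by case: bg => mg [C gC]; split; [exact: wrt_measurable mg|exists C].
Qed.

Lemma bmeas_noise_re : bmeas a. Proof. exact: bmeas_noise. Qed.
Lemma bmeas_noise_im : bmeas b. Proof. exact: bmeas_noise. Qed.

Lemma Ex_noise_re g : @bmeas _ (g_sigma_algebraType (F t)) R g ->
  Ex P (fun w => g w * a w) = 0.
Proof.
move=> bg; rewrite (Ex_prod bg aH bmeas_noise_re).
by rewrite (Ex_noise mDU h_gt0 lawU) mulr0.
Qed.

Lemma Ex_noise_im g : @bmeas _ (g_sigma_algebraType (F t)) R g ->
  Ex P (fun w => g w * b w) = 0.
Proof.
move=> bg; rewrite (Ex_prod bg bH bmeas_noise_im).
by rewrite (Ex_noise mDV h_gt0 lawV) mulr0.
Qed.

(** Two independences are combined: that of [F t] and the pair of increments splits off g, and that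
    of the two real Wiener processes then factors the product of the noises. *)
Lemma Ex_noise_re_im g : @bmeas _ (g_sigma_algebraType (F t)) R g ->
  Ex P (fun w => g w * (a w * b w)) = 0.
Proof.
move=> bg; rewrite (@Ex_prod g (fun w => a w * b w))//; last 2 first.
- exact: (measurable_funM aH bH).
- exact: (bmeasM bmeas_noise_re bmeas_noise_im).
have ind : independent_sigma P (generated_sigma [set re_part W r | r in `[0, +oo[])
                        (generated_sigma [set im_part W r | r in `[0, +oo[]).
  by case: WF => -[_ _ i].
rewrite (Ex_indep ind) ?(Ex_noise mDU h_gt0 lawU) ?mul0r ?mulr0//.
- apply/meas_wrtP; first exact: smallest_sigma_algebra.
  apply: noise_wrt; apply: measurable_funB; apply: meas_wrt_generated.
    by exists t' => //=; rewrite in_itv/= t'_ge0.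
  by exists t => //=; rewrite in_itv/= t_ge0.
- apply/meas_wrtP; first exact: smallest_sigma_algebra.
  apply: noise_wrt; apply: measurable_funB; apply: meas_wrt_generated.
    by exists t' => //=; rewrite in_itv/= t'_ge0.
  by exists t => //=; rewrite in_itv/= t_ge0.
- exact: bmeas_noise_re.
- exact: bmeas_noise_im.
Qed.

Lemma Ex_noise_re_sqr g : @bmeas _ (g_sigma_algebraType (F t)) R g ->
  Ex P (fun w => g w * a w ^+ 2) = Ex P g * Ex P (fun w => a w ^+ 2).
Proof.
move=> bg; apply: (Ex_prod bg); first exact: (measurable_funX 2 aH).
exact: bmeasX bmeas_noise_re.
Qed.

Lemma Ex_noise_im_sqr g : @bmeas _ (g_sigma_algebraType (F t)) R g ->
  Ex P (fun w => g w * b w ^+ 2) = Ex P g * Ex P (fun w => b w ^+ 2).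
Proof.
move=> bg; apply: (Ex_prod bg); first exact: (measurable_funX 2 bH).
exact: bmeasX bmeas_noise_im.
Qed.

Lemma noise_re_moments :
  [/\ `|Ex P (fun w => a w ^+ 2) - h| <= 17 * h ^+ 2,
      Ex P (fun w => a w ^+ 2) <= h & Ex P (fun w => a w ^+ 4) <= 3 * h ^+ 2].
Proof.
by split; [exact: (Ex_noise_sqr mDU h_gt0 lawU)|exact: (Ex_noise_sqr_le mDU h_gt0 lawU)
  |exact: (Ex_noise_pow4 mDU h_gt0 lawU)].
Qed.

Lemma noise_im_moments :
  [/\ `|Ex P (fun w => b w ^+ 2) - h| <= 17 * h ^+ 2,
      Ex P (fun w => b w ^+ 2) <= h & Ex P (fun w => b w ^+ 4) <= 3 * h ^+ 2].
Proof.
by split; [exact: (Ex_noise_sqr mDV h_gt0 lawV)|exact: (Ex_noise_sqr_le mDV h_gt0 lawV)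
  |exact: (Ex_noise_pow4 mDV h_gt0 lawV)].
Qed.

End Step.
End WienerIncrements.

(** * The drift in real coordinates *)

Section Drift.
Context {R : realType}.
Variables nu om : R.
Local Open Scope complex_scope.

Definition drift_re (x y : R) : R := - nu * x - om * y
  + 2 * x * (x ^+ 2 + y ^+ 2) - x * (x ^+ 2 + y ^+ 2) ^+ 2.
Definition drift_im (x y : R) : R := - nu * y + om * x
  + 2 * y * (x ^+ 2 + y ^+ 2) - y * (x ^+ 2 + y ^+ 2) ^+ 2.

Lemma normc_sqr (x y : R) : `|x +i* y| ^+ 2 = (x ^+ 2 + y ^+ 2)%:C.
Proof.
by rewrite normc_def -rmorphXn sqr_sqrtr// addr_ge0 ?sqr_ge0.
Qed.

Lemma driftE x y : drift nu om (x +i* y) = drift_re x y +i* drift_im x y.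
Proof.
rewrite /drift (_ : 4 = 2 * 2)%N// exprM normc_sqr -rmorphXn.
by simpc; rewrite /drift_re /drift_im !mulNr.
Qed.

(** In q = R^2 this is twice the potential V without its logarithmic term. *)
Definition phi_pot : {poly R} := nu *: 'X - 'X^2 + 3^-1 *: 'X^3.

Lemma deriv_phi_pot q : phi_pot^`().[q] = nu - 2 * q + q ^+ 2.
Proof.
rewrite /phi_pot !(derivD, derivN, derivZ, derivX, derivXn).
rewrite !(hornerD, hornerN, hornerZ, hornerX, hornerXn, hornerMn, hornerC).
by rewrite /=; field.
Qed.

(** The rotation is orthogonal to the radius, so [om] cancels; this is why the mean escape time does
    not depend on it. *)
Lemma radial_drift x y : x * drift_re x y + y * drift_im x y =
  - ((x ^+ 2 + y ^+ 2) * phi_pot^`().[x ^+ 2 + y ^+ 2]).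
Proof. rewrite deriv_phi_pot /drift_re /drift_im; ring. Qed.

Lemma drift_bounded (E : R) : exists2 B, 0 <= B & forall x y,
  x ^+ 2 + y ^+ 2 <= E -> `|drift_re x y| <= B /\ `|drift_im x y| <= B.
Proof.
have [E0|E0] := ltP E 0.
  exists 0 => // x y xy; have := sqr_ge0 x; have := sqr_ge0 y; lra.
pose N := 1 + E; have N0 : 0 <= N by rewrite addr_ge0.
exists (`|nu| * N + `|om| * N + 2 * N * E + N * E ^+ 2).
  by rewrite !addr_ge0// !mulr_ge0// sqr_ge0.
move=> x y xy; set q := x ^+ 2 + y ^+ 2 in xy *.
have q0 : 0 <= q by rewrite addr_ge0 ?sqr_ge0.
have xN : `|x| <= N by apply: normr_le_sqr; apply: le_trans xy; rewrite lerDl sqr_ge0.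
have yN : `|y| <= N by apply: normr_le_sqr; apply: le_trans xy; rewrite lerDr sqr_ge0.
have bd c a b : `|a| <= N -> `|b| <= N ->
    `|c * a + b * om + 2 * a * q - a * q ^+ 2| <= `|c| * N + `|om| * N + 2 * N * E + N * E ^+ 2.
  move=> aN bN; rewrite (le_trans (ler_normB _ _))// lerD//; last first.
    rewrite normrM ler_pM// ger0_norm ?sqr_ge0// lerXn2r ?nnegrE//.
  rewrite (le_trans (ler_normD _ _))// lerD//; last first.
    by rewrite !normrM (ger0_norm (ler0n R 2)) (ger0_norm q0) ler_pM ?mulr_ge0// ler_wpM2l.
  rewrite (le_trans (ler_normD _ _))// lerD//; first by rewrite normrM ler_wpM2l.
  by rewrite normrM mulrC ler_wpM2l.
have := bd (- nu) _ _ xN (_ : `|- y| <= N); have := bd (- nu) _ _ yN xN.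
rewrite !normrN => b2 b1; split.
  by apply: le_trans (b1 yN); rewrite /drift_re -/q (mulrC om) -(mulNr y).
by apply: le_trans b2; rewrite /drift_im -/q (mulrC om).
Qed.

End Drift.

(** * Continuous functions on the half-line of nonnegative times *)

Section HalfLine.
Context {R : realType}.
Implicit Types f g : R -> R.
Notation half := (`[0%R, +oo[%classic : set R).

Lemma within_halfP f : {within half, continuous f} ->
  forall (x e : R), 0 <= x -> 0 < e -> exists2 r : R, 0 < r &
    forall s, 0 <= s -> `|x - s| < r -> `|f x - f s| < e.
Proof.
move=> /subspace_continuousP cf x e x0 e0.
have := cf x; rewrite /= in_itv/= x0 => /(_ isT)/cvgrPdist_lt/(_ e e0).
rewrite near_withinE => -[r /= r0 xr]; exists r => // s s0 xs.
by apply: (xr s) => //; rewrite in_itv/= s0.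
Qed.

Lemma within_half_unif f : {within half, continuous f} ->
  forall (t e : R), 0 < e -> exists2 r : R, 0 < r &
    forall s s', 0 <= s <= t -> 0 <= s' <= t -> `|s - s'| < r -> `|f s - f s'| < e.
Proof.
move=> cf t e e0.
have e20 : 0 < e / 2 by rewrite divr_gt0.
have /compact_near_coveringP nc := @segment_compact R 0 t.
have := nc R (0%R : R)^'+ (fun r s => 0 <= s <= t -> forall s', 0 <= s' <= t ->
  `|s - s'| < r -> `|f s - f s'| < e) _.
case=> [x|r /= r0 rP].
  rewrite /= in_itv/= => /andP[x0 xt].
  have [r r0 rP] := within_halfP cf x0 e20.
  exists (ball x (r / 2), [set y : R | y < r / 2]); first split => /=.
  - by apply: nbhsx_ballx; rewrite divr_gt0.
  - by apply: nbhs_right_lt; rewrite divr_gt0.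
  move=> [s y] /= [xs yr] /andP[s0 st] s' /andP[s'0 s't] ss'.
  have h1 : `|f x - f s| < e / 2 by apply: rP => //; apply: lt_trans xs _; lra.
  have h2 : `|f x - f s'| < e / 2.
    apply: rP => //; rewrite (_ : x - s' = (x - s) + (s - s')); last by lra.
    have xs' : `|x - s| < r / 2 by [].
    rewrite (le_lt_trans (ler_normD _ _))//; lra.
  rewrite (_ : f s - f s' = (f x - f s') - (f x - f s)); last by lra.
  rewrite (le_lt_trans (ler_normB _ _))//; lra.
exists (r / 2); first by rewrite divr_gt0.
move=> s s' st s't ss'.
have r2 : 0 < r / 2 by rewrite divr_gt0.
have := rP (r / 2); rewrite /= sub0r normrN gtr0_norm// => /(_ _ r2).
have rr : r / 2 < r by lra.
by move=> /(_ rr s); rewrite /= in_itv/= => /(_ st st s' s't ss').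
Qed.

Lemma within_half_integrable f : {within half, continuous f} ->
  forall a b : R, 0 <= a -> lebesgue_measure.-integrable `[a, b] (EFin \o f).
Proof.
move=> cf a b a0; apply: continuous_compact_integrable; first exact: segment_compact.
apply: continuous_subspaceW cf => s; rewrite /= !in_itv/= => /andP[as_ _].
by rewrite (le_trans a0).
Qed.

Lemma within_half_increment f : {within half, continuous f} ->
  forall (a b e : R), 0 <= a -> a <= b ->
  (forall s, a <= s <= b -> `|f a - f s| <= e) ->
  `|Rintegral lebesgue_measure `[0, b] f - Rintegral lebesgue_measure `[0, a] f
    - (b - a) * f a| <= (b - a) * e.
Proof.
move=> cf a b e a0 ab fe.
have iab := within_half_integrable cf b a0.
rewrite Rintegral_itvB; last 3 first.
- exact: within_half_integrable.
- by rewrite bnd_simp.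
- by rewrite bnd_simp.
rewrite Rintegral_itv_obnd_cbnd; last first.
  by apply: integrableS iab => //; apply: subset_itvr; rewrite bnd_simp.
have cst k : Rintegral (@lebesgue_measure R) `[a, b] (fun=> k) = (b - a) * k.
  rewrite Rintegral_cst// mulrC; congr (_ * _).
  by rewrite /= lebesgue_measure_itv/= lte_fin; case: ltP => [_|ba] /=; [|lra].
have icst k : lebesgue_measure.-integrable `[a, b] (EFin \o (fun=> k : R)).
  apply: continuous_compact_integrable; first exact: segment_compact.
  exact: continuous_subspaceT (fun x => @cst_continuous _ _ k x).
have iB : lebesgue_measure.-integrable `[a, b] (EFin \o (fun s => f s - f a)).
  by apply: (integrableB _ iab (icst (f a))).
rewrite -cst -RintegralB// (le_trans (le_normr_Rintegral _ iB))//.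
rewrite -cst; apply: le_Rintegral => //; first exact: integrable_abse iB.
by move=> s; rewrite /= in_itv/= => ss; rewrite distrC fe.
Qed.

Lemma within_halfM f g : {within half, continuous f} ->
  {within half, continuous g} -> {within half, continuous (fun s => f s * g s)}.
Proof. by move=> cf cg s; apply: (@continuousM R (subspace half)); [exact: cf|exact: cg]. Qed.

Lemma within_halfD f g : {within half, continuous f} ->
  {within half, continuous g} -> {within half, continuous (fun s => f s + g s)}.
Proof. by move=> cf cg s; apply: (@continuousD R _ (subspace half)); [exact: cf|exact: cg]. Qed.

Lemma within_half_cst (k : R) : {within half, continuous (fun=> k)}.
Proof. by move=> s; exact: cst_continuous. Qed.

Lemma within_halfZ (k : R) f : {within half, continuous f} ->
  {within half, continuous (fun s => k * f s)}.
Proof. by move=> cf; apply: within_halfM => //; exact: within_half_cst. Qed.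

Lemma within_half_sqrD f g : {within half, continuous f} ->
  {within half, continuous g} -> {within half, continuous (fun s => f s ^+ 2 + g s ^+ 2)}.
Proof. by move=> cf cg; apply: within_halfD; apply: within_halfM. Qed.

(** One expression serves both components of the drift: k = - nu with l = - om for the real part,
    and l = om with the two coordinates exchanged for the imaginary part. *)
Lemma within_half_drift (k l : R) f g (q := fun s => f s ^+ 2 + g s ^+ 2) :
  {within half, continuous f} -> {within half, continuous g} ->
  {within half, continuous (fun s => k * f s + l * g s + 2 * f s * q s - f s * q s ^+ 2)}.
Proof.
move=> cf cg; have cq : {within half, continuous q} by exact: within_half_sqrD.
suff : {within half, continuous (fun s =>
    k * f s + l * g s + 2 * (f s * q s) + -1 * (f s * (q s * q s)))}.
  by congr (continuous (from_subspace _ _)); apply/funext => ?; apply/funext => s; rewrite /q; ring.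
apply: within_halfD; last by apply: within_halfZ; exact: within_halfM cf (within_halfM cq cq).
apply: within_halfD; last by apply: within_halfZ; exact: within_halfM.
by apply: within_halfD; exact: within_halfZ.
Qed.

End HalfLine.

Lemma horner_lipschitz (R : realType) (p : {poly R}) (M : R) :
  exists2 L, 0 < L & forall x y, `|x| <= M -> `|y| <= M ->
    `|p.[x] - p.[y]| <= L * `|x - y|.
Proof.
elim/poly_ind: p => [|p c [L L0 IH]].
  by exists 1 => // x y _ _; rewrite !horner0 subrr normr0 mul1r.
have [K K0 pK] := horner_bounded p M.
exists (L * (1 + `|M|) + K) => [|x y xM yM].
  by rewrite addr_gt0// mulr_gt0// ltr_pwDl.
rewrite !hornerMXaddC (_ : _ - _ = (p.[x] - p.[y]) * x + p.[y] * (x - y)); last by ring.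
rewrite (le_trans (ler_normD _ _))// !normrM mulrDl lerD//; last first.
  by rewrite ler_wpM2r// pK.
rewrite mulrAC ler_pM ?IH//; apply: le_trans xM _.
by rewrite (le_trans (ler_norm _))// lerDr.
Qed.

(** * The scheme along one continuous path *)

Section SampledScheme.
Context d (T : measurableType d) (R : realType).
Variables (nu om al : R) (x y U V : R -> T -> R).

Definition increment (B : R -> T -> R) (h : R) (k : nat) : T -> R :=
  noise (B (k.+1%:R * h) \- B (k%:R * h)).
Definition sample (B : R -> T -> R) (h : R) (k : nat) : T -> R := B (k%:R * h).
Definition sample_re (h : R) (k : nat) (w : T) : R :=
  drift_re nu om (x (k%:R * h) w) (y (k%:R * h) w).
Definition sample_im (h : R) (k : nat) (w : T) : R :=
  drift_im nu om (x (k%:R * h) w) (y (k%:R * h) w).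

Variables (eta2 M : R).
Hypotheses (eta2_gt0 : 0 < eta2) (eta2M : eta2 + 1 <= M).

Local Notation sampled f h := (f (increment U h) (increment V h) (sample x h)
  (sample y h) (sample_re h) (sample_im h) (Num.sqrt h) al eta2 M).
Local Notation X h := (sampled (@schX _ T R) h).
Local Notation Y h := (sampled (@schY _ T R) h).
Local Notation Q h := (sampled (@schQ _ T R) h).
Local Notation S h := (sampled (@schS _ T R) h).
Local Notation live h := (sampled (@alive _ T R) h).
Local Notation Tm h := (sampled (@exit_time _ T R) h).
Local Notation Df h := (sampled (@total_defect _ T R) h (phi_pot nu)).

Notation half := (`[0%R, +oo[%classic : set R).

(** All that is needed of almost every path. What follows in this section is a deterministic
    statement about one such path. *)
Definition good_path (w : T) : Prop :=
  [/\ {within half, continuous (x ^~ w)} /\ {within half, continuous (y ^~ w)},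
      {within half, continuous (U ^~ w)} /\ {within half, continuous (V ^~ w)},
      x 0 w = 0 /\ y 0 w = 0,
      forall t, 0 <= t -> x t w = Rintegral lebesgue_measure `[0, t]
        (fun s => drift_re nu om (x s w) (y s w)) + al * (U t w - U 0 w) &
      forall t, 0 <= t -> y t w = Rintegral lebesgue_measure `[0, t]
        (fun s => drift_im nu om (x s w) (y s w)) + al * (V t w - V 0 w)].

Variables (w : T).
Hypothesis gw : good_path w.
Variable (t : R).
Hypothesis t_gt0 : 0 < t.

Let step (n : nat) : R := t / n.+1%:R.

Let step_gt0 n : 0 < step n. Proof. by rewrite divr_gt0. Qed.

Let step_small (r : R) : 0 < r -> exists N, forall n, (N <= n)%N -> step n < r.
Proof.
move=> r0; exists (Num.truncn (t / r)) => n Nn.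
rewrite /step ltr_pdivrMr// mulrC -ltr_pdivrMr//.
by apply: lt_le_trans (truncnS_gt _) _; rewrite ler_nat.
Qed.

Let grid n k : (k <= n.+1)%N -> 0 <= k%:R * step n <= t.
Proof.
move=> kn; rewrite mulr_ge0 ?(ltW (step_gt0 n))//= /step mulrCA ger_pMr//.
by rewrite ler_pdivrMr// mul1r ler_nat.
Qed.

Let within_drift_re : {within half, continuous (fun s => drift_re nu om (x s w) (y s w))}.
Proof.
have [[cx cy] _ _ _ _] := gw.
have := @within_half_drift _ (- nu) (- om) _ _ cx cy.
by congr (continuous (from_subspace _ _)); apply/funext => ?; apply/funext => s; rewrite /drift_re; ring.
Qed.

Let within_drift_im : {within half, continuous (fun s => drift_im nu om (x s w) (y s w))}.
Proof.
have [[cx cy] _ _ _ _] := gw.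
have := @within_half_drift _ (- nu) om _ _ cy cx.
by congr (continuous (from_subspace _ _)); apply/funext => ?; apply/funext => s; rewrite /drift_im; ring.
Qed.

Let within_q : {within half, continuous (fun s => x s w ^+ 2 + y s w ^+ 2)}.
Proof. by have [[cx cy] _ _ _ _] := gw; exact: within_half_sqrD. Qed.

Let step1 n k : k.+1%:R * step n - k%:R * step n = step n.
Proof. by rewrite -mulrBl -natr1 addrAC subrr add0r mul1r. Qed.

(* One component of the scheme: while it is alive it differs from the path
   only by the error of the left Riemann sum of the drift. *)
Let follow (B Z f : R -> T -> R) (e : R) : 0 <= e ->
  {within half, continuous (f ^~ w)} ->
  (forall s, 0 <= s -> Z s w = Rintegral lebesgue_measure `[0, s] (f ^~ w)
    + al * (B s w - B 0 w)) ->
  forall n k, (k < n.+1)%N ->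
  (forall s s', 0 <= s <= t -> 0 <= s' <= t -> `|s - s'| <= step n -> `|f s w - f s' w| <= e) ->
  (forall s s', 0 <= s <= t -> 0 <= s' <= t -> `|s - s'| <= step n -> `|B s w - B s' w| <= 1) ->
  `|step n * f (k%:R * step n) w + al * increment B (step n) k w
    - (Z (k.+1%:R * step n) w - Z (k%:R * step n) w)| <= step n * e.
Proof.
move=> e0 cf eqZ n k kn fe B1.
have g0 := @grid n k (ltnW kn); have g1 := @grid n k.+1 kn.
have /andP[k0 _] := g0; have /andP[k1 k1t] := g1.
have kk : k%:R * step n <= k.+1%:R * step n.
  by rewrite ler_wpM2r ?ler_nat// (ltW (step_gt0 n)).
have -> : increment B (step n) k w = B (k.+1%:R * step n) w - B (k%:R * step n) w.
  rewrite /increment /noise /cutoff ifT// B1// step1.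
  by rewrite gtr0_norm.
rewrite !eqZ//.
have fk : forall s, k%:R * step n <= s <= k.+1%:R * step n ->
    `|f (k%:R * step n) w - f s w| <= e.
  move=> s /andP[s0 s1]; apply: fe => //.
    by rewrite (le_trans k0)//= (le_trans s1).
  rewrite distrC ger0_norm ?subr_ge0// -(step1 n k); lra.
have := within_half_increment cf k0 kk fk.
rewrite step1 -normrN; congr (`|_| <= _); ring.
Qed.

(** On a fine mesh uniform continuity keeps the increments of [U] and [V] within 1, so the
    truncation is inactive and the one-step errors [step n * e'] merely add up, to at most t e' = e.
    Only the indices before k have to be alive, so the estimate still holds at the index of
    death. *)
Let follow_scheme (e : R) : 0 < e -> exists N, forall n k, (N <= n)%N -> (k <= n.+1)%N ->
  (forall j, (j < k)%N -> live (step n) j w) ->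
  `|X (step n) k w - x (k%:R * step n) w| <= e /\
  `|Y (step n) k w - y (k%:R * step n) w| <= e.
Proof.
move=> e0; have [[cx cy] [cU cV] [x0 y0] eqx eqy] := gw.
pose e' := e / t; have e'0 : 0 < e' by rewrite divr_gt0.
have [r1 r10 u1] := within_half_unif within_drift_re t e'0.
have [r2 r20 u2] := within_half_unif within_drift_im t e'0.
have [r3 r30 u3] := within_half_unif cU t ltr01.
have [r4 r40 u4] := within_half_unif cV t ltr01.
have r0 : 0 < Num.min (Num.min r1 r2) (Num.min r3 r4) by rewrite !lt_min r10 r20 r30.
have [N Nr] := step_small r0; exists N => n k /Nr; rewrite !lt_min.
move=> /andP[/andP[n1 n2] /andP[n3 n4]] kn.
have s2 : Num.sqrt (step n) ^+ 2 = step n by rewrite sqr_sqrtr// ltW.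
suff : (forall j, (j < k)%N -> live (step n) j w) ->
  `|X (step n) k w - x (k%:R * step n) w| <= k%:R * (step n * e') /\
  `|Y (step n) k w - y (k%:R * step n) w| <= k%:R * (step n * e').
  move=> H /H[H1 H2]; have [_ g] := andP (grid kn).
  have le : k%:R * (step n * e') <= e.
    rewrite /e' (_ : _ * _ = k%:R * step n * e / t); last by ring.
    by rewrite ler_pdivrMr// mulrC ler_wpM2l// ltW.
  by split; [exact: le_trans H1 _|exact: le_trans H2 _].
elim: k kn => [|k IH] kn ak.
  by rewrite !mul0r x0 y0 /schX /schY /= subrr normr0.
have [IH1 IH2] := IH (ltnW kn) (fun j jk => ak j (ltnW jk)).
have Sk : S (step n) k w = 1 by rewrite /schS ak.
have F1 := @follow U x (fun s w => drift_re nu om (x s w) (y s w)) e' (ltW e'0) within_drift_re eqx n k kn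
  (fun s s' a b c => ltW (u1 s s' a b (le_lt_trans c n1)))
  (fun s s' a b c => ltW (u3 s s' a b (le_lt_trans c n3))).
have F2 := @follow V y (fun s w => drift_im nu om (x s w) (y s w)) e' (ltW e'0) within_drift_im eqy n k kn
  (fun s s' a b c => ltW (u2 s s' a b (le_lt_trans c n2)))
  (fun s s' a b c => ltW (u4 s s' a b (le_lt_trans c n4))).
rewrite schX_S schY_S Sk !mul1r s2; split.
- rewrite [G in `|G|](_ : _ = (X (step n) k w - x (k%:R * step n) w) +
    (step n * sample_re (step n) k w + al * increment U (step n) k w
     - (x (k.+1%:R * step n) w - x (k%:R * step n) w))); last by ring.
  by rewrite (le_trans (ler_normD _ _))// -[k.+1%:R in leRHS]natr1 (mulrDl k%:R) mul1r lerD.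
- rewrite [G in `|G|](_ : _ = (Y (step n) k w - y (k%:R * step n) w) +
    (step n * sample_im (step n) k w + al * increment V (step n) k w
     - (y (k.+1%:R * step n) w - y (k%:R * step n) w))); last by ring.
  by rewrite (le_trans (ler_normD _ _))// -[k.+1%:R in leRHS]natr1 (mulrDl k%:R) mul1r lerD.
Qed.

Let q (s : R) : R := x s w ^+ 2 + y s w ^+ 2.

Let sqr_dist (a b N e : R) : `|b| <= N -> `|a - b| <= e -> e <= 1 ->
  `|a ^+ 2 - b ^+ 2| <= e * (2 * N + 1).
Proof.
move=> bN abe e1; rewrite subr_sqr normrM ler_pM//.
rewrite (_ : a + b = (a - b) + 2 * b); last by ring.
rewrite (le_trans (ler_normD _ _))// normrM (ger0_norm (ler0n R 2)); lra.
Qed.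

(** The sample before k lies inside the disc, so on a fine mesh the path overshoots [eta2] by at
    most e, even at the index of death. *)
Let follow_sqr (e : R) : 0 < e -> exists N, forall n k, (N <= n)%N -> (k <= n.+1)%N ->
  (forall j, (j < k)%N -> live (step n) j w) ->
  q (k%:R * step n) <= eta2 + e /\ `|Q (step n) k w - q (k%:R * step n)| <= e.
Proof.
move=> e0; pose e1 := Num.min e 1.
have e10 : 0 < e1 by rewrite lt_min e0 ltr01.
have e1e : e1 <= e by rewrite ge_min lexx.
have e11 : e1 <= 1 by rewrite ge_min lexx orbT.
(* A squared modulus of at most 1 + eta2 bounds the coordinates by [N0], through [normr_le_sqr];
   each of the two squares then varies by at most 2 N0 + 1 times the distance. *)
pose N0 := 2 + eta2.
pose D := 2 * (2 * N0 + 1).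
have eta0 := eta2_gt0.
have D1 : 1 <= D by rewrite /D /N0; lra.
have D0 : 0 < D by lra.
pose e2 := e1 / D; have e20 : 0 < e2 by rewrite divr_gt0.
have e21 : e2 <= 1 by rewrite ler_pdivrMr// mul1r (le_trans e11).
have [r r0 ur] := within_half_unif within_q t e10.
have [N1 Nr] := step_small r0; have [N2 fol] := follow_scheme e20.
exists (maxn N1 N2) => n k; rewrite geq_max => /andP[/Nr nr nN2] kn ak.
have qk : q (k%:R * step n) <= eta2 + e1.
  case: k kn ak => [|k] kn ak.
    have [_ _ [x0 y0] _ _] := gw.
    by rewrite mul0r /q x0 y0 expr0n /= addr0 ltW// addr_gt0.
  have /alive_lt/andP[qe _] := ak k (ltnSn k).
  have := ur _ _ (grid (ltnW kn)) (grid kn).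
  rewrite distrC step1 gtr0_norm// => /(_ nr); rewrite ltr_norml => /andP[+ _].
  move: qe; rewrite /sample /q; lra.
have [Xx Yy] := fol n k nN2 kn ak; split; first lra.
have q2 : q (k%:R * step n) <= 1 + eta2 by lra.
have xN : `|x (k%:R * step n) w| <= N0.
  rewrite /N0 (_ : 2 + eta2 = 1 + (1 + eta2)); last by ring.
  by apply: normr_le_sqr; apply: le_trans q2; rewrite lerDl sqr_ge0.
have yN : `|y (k%:R * step n) w| <= N0.
  rewrite /N0 (_ : 2 + eta2 = 1 + (1 + eta2)); last by ring.
  by apply: normr_le_sqr; apply: le_trans q2; rewrite lerDr sqr_ge0.
have := sqr_dist xN Xx e21; have := sqr_dist yN Yy e21.
have e2D : 2 * (e2 * (2 * N0 + 1)) = e1.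
  by rewrite mulrCA -/D /e2 mulfVK ?gt_eqF.
rewrite /schQ /q => h1 h2.
rewrite opprD addrACA (le_trans (ler_normD _ _))//; lra.
Qed.

Let first_dead h m : (forall j, (j < m)%N -> live h j w) \/
  exists k, [/\ (k < m)%N, ~~ live h k w & forall j, (j < k)%N -> live h j w].
Proof.
elim: m => [|m [IH|[k [km dk ak]]]]; first by left.
  case: (boolP (live h m w)) => lm; last by right; exists m.
  by left => j; rewrite ltnS leq_eqVlt => /predU1P[->//|]; exact: IH.
by right; exists k; split => //; exact: ltnW.
Qed.

Let dead_mono h k m : ~~ live h k w -> (k <= m)%N -> ~~ live h m w.
Proof. by move=> dk km; apply: contra dk; exact: alive_mono. Qed.

Let step_sqrt n : Num.sqrt (step n) ^+ 2 = step n.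
Proof. by rewrite sqr_sqrtr// ltW. Qed.

Let sum_live h m k : (k <= m)%N -> (forall j, (j < k)%N -> live h j w) ->
  (forall j, (k <= j)%N -> (j < m)%N -> ~~ live h j w) -> \sum_(j < m) S h j w = k%:R.
Proof.
move=> km ak dk; rewrite -(big_mkord xpredT (fun j => S h j w)) (big_cat_nat (leq0n k) km)//=.
rewrite [E in _ + E]big_nat_cond [E in _ + E]big1 ?addr0; last first.
  by move=> j /andP[/andP[kj jm] _]; rewrite /schS (negbTE (dk _ kj jm)).
rewrite big_nat_cond (eq_bigr (fun=> 1)); last first.
  by move=> j /andP[/andP[_ jk] _]; rewrite /schS ak.
by rewrite -big_nat_cond big_const_nat subn0 iter_addr_0.
Qed.

Lemma exit_timeE n :
  (forall j, (j < n.+1)%N -> live (step n) j w) /\ Tm (step n) n.+1 w = t \/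
  exists k, [/\ (k <= n)%N, ~~ live (step n) k w,
    forall j, (j < k)%N -> live (step n) j w & Tm (step n) n.+1 w = k%:R * step n].
Proof.
rewrite /exit_time step_sqrt; case: (first_dead (step n) n.+1) => [ak|[k [kn dk ak]]].
  left; split => //; rewrite (@sum_live _ _ n.+1)//; last by move=> j nj; rewrite ltnNge nj.
  by rewrite /step mulfVK// pnatr_eq0.
right; exists k; split=> //; rewrite (@sum_live _ _ k) 1?mulrC// 1?ltnW//.
by move=> j kj _; exact: dead_mono kj.
Qed.

Lemma exit_time_le n : 0 <= Tm (step n) n.+1 w <= t.
Proof.
case: (exit_timeE n) => [[_ ->]|[k [kn _ _ ->]]]; first by rewrite lexx ltW.
by apply: grid; exact: leqW.
Qed.

Lemma exit_time_dead n k : ~~ live (step n) k w -> Tm (step n) n.+1 w <= k%:R * step n.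
Proof.
move=> dk; have [|nk] := leqP k n.+1; last first.
  have /andP[_ /le_trans] := exit_time_le n; apply.
  apply: (@le_trans _ _ (n.+1%:R * step n)).
    by rewrite mulrC /step mulfVK// pnatr_eq0.
  by rewrite ler_wpM2r ?(ltW (step_gt0 n))// ler_nat ltnW.
case: (exit_timeE n) => [[ak ->]|[j [jn dj aj ->]]] kn.
  have /eqP -> : k == n.+1 by rewrite eqn_leq kn leqNgt; apply/negP => /ak; apply/negP.
  by rewrite mulrC /step mulfVK// pnatr_eq0.
rewrite ler_wpM2r ?(ltW (step_gt0 n))// ler_nat leqNgt; apply/negP => /aj.
by apply/negP.
Qed.

Let live0 h : live h 0 w.
Proof.
have [_ _ [x0 y0] _ _] := gw.
rewrite /alive /= /sample mul0r x0 y0 expr0n /= addr0 eta2_gt0 /=.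
by apply: lt_le_trans eta2M; rewrite addr_gt0.
Qed.

(** Death through the guard [M] also implies that the path is outside: on a fine mesh scheme and
    path differ by at most 1/2 in squared modulus, whereas M >= eta2 + 1. *)
Lemma exit_time_hits : exists N, forall n, (N <= n)%N ->
  Tm (step n) n.+1 w = t \/
  0 < Tm (step n) n.+1 w <= t /\ eta2 <= q (Tm (step n) n.+1 w).
Proof.
have h20 : 0 < 2^-1 :> R by rewrite invr_gt0.
have [N fol] := follow_sqr h20; exists N => n Nn.
case: (exit_timeE n) => [[_ ->]|[k [kn dk ak ->]]]; [by left|right].
case: k kn dk ak => [|k] kn dk ak; first by rewrite live0 in dk.
have [_ Qq] := fol n k.+1 Nn (leqW kn) ak.
have /andP[_ ->] := @grid n k.+1 (leqW kn); rewrite mulr_gt0//; split => //.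
move: dk; rewrite alive_S ak//= negb_and -!leNgt /sample => /orP[//|MQ].
move: Qq; rewrite ler_norml => /andP[_]; move: MQ eta2M; rewrite -/(q _); lra.
Qed.

Let frozen h k m : (k <= m)%N -> ~~ live h k w ->
  X h m w = X h k w /\ Y h m w = Y h k w.
Proof.
move/subnK <- => dk; elim: (m - k)%N => [//|i [IHX IHY]].
rewrite addSn schX_S schY_S /schS (negbTE (dead_mono dk _)) ?leq_addl//.
by rewrite !mul0r !addr0.
Qed.

(** At the index of death the squared modulus of the scheme is within 3 e' of [eta2], and freezing
    keeps it there, so p has nearly its boundary value. The factor [1 - S] restricts the claim to
    paths that die within the horizon. *)
Lemma final_value (p : {poly R}) (e : R) : 0 < e -> exists N, forall n, (N <= n)%N ->
  (1 - S (step n) n.+1 w) * `|p.[Q (step n) n.+1 w] - p.[eta2]| <= e.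
Proof.
move=> e0; have [L L0 pL] := horner_lipschitz p (eta2 + 2).
pose e' := Num.min 1 (e / (L * 3)).
have e'0 : 0 < e' by rewrite lt_min ltr01 divr_gt0// mulr_gt0.
have e'1 : e' <= 1 by rewrite ge_min lexx.
have e'e : e' <= e / (L * 3) by rewrite ge_min lexx orbT.
have [N fol] := follow_sqr e'0; exists N => n Nn.
rewrite /schS; case: (boolP (live (step n) n.+1 w)) => [_|dn].
  by rewrite subrr mul0r ltW.
rewrite subr0 mul1r.
case: (first_dead (step n) n.+2) => [ak|[k [kn dk ak]]]; first by rewrite ak in dn.
have kn' : (k <= n.+1)%N by [].
have [XE YE] := frozen kn' dk.
have -> : Q (step n) n.+1 w = Q (step n) k w by rewrite /schQ XE YE.
have [q1 Qq] := fol n k Nn kn' ak.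
have q2 : eta2 - e' <= q (k%:R * step n).
  case: k kn kn' dk ak {XE YE} q1 Qq => [|k] kn kn' dk ak q1 Qq; first by rewrite live0 in dk.
  move: dk; rewrite alive_S ak//= negb_and -!leNgt /sample -/(q _) => /orP[|MQ]; first lra.
  move: Qq; rewrite ler_norml => /andP[_]; move: MQ eta2M; lra.
have Qe : `|Q (step n) k w - eta2| <= 3 * e'.
  move: Qq; rewrite !ler_norml => /andP[? ?]; apply/andP; split; lra.
have QM : `|Q (step n) k w| <= eta2 + 2.
  move: Qq; rewrite !ler_norml => /andP[? ?]; apply/andP; split; last lra.
  by have := schQ_ge0 (increment U (step n)) (increment V (step n)) (sample x (step n))
    (sample y (step n)) (sample_re (step n)) (sample_im (step n)) (Num.sqrt (step n))
    al eta2 M k w; lra.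
apply: le_trans (pL _ _ QM _) _; first by rewrite gtr0_norm//; lra.
apply: (@le_trans _ _ (L * (3 * e'))); first by rewrite ler_pM2l.
by rewrite mulrA mulrC -ler_pdivlMr// mulr_gt0.
Qed.

(** By continuity the path is still outside at the first grid point after s. This is where strict
    crossing matters: a path may touch the circle between two grid points and turn back. *)
Lemma exit_time_le_hit (s : R) : 0 < s -> eta2 < q s -> forall e : R, 0 < e ->
  exists N, forall n, (N <= n)%N -> Tm (step n) n.+1 w <= s + e.
Proof.
move=> s0 qs e e0.
have qs0 : 0 < q s - eta2 by rewrite subr_gt0.
have [r r0 rq] := within_halfP within_q (ltW s0) qs0.
have re0 : 0 < Num.min r e by rewrite lt_min r0.
have [N Nr] := step_small re0; exists N => n /Nr; rewrite lt_min => /andP[nr ne].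
pose k := (Num.truncn (s / step n)).+1.
have k1 : s < k%:R * step n by rewrite -ltr_pdivrMr// truncnS_gt.
have k2 : k%:R * step n <= s + step n.
  rewrite /k -natr1 mulrDl mul1r lerD2r -ler_pdivlMr//.
  by rewrite truncn_le divr_ge0 ?(ltW s0) ?(ltW (step_gt0 n)).
apply: le_trans (exit_time_dead (k := k) _) _; last by lra.
apply/negP => /alive_lt/andP[+ _]; rewrite /sample -/(q _) ltNge => /negP; apply.
have := rq (k%:R * step n); rewrite ltr0_norm ?subr_lt0// => /(_ _ _).
have c1 : 0 <= k%:R * step n by lra.
have c2 : - (s - k%:R * step n) < r by lra.
by move=> /(_ c1 c2); rewrite -/(q _) -/(q _) ltr_norml => /andP[_]; lra.
Qed.

(** With psi(q) = q phi'(q), [radial_drift] turns the defect into (X - x) u + (Y - y) v + psi(Q) -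
    psi(q). The bound of the drift serves the first two terms, Lipschitz continuity of psi the last,
    whence D = 2 B + L. *)
Lemma total_defect_small (e : R) : 0 < e -> exists N, forall n, (N <= n)%N ->
  Df (step n) n.+1 w <= e.
Proof.
move=> e0; have [B B0 bB] := drift_bounded nu om eta2.
pose psi : {poly R} := 'X * (phi_pot nu)^`().
have [L L0 pL] := horner_lipschitz psi M.
pose D := 2 * B + L; have D0 : 0 < D by rewrite /D; lra.
pose e' := e / (t * D); have e'0 : 0 < e' by rewrite divr_gt0// mulr_gt0.
have [N1 fol] := follow_scheme e'0; have [N2 folq] := follow_sqr e'0.
exists (maxn N1 N2) => n; rewrite geq_max => /andP[nN1 nN2].
suff dk k : (k < n.+1)%N -> `|sampled (@drift_defect _ T R) (step n) (phi_pot nu) k w| <= D * e'.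
  rewrite /total_defect step_sqrt.
  apply: (@le_trans _ _ (step n * \sum_(k < n.+1) (D * e'))).
    rewrite ler_wpM2l ?(ltW (step_gt0 n))// ler_sum// => k _; exact: dk.
  rewrite sumr_const card_ord -mulr_natr mulrCA /step mulfVK ?pnatr_eq0//.
  by rewrite /e' le_eqVlt; apply/orP; left; apply/eqP; field; rewrite !gt_eqF.
move=> kn; rewrite /drift_defect /schS; case: (boolP (live (step n) k w)) => [lk|_]; last first.
  by rewrite !mul0r normr0 mulr_ge0// ltW.
rewrite !mul1r.
have ak j : (j < k)%N -> live (step n) j w by move=> jk; apply: alive_mono lk; exact: ltnW.
have [Xx Yy] := fol n k nN1 (ltnW kn) ak; have [_ Qq] := folq n k nN2 (ltnW kn) ak.
have /andP[qk QM] := alive_lt lk.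
have [ub vb] := bB _ _ (ltW qk).
have rd := radial_drift nu om (x (k%:R * step n) w) (y (k%:R * step n) w).
have psiE z : psi.[z] = z * (phi_pot nu)^`().[z] by rewrite hornerM hornerX.
rewrite -psiE [Z in `|Z|](_ : _ = (X (step n) k w - x (k%:R * step n) w) * sample_re (step n) k w
   + (Y (step n) k w - y (k%:R * step n) w) * sample_im (step n) k w
   + (psi.[Q (step n) k w] - psi.[q (k%:R * step n)])); last first.
  move: rd; rewrite -psiE -/(q _) /sample_re /sample_im => rd; lra.
rewrite (le_trans (ler_normD _ _))// (_ : D * e' = (e' * B + e' * B) + L * e'); last first.
  by rewrite /D; ring.
rewrite lerD//.
  by rewrite (le_trans (ler_normD _ _))// lerD// normrM ler_pM.
apply: (@le_trans _ _ (L * `|Q (step n) k w - q (k%:R * step n)|)); last by rewrite ler_pM2l.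
apply: pL.
  by rewrite ger0_norm ?schQ_ge0// ltW.
rewrite ger0_norm ?addr_ge0 ?sqr_ge0//; have := eta2M; move: qk; rewrite /sample -/(q _); lra.
Qed.

End SampledScheme.

(** * Expected exit times up to a finite horizon *)

Section MeanExit.
Context d (T : measurableType d) (R : realType) (P : probability T R).
Variables (F : R -> set (set T)) (W z : R -> T -> R[i]) (nu om al : R).
Hypothesis WF : complex_wiener_wrt P F W.
Hypothesis z_sol : sde_solution P F W (drift nu om) al 0 z.
Hypothesis al_gt0 : 0 < al.

Let x := re_part z.
Let y := im_part z.
Let U := re_part W.
Let V := im_part W.

Lemma ae_good_path : {ae P, forall w, good_path nu om al x y U V w}.
Proof.
have [_ [cx cy] z0 zE] := z_sol.
have [[[_ _ _ _ cU] [_ _ _ _ cV] _] _ _ _] := WF.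
have Z0 : {ae P, forall w, x 0 w = 0 /\ y 0 w = 0}.
  by apply: filterS z0 => w z0w; rewrite /x /y /re_part /im_part z0w.
have ZE : {ae P, forall w, (forall t, 0 <= t -> x t w = x 0 w + Rintegral lebesgue_measure `[0, t]
        (fun s => drift_re nu om (x s w) (y s w)) + al * (U t w - U 0 w)) /\
      (forall t, 0 <= t -> y t w = y 0 w + Rintegral lebesgue_measure `[0, t]
        (fun s => drift_im nu om (x s w) (y s w)) + al * (V t w - V 0 w))}.
  apply: filterS zE => w zw.
  have dE s : drift nu om (z s w) = (drift_re nu om (x s w) (y s w) +i* drift_im nu om (x s w) (y s w))%C.
    by rewrite -driftE; congr drift; rewrite /x /y /re_part /im_part; case: (z s w).
  split=> t t0.
  - rewrite {1}/x /re_part zw// /complex_integral.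
    rewrite -[x 0 w]/(complex.Re (z 0 w)) /U /re_part; case: (z 0 w) (W t w) (W 0 w) => [z1 z2] [W1 W2] [W3 W4].
    simpc => /=; congr (_ + _ + _); apply: eq_Rintegral => s _.
    by rewrite dE.
  - rewrite {1}/y /im_part zw// /complex_integral.
    rewrite -[y 0 w]/(complex.Im (z 0 w)) /V /im_part; case: (z 0 w) (W t w) (W 0 w) => [z1 z2] [W1 W2] [W3 W4].
    simpc => /=; congr (_ + _ + _); apply: eq_Rintegral => s _.
    by rewrite dE.
near=> w.
have [x0 y0] : x 0 w = 0 /\ y 0 w = 0 by near: w.
have [xE yE] : (forall t, 0 <= t -> x t w = x 0 w + Rintegral lebesgue_measure `[0, t]
        (fun s => drift_re nu om (x s w) (y s w)) + al * (U t w - U 0 w)) /\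
      (forall t, 0 <= t -> y t w = y 0 w + Rintegral lebesgue_measure `[0, t]
        (fun s => drift_im nu om (x s w) (y s w)) + al * (V t w - V 0 w)) by near: w.
split.
- by split; near: w.
- by split; near: w.
- by [].
- by move=> t t0; rewrite xE// x0 add0r.
- by move=> t t0; rewrite yE// y0 add0r.
Unshelve. all: by end_near. Qed.


Section Horizon.
Variables (eta2 M : R) (p : {poly R}) (eps : R) (t : R).
Hypotheses (eta2_gt0 : 0 < eta2) (eta2M : eta2 + 1 <= M).
Hypotheses (t_gt0 : 0 < t) (eps_ge0 : 0 <= eps).
Hypothesis eps_residual : forall q, 0 <= q <= M ->
  `|residual (phi_pot nu) (al ^+ 2) p q| <= eps.

Local Notation sampled f h := (f (increment U h) (increment V h) (sample x h)
  (sample y h) (sample_re nu om x y h) (sample_im nu om x y h) (Num.sqrt h) al eta2 M).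

(* The shift makes all time steps at most 1. *)
Definition mesh (n : nat) : nat := n + Num.truncn t.

Let h (n : nat) : R := t / (mesh n).+1%:R.

Let h_gt0 n : 0 < h n. Proof. by rewrite divr_gt0. Qed.

Let h_le1 n : h n <= 1.
Proof.
rewrite ler_pdivrMr// mul1r ltW// (lt_le_trans (truncnS_gt t))// ler_nat.
by rewrite ltnS leq_addl.
Qed.

Definition sampled_exit n := sampled (@exit_time _ T R) (h n) (mesh n).+1.
Let fin_S n := sampled (@schS _ T R) (h n) (mesh n).+1.
Let fin_Q n := sampled (@schQ _ T R) (h n) (mesh n).+1.
Let defect n := sampled (@total_defect _ T R) (h n) (phi_pot nu) (mesh n).+1.

Let hsq n : Num.sqrt (h n) ^+ 2 = h n.
Proof. by rewrite sqr_sqrtr// ltW. Qed.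

Let s01 n : 0 < Num.sqrt (h n) <= 1.
Proof. by rewrite sqrtr_gt0 h_gt0 /= -sqrtr1 ler_sqrt// h_le1. Qed.

Let M_gt0 : 0 < M. Proof. by apply: lt_le_trans eta2M; rewrite addr_gt0. Qed.

Let tk_ge0 n k : 0 <= k%:R * h n. Proof. by rewrite mulr_ge0// ltW. Qed.

Let tk_lt n k : k%:R * h n < k.+1%:R * h n.
Proof. by rewrite ltr_pM2r// ltr_nat. Qed.

Let tk_step n k : k.+1%:R * h n - k%:R * h n = h n.
Proof. by rewrite -mulrBl -natr1 addrAC subrr add0r mul1r. Qed.

Let tk_le1 n k : k.+1%:R * h n - k%:R * h n <= 1.
Proof. by rewrite tk_step. Qed.

Let G n k := F (k%:R * h n).
Let G_sigma n k : sigma_algebra setT (G n k). Proof. exact: (filtration_sigma WF). Qed.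
Let G_meas n k : G n k `<=` measurable. Proof. exact: (filtration_meas WF). Qed.
Let G_incr n k : G n k `<=` G n k.+1.
Proof. by apply: (filtration_incr WF) => //; exact: ltW. Qed.

Let az : adapted F z. Proof. by case: z_sol. Qed.

Let x_meas n k : meas_wrt (G n k) (sample x (h n) k). Proof. exact: adapted_re. Qed.
Let y_meas n k : meas_wrt (G n k) (sample y (h n) k). Proof. exact: adapted_im. Qed.

Let u_meas n k : meas_wrt (G n k) (sample_re nu om x y (h n) k).
Proof.
have mx := @x_meas n k; have my := @y_meas n k.
have mq : meas_wrt (G n k) (fun w => sample x (h n) k w ^+ 2 + sample y (h n) k w ^+ 2).
  exact: (measurable_funD (measurable_funX 2 mx) (measurable_funX 2 my)).
have mc (c : R) : meas_wrt (G n k) (fun=> c) by exact: measurable_cst.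
exact: (measurable_funB (measurable_funD (measurable_funB (measurable_funM (mc (- nu)) mx)
  (measurable_funM (mc om) my)) (measurable_funM (measurable_funM (mc 2) mx) mq))
  (measurable_funM mx (measurable_funX 2 mq))).
Qed.

Let v_meas n k : meas_wrt (G n k) (sample_im nu om x y (h n) k).
Proof.
have mx := @x_meas n k; have my := @y_meas n k.
have mq : meas_wrt (G n k) (fun w => sample x (h n) k w ^+ 2 + sample y (h n) k w ^+ 2).
  exact: (measurable_funD (measurable_funX 2 mx) (measurable_funX 2 my)).
have mc (c : R) : meas_wrt (G n k) (fun=> c) by exact: measurable_cst.
exact: (measurable_funB (measurable_funD (measurable_funD (measurable_funM (mc (- nu)) my)
  (measurable_funM (mc om) mx)) (measurable_funM (measurable_funM (mc 2) my) mq))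
  (measurable_funM my (measurable_funX 2 mq))).
Qed.

Let a_meas n k : meas_wrt (G n k.+1) (increment U (h n) k).
Proof. exact: (noise_re_wrt WF). Qed.
Let b_meas n k : meas_wrt (G n k.+1) (increment V (h n) k).
Proof. exact: (noise_im_wrt WF). Qed.

Let incr_le1 (B : R -> T -> R) n k w : `|increment B (h n) k w| <= 1.
Proof. exact: cutoff_le. Qed.

Let mean_exit n := Ex P (sampled_exit n).

(** The point is that [L] and [C] do not depend on the mesh. The constant [C] is also the dominating
    bound in the limits taken later. *)
Lemma discrete_dynkin_sampled : exists L C : R, [/\ 0 <= L, 0 <= C &
  (forall n, `|Ex P (fun w => p.[fin_Q n w]) - p.[0] + mean_exit n| <=
     eps * mean_exit n + 2 * L * Ex P (defect n) + C * Num.sqrt (h n))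
  /\ (forall n, [/\ bmeas (sampled_exit n), bmeas (defect n), bmeas (fin_S n)
    & bmeas (fun w => p.[fin_Q n w])])
  /\ (forall n w, [/\ `|defect n w| <= C, 0 <= fin_Q n w <= C & 0 <= fin_S n w <= 1])].
Proof.
have [B B0 bB] := drift_bounded nu om eta2.
have [C C0 C_step] := one_step p al (ltW M_gt0) B0.
have [L1 L10 p1] := horner_bounded p^`() M.
have [L2 L20 p2] := horner_bounded p^`()^`() M.
have [L3 L30 p3] := horner_bounded (phi_pot nu)^`() M.
have uv n k w : sample x (h n) k w ^+ 2 + sample y (h n) k w ^+ 2 < eta2 ->
  `|sample_re nu om x y (h n) k w| <= B /\ `|sample_im nu om x y (h n) k w| <= B.
  by move=> xy; apply: bB; exact: ltW.
pose K := step_const al M C L1 L2.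
pose N0 := sch_bound al M B.
pose D := N0 * B + N0 * B + M * L3.
pose C' := t * `|K| + (N0 ^+ 2 + N0 ^+ 2) + t * D.
have N00 : 0 <= N0 by rewrite /N0 /sch_bound !addr_ge0// ltW.
have NB0 : 0 <= N0 * B by rewrite mulr_ge0.
have D0 : 0 <= D by rewrite !addr_ge0// mulr_ge0 ?ltW.
have tK : 0 <= t * `|K| by rewrite mulr_ge0// ltW.
have tD : 0 <= t * D by rewrite mulr_ge0// ltW.
have NN : 0 <= N0 ^+ 2 + N0 ^+ 2 by rewrite addr_ge0 ?sqr_ge0.
have C'0 : 0 <= C' by rewrite !addr_ge0 ?sqr_ge0.
have mh n : (mesh n).+1%:R * h n = t by rewrite /h mulrC mulfVK// pnatr_eq0.
exists L1, C'; split => //; first exact: ltW.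
split; [|split].
- move=> n.
  have mre k := noise_re_moments WF (tk_ge0 n k) (tk_lt n k) (tk_le1 n k).
  have mim k := noise_im_moments WF (tk_ge0 n k) (tk_lt n k) (tk_le1 n k).
  have := @discrete_dynkin _ T R P (G n) (@G_sigma n) (@G_meas n) (@G_incr n) _ _ _ _ _ _ _ al eta2 M B
    (s01 n) M_gt0 B0
    (@a_meas n) (@b_meas n) (@x_meas n) (@y_meas n) (@u_meas n) (@v_meas n)
    (incr_le1 U n) (incr_le1 V n) (uv n)
    (fun k g bg => Ex_noise_re WF (tk_ge0 n k) (tk_lt n k) bg)
    (fun k g bg => Ex_noise_im WF (tk_ge0 n k) (tk_lt n k) bg)
    (fun k g bg => Ex_noise_re_im WF (tk_ge0 n k) (tk_lt n k) bg)
    (fun k g bg => Ex_noise_re_sqr WF (tk_ge0 n k) (tk_lt n k) bg)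
    (fun k g bg => Ex_noise_im_sqr WF (tk_ge0 n k) (tk_lt n k) bg) _ _ _ _ _ _
    p C L1 L2 C0 C_step p1 p2 (phi_pot nu) eps eps_residual (mesh n).+1.
  rewrite hsq mh => dd; apply: (le_trans (dd _ _ _ _ _ _)).
  + by move=> k; have [] := mre k; rewrite tk_step.
  + by move=> k; have [] := mim k; rewrite tk_step.
  + by move=> k; have [] := mre k; rewrite tk_step.
  + by move=> k; have [] := mim k; rewrite tk_step.
  + by move=> k; have [] := mre k; rewrite tk_step.
  + by move=> k; have [] := mim k; rewrite tk_step.
  rewrite lerD2l mulrCA mulrA ler_wpM2r// /C'.
  rewrite (le_trans (ler_wpM2l (ltW t_gt0) (ler_norm K)))// -addrA lerDl addr_ge0//.
- move=> n; split.
  + exact: (bmeas_exit_time (@G_sigma n) (@G_meas n) (@G_incr n) _ _ _ _ (@a_meas n)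
      (@b_meas n) (@x_meas n) (@y_meas n) (@u_meas n) (@v_meas n)).
  + exact: (bmeas_total_defect (@G_sigma n) (@G_meas n) (@G_incr n) al (s01 n) M_gt0 B0 (@a_meas n)
      (@b_meas n) (@x_meas n) (@y_meas n) (@u_meas n) (@v_meas n)
      (incr_le1 U n) (incr_le1 V n) (uv n)).
  + exact: (bmeas_schS (@G_sigma n) (@G_meas n) (@G_incr n) _ _ _ _ (@a_meas n)
      (@b_meas n) (@x_meas n) (@y_meas n) (@u_meas n) (@v_meas n)).
  + exact: (bmeas_pschQ (@G_sigma n) (@G_meas n) (@G_incr n) al (s01 n) M_gt0 B0 (@a_meas n)
      (@b_meas n) (@x_meas n) (@y_meas n) (@u_meas n) (@v_meas n)
      (incr_le1 U n) (incr_le1 V n) (uv n)).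
- move=> n w.
  have sb k := scheme_bound al (s01 n) M_gt0 B0 (incr_le1 U n) (incr_le1 V n) (uv n) k w.
  split; last exact: schS_01.
  + have dk k : `|sampled (@drift_defect _ T R) (h n) (phi_pot nu) k w| <= D.
      rewrite /drift_defect /schS.
      case: (boolP (alive _ _ _ _ _ _ _ _ _ _ k w)) => [lk|_]; last by rewrite !mul0r normr0.
      have /andP[xy Q] := alive_lt lk; have [ub vb] := uv _ _ _ xy; have [Xb Yb] := sb k.
      rewrite !mul1r (le_trans (ler_normD _ _))// lerD//.
        by rewrite (le_trans (ler_normD _ _))// !normrM lerD// ler_pM.
      have Qb : `|sampled (@schQ _ T R) (h n) k w| <= M by rewrite ger0_norm ?schQ_ge0// ltW.
      by rewrite normrM ler_pM// p3.
    rewrite /defect /total_defect hsq normrM gtr0_norm// ger0_norm ?sumr_ge0//.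
    apply: (@le_trans _ _ (h n * \sum_(k < (mesh n).+1) D)).
      by rewrite ler_wpM2l ?(ltW (h_gt0 n))// ler_sum.
    rewrite sumr_const card_ord -mulr_natr mulrCA (mulrC (h n)) mh (mulrC D).
    by rewrite /C' lerDr addr_ge0.
  + rewrite schQ_ge0 /=; have [Xb Yb] := sb (mesh n).+1.
    apply: (@le_trans _ _ (N0 ^+ 2 + N0 ^+ 2)); last by rewrite /C'; lra.
    rewrite /fin_Q /schQ lerD// -real_normK ?num_real// lerXn2r ?nnegrE//.
Qed.

Let mesh_ge n : (n <= mesh n)%N. Proof. exact: leq_addr. Qed.

Let sampled_exitE n w : sampled_exit n w = h n * \sum_(k < (mesh n).+1)
  sampled (@schS _ T R) (h n) k w.
Proof. by rewrite /sampled_exit /exit_time hsq. Qed.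

Lemma sampled_exit_ge0 n w : 0 <= sampled_exit n w.
Proof.
rewrite sampled_exitE; apply: mulr_ge0; first exact: ltW.
apply: sumr_ge0 => k _.
by have /andP[] := schS_01 (increment U (h n)) (increment V (h n)) (sample x (h n)) (sample y (h n))
  (sample_re nu om x y (h n)) (sample_im nu om x y (h n)) (Num.sqrt (h n)) al eta2 M k w.
Qed.

(** A path alive at the end was alive at every step, so its exit time is the horizon t. Integrated,
    this is Markov's inequality for the survival probability. *)
Let fin_S_le n w : t * fin_S n w <= sampled_exit n w.
Proof.
rewrite sampled_exitE.
apply: (@le_trans _ _ (h n * \sum_(k < (mesh n).+1) fin_S n w)).
  rewrite sumr_const card_ord -mulr_natr mulrCA /h mulfVK ?pnatr_eq0// mulrC.
  by [].
rewrite ler_wpM2l ?(ltW (h_gt0 n))// ler_sum// => k _.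
rewrite /fin_S /schS ler_nat; case: (boolP (alive _ _ _ _ _ _ _ _ _ _ (mesh n).+1 w)) => // l.
by rewrite (alive_mono _ l)// ltnW.
Qed.

(** Below, [f] is the distance of p from its boundary value on the paths that die, while survivors
    are estimated by 2 K. The three thirds of e go to [f], to the drift defect and to the local
    errors. *)
Lemma mean_exit_estimate (K : R) : (forall q, `|q| <= M -> `|p.[q]| <= K) ->
  forall e : R, 0 < e -> exists N, forall n, (N <= n)%N ->
   `|p.[eta2] - p.[0] + mean_exit n| <= (eps + 2 * K / t) * mean_exit n + e.
Proof.
move=> pK e e0; have [L [C [L0 C0 [dyn [bm bd]]]]] := discrete_dynkin_sampled.
have K0 : 0 <= K by apply: le_trans (pK 0 _); rewrite ?normr0// ltW.
have ae := ae_good_path.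
have gE n w := sampled_exit_ge0 n w.
have eta2_M : eta2 <= M by apply: le_trans eta2M; rewrite lerDl.
pose f n w := (1 - fin_S n w) * `|p.[fin_Q n w] - p.[eta2]|.
have bf n : bmeas (f n).
  have [_ _ bS bQ] := bm n; apply: bmeasM; first by apply: bmeasB => //; exact: bmeas_cst.
  by apply: bmeas_norm; apply: bmeasB => //; exact: bmeas_cst.
have [L3 L30 p3] := horner_bounded p C.
have f_le n w : `|f n w| <= L3 + `|p.[eta2]|.
  have [_ /andP[Q0 QC] /andP[S0 S1]] := bd n w.
  rewrite /f normrM normr_id -[leRHS]mul1r ler_pM//.
    by rewrite ger0_norm ?subr_ge0//; lra.
  rewrite (le_trans (ler_normB _ _))// lerD// p3//.
  by rewrite ger0_norm.
have f_cvg : Ex P (f n) @[n --> \oo] --> Ex P (cst 0 : T -> R).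
  apply: (Ex_cvg bf f_le); first exact: measurable_cst.
  apply: filterS ae => w gw; apply/cvgrPdist_le => r r0.
  have [N fv] := final_value eta2_gt0 eta2M gw t_gt0 p r0.
  exists N => // n /= Nn; rewrite /cst sub0r normrN ger0_norm; last first.
    have [_ _ /andP[S0 S1]] := bd n w.
    by rewrite mulr_ge0// subr_ge0.
  by apply: (fv (mesh n)); rewrite (leq_trans Nn).
have d_cvg : Ex P (defect n) @[n --> \oo] --> Ex P (cst 0 : T -> R).
  apply: (Ex_cvg (C := C)).
  - by move=> n; have [] := bm n.
  - by move=> n w; have [] := bd n w.
  - exact: measurable_cst.
  apply: filterS ae => w gw; apply/cvgrPdist_le => r r0.
  have [N fv] := total_defect_small eta2_gt0 eta2M gw t_gt0 r0.
  exists N => // n /= Nn; rewrite /cst sub0r normrN ger0_norm; last first.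
    rewrite /defect /total_defect hsq mulr_ge0 ?(ltW (h_gt0 n))// sumr_ge0//.
  by apply: (fv (mesh n)); rewrite (leq_trans Nn).
have s_cvg : Num.sqrt (h n) @[n --> \oo] --> (0 : R).
  apply/cvgrPdist_le => r r0.
  exists (Num.truncn (t / r ^+ 2)) => // n /= Nn.
  rewrite sub0r normrN ger0_norm ?sqrtr_ge0// -[leRHS]gtr0_norm// -sqrtr_sqr ler_sqrt ?sqr_ge0//.
  rewrite /h ler_pdivrMr// mulrC -ler_pdivrMr ?exprn_gt0//.
  apply: (le_trans (ltW (truncnS_gt _))); rewrite ler_nat ltnS.
  exact: leq_trans Nn (mesh_ge n).
rewrite !Ex_cst in f_cvg d_cvg.
have e1 : 0 < e / 3 by rewrite divr_gt0.
have e2 : 0 < e / 3 / (2 * L + 1) by rewrite divr_gt0//; lra.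
have e3 : 0 < e / 3 / (C + 1) by rewrite divr_gt0//; lra.
move/cvgrPdist_lt : f_cvg => /(_ _ e1)[N1 _ H1].
move/cvgrPdist_lt : d_cvg => /(_ _ e2)[N2 _ H2].
move/cvgrPdist_lt : s_cvg => /(_ _ e3)[N3 _ H3].
exists (maxn N1 (maxn N2 N3)) => n; rewrite !geq_max => /and3P[n1 n2 n3].
have {H1} := H1 n n1; rewrite /= sub0r normrN => H1.
have {H2} := H2 n n2; rewrite /= sub0r normrN => H2.
have {H3} := H3 n n3; rewrite /= sub0r normrN ger0_norm ?sqrtr_ge0// => H3.
have [bE bD bS bQ] := bm n.
have S_le : Ex P (fin_S n) <= mean_exit n / t.
  rewrite ler_pdivlMr// mulrC -ExZ//; apply: le_Ex => //; exact: bmeasZ.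
have fin : `|Ex P (fun w => p.[fin_Q n w]) - p.[eta2]| <= Ex P (f n) + 2 * K * Ex P (fin_S n).
  rewrite -{1}(Ex_cst P p.[eta2]) -ExB//; last exact: bmeas_cst.
  rewrite -ExZ// -ExD//; last exact: bmeasZ.
  apply: le_normr_Ex.
  - by apply: bmeasB => //; exact: bmeas_cst.
  - by apply: bmeasD => //; exact: bmeasZ.
  move=> w; rewrite /f /fin_S /schS; case: (boolP (alive _ _ _ _ _ _ _ _ _ _ _ w)) => [l|_] /=.
    rewrite subrr mul0r add0r mulr1 (le_trans (ler_normB _ _))//.
    have /andP[_ Q] := alive_lt l.
    have : `|p.[fin_Q n w]| <= K by apply: pK; rewrite ger0_norm ?schQ_ge0// ltW.
    have : `|p.[eta2]| <= K by apply: pK; rewrite gtr0_norm.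
    lra.
  by rewrite subr0 mul1r mulr0 addr0.
have H2' : 2 * L * Ex P (defect n) <= e / 3.
  have : `|Ex P (defect n)| * (2 * L + 1) <= e / 3 by rewrite -ler_pdivlMr ?ltW//; lra.
  have := ler_norm (Ex P (defect n)); have := normr_ge0 (Ex P (defect n)).
  by move=> ? ? ?; nra.
have H3' : C * Num.sqrt (h n) <= e / 3.
  have : Num.sqrt (h n) * (C + 1) <= e / 3 by rewrite -ler_pdivlMr ?ltW//; lra.
  have := sqrtr_ge0 (h n); lra.
have H1' := ler_norm (Ex P (f n)).
have KS : 2 * K * Ex P (fin_S n) <= 2 * K / t * mean_exit n.
  by rewrite -mulrA -mulrA (mulrA 2) [t^-1 * _]mulrC ler_wpM2l// mulr_ge0.
have := dyn n; move: fin; rewrite !ler_norml mulrDl => /andP[? ?] /andP[? ?].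
apply/andP; split; lra.
Qed.

End Horizon.
End MeanExit.

(** * The mean escape time *)

Section LimInf.
Context {R : realType}.
Local Open Scope ereal_scope.

Lemma limn_einf_ge (u : (\bar R)^nat) (a : \bar R) N :
  (forall n, (N <= n)%N -> a <= u n) -> a <= limn_einf u.
Proof.
move=> ua; rewrite limn_einf_lim (cvg_lim _ (@cvg_einfs_sup _ u))//.
apply: (@le_trans _ _ (einfs u N)); last by apply: ereal_sup_ubound; exists N.
by apply: le_ereal_inf_tmp => _ [n /= Nn <-]; exact: ua.
Qed.

Lemma limn_einf_le (u : (\bar R)^nat) (a : \bar R) :
  (forall n, u n <= a) -> limn_einf u <= a.
Proof.
move=> ua; rewrite limn_einf_lim (cvg_lim _ (@cvg_einfs_sup _ u))//.
apply: ge_ereal_sup => _ [n _ <-]; apply: le_trans (ua n).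
by apply: ereal_inf_lbound; exists n => /=.
Qed.

End LimInf.

Import HBNNSimple.

Section MeanEscapeTime.
Context d (T : measurableType d) (R : realType) (P : probability T R).
Variables (F : R -> set (set T)) (W z : R -> T -> R[i]) (nu om al : R).
Hypothesis WF : complex_wiener_wrt P F W.
Hypothesis z_sol : sde_solution P F W (drift nu om) al 0 z.
Hypothesis al_gt0 : 0 < al.
Variable xi : R.
Hypothesis xi_gt0 : 0 < xi.

Let c := al ^+ 2.
Let I1 := exit_integral (phi_pot nu) c xi.
Let u := 2 / c * fine I1.
Let M := xi ^+ 2 + 1.

Let c_gt0 : 0 < c. Proof. by rewrite exprn_gt0. Qed.

Lemma exit_integral_fin_num : I1 \is a fin_num.
Proof.
pose r : R := 2^-1; have h0 : 0 < r by rewrite invr_gt0.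
have [p pe] := residual_approx (phi_pot nu) c_gt0 (xi ^+ 2) h0.
have h1 : 0 < r < 1 by rewrite h0 /= /r; lra.
have /andP[l1 l2] := exit_integral_bounds c_gt0 (ltW xi_gt0) h1 pe.
rewrite fin_numE; apply/andP; split; apply/eqP => E.
  by move: l1; rewrite -/I1 E leeNy_eq.
by move: l2; rewrite -/I1 E leye_eq.
Qed.

Lemma exit_potential_bounds (p : {poly R}) (e : R) : 0 < e < 1 ->
  (forall q, 0 <= q <= M -> `|residual (phi_pot nu) c p q| <= e) ->
  (1 - e) * u <= p.[0] - p.[xi ^+ 2] <= (1 + e) * u.
Proof.
move=> /[dup] e01 /andP[e0 e1] pe.
have pe' q : 0 <= q <= xi ^+ 2 -> `|residual (phi_pot nu) c p q| <= e.
  by move=> /andP[q0 qx]; apply: pe; rewrite q0 (le_trans qx)// lerDl.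
have := exit_integral_bounds c_gt0 (ltW xi_gt0) e01 pe'.
rewrite -/I1 -(fineK exit_integral_fin_num) !lee_fin /u => /andP[l1 l2].
rewrite ler_pdivrMl in l1; last by lra.
rewrite ler_pdivlMl in l2; last by lra.
set r := fine I1 in l1 l2 *; have c0 := c_gt0.
have e1' : (1 - e) * (2 / c * r) = 2 / c * ((1 - e) * r) by ring.
have e2' : (1 + e) * (2 / c * r) = 2 / c * ((1 + e) * r) by ring.
have c20 : 0 < 2 / c by rewrite divr_gt0.
have e3' : p.[0] - p.[xi ^+ 2] = 2 / c * (c / 2 * (p.[0] - p.[xi ^+ 2])).
  by field; exact: lt0r_neq0.
by rewrite e1' e2' e3' !ler_pM2l// l1 l2.
Qed.

Lemma escape_time_ge0 w : (0 <= escape_time z xi w)%E.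
Proof. by apply: le_ereal_inf_tmp => _ [t [t0 _] <-]; rewrite lee_fin ltW. Qed.

Lemma hitE (t : R) w : (xi%:C%C <= `|z t w|) =
  (xi ^+ 2 <= re_part z t w ^+ 2 + im_part z t w ^+ 2).
Proof.
rewrite /re_part /im_part; case: (z t w) => a b /=.
rewrite normc_def /= lecR -[in LHS](gtr0_norm xi_gt0) -sqrtr_sqr ler_sqrt//.
by rewrite addr_ge0 ?sqr_ge0.
Qed.

Lemma escape_time_le (t : R) w : 0 < t ->
  xi ^+ 2 <= re_part z t w ^+ 2 + im_part z t w ^+ 2 -> (escape_time z xi w <= t%:E)%E.
Proof.
by move=> t0 ht; apply: ereal_inf_lbound; exists t => //; split=> //; rewrite hitE.
Qed.

Let u_ge0 : 0 <= u.
Proof.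
rewrite mulr_ge0 ?divr_ge0 ?(ltW c_gt0)// fine_ge0//.
apply: integral_ge0 => s; rewrite /= in_itv/= => /andP[s0 _]; apply: integral_ge0 => s'.
by rewrite /= in_itv/= => /andP[s'0 _]; rewrite lee_fin exit_kernel_ge0.
Qed.

Let eta0 : 0 < xi ^+ 2. Proof. by rewrite exprn_gt0. Qed.

(** On a fine mesh a sampled exit time is either the horizon, which exceeds g, or a time at which
    the path is outside, hence at least the escape time. So the excess of g over the sampled exit
    time tends to 0 almost surely, and [mean_exit_estimate] at the radius [xi] bounds the
    expectation of g. *)
Lemma Ex_below_escape (g : T -> R) : bmeas g -> (forall w, 0 <= g w) ->
  (forall w, (g w)%:E <= escape_time z xi w)%E -> Ex P g <= u.
Proof.
move=> bg g0 gt; have [_ [C gC]] := bg.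
suff key (e : R) : 0 < e -> e < 8^-1 -> Ex P g - u <= e * (u + 2 * Ex P g + 2).
  rewrite leNgt; apply/negP => ug.
  have G0 : 0 <= Ex P g by exact: Ex_ge0.
  have u0 := u_ge0.
  pose D := u + 2 * Ex P g + 2.
  have D0 : 0 < D by rewrite /D; lra.
  (* This makes e D at most half of the supposed excess of [Ex P g] over [u]; the value 1/16 only
     secures e < 1/8. *)
  pose e := Num.min 16^-1 ((Ex P g - u) / (2 * D)).
  have e0 : 0 < e.
    rewrite lt_min invr_gt0 ltr0n /=; apply: divr_gt0; first by rewrite subr_gt0.
    by rewrite mulr_gt0.
  have e8 : e < 8^-1.
    by apply: (@le_lt_trans _ _ 16^-1); [rewrite ge_min lexx|rewrite ltf_pV2 ?posrE// ltr_nat].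
  have eD : e * D <= (Ex P g - u) / 2.
    apply: (@le_trans _ _ ((Ex P g - u) / (2 * D) * D)).
      by rewrite ler_wpM2r ?(ltW D0)// ge_min lexx orbT.
    by rewrite le_eqVlt; apply/orP; left; apply/eqP; field; exact: lt0r_neq0.
  by have := key e e0 e8; rewrite -/D; lra.
move=> e0 e8.
have e01 : 0 < e < 1 by rewrite e0 (lt_trans e8)// invf_lt1// ltr1n.
have [p pe] := residual_approx (phi_pot nu) c_gt0 M e0.
have [K K0 pK] := horner_bounded p M.
(* The first entry puts the horizon above [g], the second makes the share 2 K / t of the survivors
   at most e. *)
pose t := Num.max (1 + `|C|) (2 * K / e).
have t0 : 0 < t by rewrite lt_max ltr_pwDl.
have gt' w : g w <= t.
  rewrite le_max (le_trans (ler_norm _))// (le_trans (gC w))// (le_trans (ler_norm C))//.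
  by rewrite lerDr.
have Kt : 2 * K / t <= e.
  by rewrite ler_pdivrMr// -ler_pdivrMl// le_max [e^-1 * _]mulrC lexx orbT.
have eta2M : xi ^+ 2 + 1 <= M by [].
have [L [C' [_ _ [_ [bm _]]]]] := discrete_dynkin_sampled WF z_sol eta0 eta2M t0 pe.
have [N est] := mean_exit_estimate WF z_sol eta0 eta2M t0 pe pK e0.
pose f n w := Num.max 0 (g w - sampled_exit W z nu om al (xi ^+ 2) M t n w).
have f_le n w : `|f n w| <= t.
  rewrite ger0_norm; last by rewrite le_max lexx.
  rewrite ge_max (ltW t0) /=; have := gt' w.
  have := sampled_exit_ge0 W z nu om al (xi ^+ 2) M t0 n w; lra.
have bf n : bmeas (f n).
  have [[mE _] _ _ _] := bm n; have [mg _] := bg; split.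
    by apply: measurable_maxr => //; exact: measurable_funB.
  by exists t => w; exact: f_le.
have f_cvg : Ex P (f n) @[n --> \oo] --> Ex P (cst 0 : T -> R).
  apply: (Ex_cvg bf f_le); first exact: measurable_cst.
  apply: filterS (ae_good_path WF z_sol) => w gw; apply: cvg_near_cst.
  have [N' hits] := exit_time_hits eta0 eta2M gw t0.
  exists N' => // n /= Nn; rewrite /f /sampled_exit; apply/max_idPl; rewrite subr_le0.
  have Nm : (N' <= mesh t n)%N by rewrite (leq_trans Nn)// leq_addr.
  case: (hits _ Nm) => [->//|[/andP[h0 ht] hx]].
  by rewrite -lee_fin; apply: le_trans (gt w) _; exact: escape_time_le.
rewrite Ex_cst in f_cvg; move/cvgrPdist_lt : f_cvg => /(_ _ e0)[N1 _ H1].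
pose n := maxn N N1.
have /= := H1 n (leq_maxr _ _); rewrite sub0r normrN => /ltW/(le_trans (ler_norm _)) fe.
have [bE _ _ _] := bm n.
have gD : Ex P g <= Ex P (sampled_exit W z nu om al (xi ^+ 2) M t n) + Ex P (f n).
  rewrite -ExD//; apply: le_Ex => //; first exact: bmeasD.
  by move=> w; rewrite -lerBlDl le_max lexx orbT.
have := est n (leq_maxl _ _); have := exit_potential_bounds e01 pe.
set D := Ex P (sampled_exit _ _ _ _ _ _ _ _ _) in gD *.
have D0 : 0 <= D by apply: Ex_ge0 => w; exact: sampled_exit_ge0.
have KD : 2 * K / t * D <= e * D by rewrite ler_wpM2r.
move=> /andP[_ b2]; rewrite mulrDl ler_norml => /andP[_ b3].
have G0 : 0 <= Ex P g by exact: Ex_ge0.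
have eG : e * (Ex P g) <= e * (D + Ex P (f n)) by rewrite ler_wpM2l// ltW.
have ef : e * Ex P (f n) <= e * e by rewrite ler_wpM2l// ltW.
have ee : e * e <= e * 8^-1 by rewrite ler_wpM2l// ltW.
have D1 : D - 2 * (e * D) <= (1 + e) * u + e by lra.
have u0 := u_ge0.
have [Dg|gD'] := leP (D) (Ex P g).
  have eD : e * D <= e * Ex P g by rewrite ler_wpM2l// ltW.
  lra.
have : (1 - 2 * e) * Ex P g <= (1 - 2 * e) * D by rewrite ler_wpM2l ?ltW//; lra.
lra.
Qed.


Lemma mean_escape_time_le : (mean_escape_time P z xi <= u%:E)%E.
Proof.
apply: ge0_integral_le_nnsfun => [w|g gt]; first exact: escape_time_ge0.
have bg : bmeas g.
  split; first exact: measurable_funP.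
  have [C [_ /= bC]] := simple_bounded g; exists (C + 1) => w; apply: bC => //.
  by rewrite ltrDl.
rewrite -(EFin_Ex P bg) lee_fin; apply: Ex_below_escape => // w.
Qed.

(** Fatou's lemma in reverse: applied to t - S n, it bounds the integral of [H], the upper limit of
    the S n, from below. A path that is at or beyond [xi] at time s is strictly beyond the smaller
    radius, so S n <= s + r' on fine meshes. Hence [H] is almost surely at most the escape time, and
    it is measurable. *)
Lemma mean_escape_time_ge : (u%:E <= mean_escape_time P z xi)%E.
Proof.
suff key (e : R) : 0 < e -> e < 8^-1 ->
    ((((1 - e) * u - 2 * e) / (1 + 2 * e))%:E <= mean_escape_time P z xi)%E.
  apply/lee_addgt0Pr => e e0; rewrite -leeBlDr// -EFinB.
  have u0 := u_ge0.
  (* The condition r (3 u + 2) <= e is what makes the bound of [key] at r at least u - e. *)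
  pose r := Num.min 16^-1 (e / (3 * u + 2)).
  have d0 : 0 < 3 * u + 2 by lra.
  have r0 : 0 < r.
    by rewrite lt_min invr_gt0 ltr0n /=; exact: divr_gt0.
  have r8 : r < 8^-1.
    by apply: (@le_lt_trans _ _ 16^-1); [rewrite ge_min lexx|rewrite ltf_pV2 ?posrE// ltr_nat].
  have re : r * (3 * u + 2) <= e by rewrite -ler_pdivlMr// ge_min lexx orbT.
  apply: le_trans (key r r0 r8); rewrite lee_fin ler_pdivlMr; last by lra.
  have := mulr_ge0 (ltW e0) (ltW r0); have := mulr_ge0 u0 (ltW r0); lra.
move=> e0 e8.
have e01 : 0 < e < 1 by rewrite e0 (lt_trans e8)// invf_lt1// ltr1n.
have [p pe] := residual_approx (phi_pot nu) c_gt0 M e0.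
have [K K0 pK] := horner_bounded p M.
have [L L0 pL] := horner_lipschitz p M.
(* The first entry keeps the smaller radius positive, the second keeps p(eta2) within e/2 of
   p(xi^2). *)
pose r := Num.min (xi ^+ 2 / 2) (e / (2 * L)).
have x20 := eta0.
have r0 : 0 < r.
  rewrite lt_min; apply/andP; split; apply: divr_gt0 => //; exact: mulr_gt0.
pose eta2 := xi ^+ 2 - r.
have rx : r <= xi ^+ 2 / 2 by rewrite ge_min lexx.
have eta20 : 0 < eta2 by rewrite /eta2; lra.
have eta2M : eta2 + 1 <= M by rewrite /eta2 /M; lra.
have Lr : L * r <= e / 2.
  apply: (@le_trans _ _ (L * (e / (2 * L)))).
    by rewrite ler_pM2l// ge_min lexx orbT.
  by rewrite le_eqVlt; apply/orP; left; apply/eqP; field; exact: lt0r_neq0.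
have peta : `|p.[xi ^+ 2] - p.[eta2]| <= e / 2.
  apply: le_trans (pL _ _ _ _) _.
  - by rewrite gtr0_norm// /M lerDl.
  - by rewrite gtr0_norm// /M /eta2; lra.
  - by rewrite /eta2 opprB addrCA subrr addr0 gtr0_norm.
pose t := 2 * K / e.
have t0 : 0 < t by apply: divr_gt0 => //; exact: mulr_gt0.
have Kt : 2 * K / t = e by rewrite /t; field; rewrite !gt_eqF.
have [L' [C' [_ _ [_ [bm _]]]]] := discrete_dynkin_sampled WF z_sol eta20 eta2M t0 pe.
have e20 : 0 < e / 2 by apply: divr_gt0.
have [N est] := mean_exit_estimate WF z_sol eta20 eta2M t0 pe pK e20.
pose S n := sampled_exit W z nu om al eta2 M t n.
set A := _ / (1 + 2 * e).
have SA n : (N <= n)%N -> A <= Ex P (S n).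
  move=> /est; have /andP[b1 _] := exit_potential_bounds e01 pe.
  rewrite Kt -/(S n) ler_norml => /andP[b2 b3].
  move: peta; rewrite ler_norml => /andP[p1 p2].
  by rewrite /A ler_pdivrMr; lra.
have S_le n w : good_path nu om al (re_part z) (im_part z) (re_part W) (im_part W) w ->
    0 <= S n w <= t.
  by move=> gw; exact: exit_time_le.
have S0 n w : 0 <= S n w by exact: sampled_exit_ge0.
have St n w : S n w <= t by have /andP[] := exit_time_le nu om al (re_part z) (im_part z)
  (re_part W) (im_part W) eta2 M w t0 (mesh t n).
pose f (n : nat) (w : T) : \bar R := (t - S n w)%:E.
have bS n : bmeas (S n) by have [] := bm n.
have mf n : measurable_fun setT (f n).
  apply/measurable_EFinP; apply: measurable_funB; first exact: measurable_cst.
  by have [] := bS n.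
have f0 n w : (0 <= f n w)%E by rewrite lee_fin subr_ge0.
have ft n w : (f n w <= t%:E)%E by rewrite lee_fin lerBlDr lerDl.
pose g w := limn_einf (f ^~ w).
have g0 w : (0 <= g w)%E by apply: (@limn_einf_ge _ _ _ 0%N).
have gt w : (g w <= t%:E)%E by exact: limn_einf_le.
have mg : measurable_fun setT g.
  have -> : g = (fun w => - limn_esup (fun n => - f n w))%E by [].
  apply: measurableT_comp => //; apply: measurable_fun_limn_esup => n.
  exact: measurableT_comp.
have gfin w : g w \is a fin_num.
  by rewrite ge0_fin_numE// (le_lt_trans (gt w))// ltry.
have intg : (\int[P]_w g w <= (t - A)%:E)%E.
  apply: le_trans (fatou P measurableT mf (fun n w _ => f0 n w)) _.
  rewrite limn_einf_lim (cvg_lim _ (@cvg_einfs_sup _ _))//.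
  apply: ge_ereal_sup => _ [n _ <-].
  apply: (@le_trans _ _ (\int[P]_w f (maxn n N) w)%E).
    by apply: ereal_inf_lbound; exists (maxn n N) => //=; exact: leq_maxl.
  rewrite -(EFin_Ex P (bmeasB (bmeas_cst T t) (bS (maxn n N)))) ExB//; last exact: bmeas_cst.
  by rewrite Ex_cst lee_fin lerB// SA// leq_maxr.
pose H w : \bar R := (t%:E - g w)%E.
have H0 w : (0 <= H w)%E by rewrite sube_ge0 ?gfin ?orbT.
have mH : measurable_fun setT H by apply: emeasurable_funB.
have intH : (A%:E <= \int[P]_w H w)%E.
  have : (\int[P]_w (g w + H w) = t%:E)%E.
    transitivity (\int[P]_w (cst t%:E w))%E; last first.
      by rewrite integral_cst// /= probability_setT mule1.
    by apply: eq_integral => w _; rewrite /H addeC subeK.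
  rewrite ge0_integralD// => E.
  have : (t%:E <= (t - A)%:E + \int[P]_w H w)%E by rewrite -E leeD2r.
  case: (\int[P]_w H w)%E => [r'| |]; [|by move=> _; rewrite leey|by rewrite addeNy leeNy_eq].
  rewrite -EFinD !lee_fin; lra.
apply: le_trans intH _.
have [B [mB PB0 subB]] := ae_good_path WF z_sol.
apply: (ge0_integral_null_le mB PB0) => // w _.
  exact: escape_time_ge0.
move=> Bw; have gw : good_path nu om al (re_part z) (im_part z) (re_part W) (im_part W) w.
  by apply: contrapT => ngw; apply: Bw; exact: subB.
apply: le_ereal_inf_tmp => _ [s [s0 hs] <-].
rewrite hitE in hs.
have hs' : eta2 < re_part z s w ^+ 2 + im_part z s w ^+ 2.
  by apply: lt_le_trans hs; rewrite /eta2; lra.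
rewrite /H leeBlDr// -leeBlDl//.
apply/lee_addgt0Pr => r' r'0.
have [N' le_hit] := exit_time_le_hit M gw t0 s0 hs' r'0.
rewrite -leeBlDr//.
apply: (@limn_einf_ge _ _ _ N') => n Nn.
rewrite -EFinB /f lee_fin.
have : S n w <= s + r' by apply: le_hit; rewrite (leq_trans Nn)// leq_addr.
lra.
Qed.

Theorem mean_escape_timeE : mean_escape_time P z xi =
  ((2 / al ^+ 2)%:E * exit_integral (phi_pot nu) (al ^+ 2) xi)%E.
Proof.
transitivity u%:E.
  by apply/eqP; rewrite eq_le mean_escape_time_le mean_escape_time_ge.
by rewrite /u EFinM fineK// exit_integral_fin_num.
Qed.

End MeanEscapeTime.

(** * The rotated integral and its bounds *)

Section Substitution.
Context {R : realType}.
Notation mu := (@lebesgue_measure R).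

Lemma integral_subst_increasing (F f G : R -> R) (a b : R) : a <= b ->
  (forall x : R, is_derive x 1 F (f x)) -> continuous f ->
  {in `[a, b] &, {homo F : x y / x < y}} ->
  {within `[F a, F b], continuous G} ->
  (\int[mu]_(x in `[F a, F b]) (G x)%:E = \int[mu]_(x in `[a, b]) (G (F x) * f x)%:E)%E.
Proof.
move=> ab Ff cf Fmono cG.
have F'E : derive1 F = f by apply/funext => x; rewrite derive1E; have [_ ->] := Ff x.
have dF (x : R) : derivable F x 1 by have [] := Ff x.
have cF : continuous F by move=> x; apply/differentiable_continuous/derivable1_diffP.
rewrite (integration_by_substitution_increasing ab Fmono)//; rewrite ?F'E.
- by [].
- by move=> x _; exact: cf.
- by apply/cvg_ex; exists (f a); exact: cvg_at_right_filter (cf a).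
- by apply/cvg_ex; exists (f b); exact: cvg_at_left_filter (cf b).
- split.
  + by move=> x _; exact: dF.
  + exact: cvg_at_right_filter (cF a).
  + exact: cvg_at_left_filter (cF b).
Qed.

End Substitution.

(** * Rotation of the domain of integration *)

Section Rotation.
Context {R : realType}.
Notation mu := (@lebesgue_measure R).
Variables (nu c xi : R).
Hypotheses (c_gt0 : 0 < c) (xi_gt0 : 0 < xi).
Let phi := phi_pot nu.

Definition rotated_exponent (p q : R) : R := p * (nu - q + p ^+ 2 / 12 + q ^+ 2 / 4) / c.

(** Here q - x^2 is y^2, and 2 x^2 - q is p = x^2 - y^2. *)
Lemma rotated_exponentE (x q : R) :
  (phi.[x ^+ 2] - phi.[q - x ^+ 2]) / c = rotated_exponent (2 * x ^+ 2 - q) q.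
Proof.
rewrite /phi /phi_pot /rotated_exponent !(hornerD, hornerN, hornerZ, hornerX, hornerXn).
by field; exact: lt0r_neq0.
Qed.

(** The integrand in the intermediate coordinates x and q = x^2 + y^2: as dq = 2 y dy, the factor y
    / x becomes 1/(2x). *)
Let E (x q : R) : R := (2 * x)^-1 * expR ((phi.[x ^+ 2] - phi.[q - x ^+ 2]) / c).

Let E_ge0 x q : 0 <= x -> 0 <= E x q.
Proof. by move=> x0; rewrite mulr_ge0 ?expR_ge0// invr_ge0 mulr_ge0. Qed.

Let inner_x (x : R) : 0 < x ->
  (\int[mu]_(y in `[0%R, x]) (exit_kernel phi c x y)%:E =
   \int[mu]_(q in `[(x ^+ 2)%R, (2 * x ^+ 2)%R]) (E x q)%:E)%E.
Proof.
move=> x0; pose Fp : {poly R} := 'X^2 + (x ^+ 2)%:P.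
have FpE y : Fp.[y] = y ^+ 2 + x ^+ 2 by rewrite hornerD hornerXn hornerC.
have Fp'E y : Fp^`().[y] = 2 * y.
  by rewrite derivD derivXn derivC addr0 hornerMn hornerXn expr1 mulr_natl.
have := @integral_subst_increasing R (horner Fp) (horner Fp^`()) (E x) 0 x (ltW x0)
  (fun y => is_derive_poly Fp y) (fun y => @continuous_horner _ _ y) _ _.
rewrite !FpE expr0n add0r (_ : x ^+ 2 + x ^+ 2 = 2 * x ^+ 2); last by ring.
move=> ->.
- apply: eq_integral => y _; congr (_%:E).
  rewrite FpE Fp'E /E /exit_kernel addrK [RHS]mulrAC; congr (_ * _).
  by field; exact: lt0r_neq0.
- move=> y1 y2; rewrite !in_itv/= => /andP[y10 _] /andP[y20 _] y12.
  by rewrite !FpE ltrD2r ltrXn2r// ?nnegrE.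
- apply: continuous_subspaceT.
  have -> : E x = exp_poly ((2 * x)^-1)%:P
      (c^-1 *: ((phi.[x ^+ 2])%:P - (phi \Po ('X - (x ^+ 2)%:P)))).
    apply/funext => q; rewrite /E /exp_poly; move: phi => ph; rewrite hornerZ hornerD hornerN !hornerC horner_comp.
    by rewrite hornerD hornerN hornerX hornerC (mulrC c^-1).
  exact: continuous_exp_poly.
Qed.

(** At fixed q, p = 2 x^2 - q has dp = 4 x dx and p + q = 2 x^2, so that dx / (2x) becomes dp / (4
    (p + q)). *)
Definition rotated_kernel (q p : R) : R := (4 * (p + q))^-1 * expR (rotated_exponent p q).

Lemma continuous_rotated_kernel (q : R) : 0 < q -> forall p, 0 <= p ->
  {for p, continuous (rotated_kernel q)}.
Proof.
move=> q0 p p0.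
have c1 : {for p, continuous (fun p => (4 * (p + q))^-1)}.
  apply: (@continuousV R R (fun p => 4 * (p + q))).
    by rewrite mulf_neq0 ?pnatr_eq0// gt_eqF// ltr_wpDl.
  have -> : (fun p => 4 * (p + q)) = horner (4 *: ('X + q%:P)).
    by apply/funext => p'; rewrite hornerZ hornerD hornerX hornerC.
  exact: continuous_horner.
have c2 : {for p, continuous (exp_poly 1%:P
    (c^-1 *: ((nu - q + q ^+ 2 / 4) *: 'X + 12^-1 *: 'X^3)))}.
  exact: continuous_exp_poly.
have := continuousM c1 c2; congr ({for _, continuous _}); apply/funext => p'.
apply/funext => s; rewrite /= /exp_poly /rotated_kernel hornerC mul1r; congr (_ * expR _).
rewrite /rotated_exponent hornerZ hornerD !hornerZ hornerX hornerXn.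
by field; exact: lt0r_neq0.
Qed.

Let inner_q (q : R) (b := Num.min (Num.sqrt q) xi) : 0 < q <= 2 * xi ^+ 2 ->
  (\int[mu]_(p in `[0%R, Num.min q (2 * xi ^+ 2 - q)%R]) (rotated_kernel q p)%:E =
   \int[mu]_(x in `[Num.sqrt (q / 2)%R, b]) (E x q)%:E)%E.
Proof.
move=> /andP[q0 qxi].
pose Fp : {poly R} := 2 *: 'X^2 - q%:P.
have FpE y : Fp.[y] = 2 * y ^+ 2 - q by rewrite hornerD hornerN hornerZ hornerXn hornerC.
have Fp'E y : Fp^`().[y] = 4 * y.
  rewrite derivB derivZ derivXn derivC subr0 hornerZ hornerMn hornerXn expr1 -mulr_natl; ring.
set a := Num.sqrt (q / 2).
have q20 : 0 < q / 2 by apply: divr_gt0.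
have a0 : 0 < a by rewrite sqrtr_gt0.
have a2 : a ^+ 2 = q / 2 by rewrite sqr_sqrtr// ltW.
have ab : a <= b.
  rewrite le_min ler_sqrt// ?(ltW q0)// -(ger0_norm (ltW xi_gt0)) -sqrtr_sqr ler_sqrt ?sqr_ge0//.
  by apply/andP; split; lra.
have b0 : 0 < b by apply: lt_le_trans ab.
have b2 : b ^+ 2 = Num.min q (xi ^+ 2).
  rewrite /b; case: (leP (Num.sqrt q) xi) => qx; case: (leP q (xi ^+ 2)) => qx2.
  - by rewrite sqr_sqrtr// ltW.
  - move: qx; rewrite -(ger0_norm (ltW xi_gt0)) -sqrtr_sqr ler_sqrt ?sqr_ge0//.
    by rewrite leNgt qx2.
  - move: qx; rewrite -(ger0_norm (ltW xi_gt0)) -sqrtr_sqr ltr_sqrt//.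
    by rewrite ltNge qx2.
  - by [].
have := @integral_subst_increasing R (horner Fp) (horner Fp^`()) (rotated_kernel q) a b ab
  (fun y => is_derive_poly Fp y) (fun y => @continuous_horner _ _ y) _ _.
rewrite !FpE a2 b2 (_ : 2 * (q / 2) - q = 0); last by field.
have -> : 2 * Num.min q (xi ^+ 2) - q = Num.min q (2 * xi ^+ 2 - q).
  by case: (leP q (xi ^+ 2)) => qx; case: (leP q (2 * xi ^+ 2 - q)) => qx2; lra.
move=> ->.
- apply: eq_integral => y; rewrite inE/= in_itv/= => /andP[ay yb]; congr (_%:E).
  have y0 : 0 < y by apply: lt_le_trans ay.
  rewrite FpE Fp'E /E /rotated_kernel rotated_exponentE [LHS]mulrAC; congr (_ * _).
  by rewrite subrK; field; rewrite lt0r_neq0.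
- move=> y1 y2; rewrite !in_itv/= => /andP[y10 _] /andP[y20 _] y12.
  rewrite !FpE ltrD2r ltr_pM2l// ltrXn2r// ?nnegrE.
  exact: le_trans (ltW a0) y10.
- apply/subspace_continuousP => p; rewrite /= in_itv/= => /andP[p0 _].
  apply: cvg_within_filter; exact: continuous_rotated_kernel.
Qed.

(** The triangle 0 <= y <= x <= xi in the coordinates x and q, without x = 0, where [E] takes a
    default value. *)
Let band (x q : R) := [&& 0 < x, x <= xi, x ^+ 2 <= q & q <= 2 * x ^+ 2].

Let f (z : R * R) : \bar R := (if band z.1 z.2 then E z.1 z.2 else 0)%:E.

Let f_ge0 z : (0 <= f z)%E.
Proof.
by rewrite /f lee_fin; case: ifPn => // /and4P[/ltW x0 _ _ _]; exact: E_ge0.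
Qed.

(* [expR (- ln x)] stands for the inverse of [x > 0]. *)
Let measurable_f : measurable_fun setT f.
Proof.
have m1 : measurable_fun setT (fst : R * R -> R) by exact: measurable_fst.
have m2 : measurable_fun setT (snd : R * R -> R) by exact: measurable_snd.
have mp (p : {poly R}) (g : R * R -> R) :
    measurable_fun setT g -> measurable_fun setT (fun z => p.[g z]).
  move=> mg; apply: (measurableT_comp (f := horner p)) => //.
  by apply: continuous_measurable_fun; exact: continuous_horner.
have mx2 : measurable_fun setT (fun z : R * R => z.1 ^+ 2) by exact: measurable_funX.
have -> : f = EFin \o (fun z => if band z.1 z.2 then
    2^-1 * expR (- ln z.1) * expR ((phi.[z.1 ^+ 2] - phi.[z.2 - z.1 ^+ 2]) / c) else 0).
  apply/funext => -[x q]; rewrite /f /=; congr (_%:E).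
  case: ifPn => // /and4P[x0 _ _ _].
  by rewrite /E expRN lnK// invfM.
apply/measurable_EFinP; apply: measurable_fun_ifT => //.
  rewrite /band; apply: measurable_and; first exact: measurable_fun_ltr.
  apply: measurable_and; first exact: measurable_fun_ler.
  apply: measurable_and; first exact: measurable_fun_ler.
  by apply: measurable_fun_ler => //; apply: measurable_funM.
apply: measurable_funM.
  apply: measurable_funM => //; apply: measurableT_comp => //.
  by apply: measurableT_comp => //; apply: measurableT_comp => //; exact: measurable_ln.
apply: measurableT_comp => //; apply: measurable_funM => //; apply: measurable_funB.
  exact: mp.
by apply: mp; exact: measurable_funB.
Qed.

Let J (q : R) : \bar R := (\int[mu]_x f (x, q))%E.

Let measurable_J : measurable_fun setT J.
Proof. exact: (measurable_fun_fubini_tonelli_G (m1 := mu)). Qed.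

Let J_inner (q : R) : 0 <= q <= 2 * xi ^+ 2 ->
  J q = (\int[mu]_(p in `[0%R, Num.min q (2 * xi ^+ 2 - q)%R]) (rotated_kernel q p)%:E)%E.
Proof.
move=> /andP[q0 qxi].
have [q00|qn0] := eqVneq q 0.
  have -> : Num.min q (2 * xi ^+ 2 - q) = 0.
    by rewrite q00 subr0 min_l// mulr_ge0// sqr_ge0.
  rewrite set_itv1 integral_set1 /J integral0_eq// => x _; rewrite /f /band/= q00.
  case: ifPn => // /and4P[x0 _]; rewrite leNgt exprn_gt0//.
have {qn0}q0' : 0 < q by rewrite lt_neqAle eq_sym qn0.
rewrite inner_q ?q0'// [RHS]integral_mkcond /J; apply: eq_integral => x _.
rewrite /patch /f /=.
suff -> : band x q = (x \in `[Num.sqrt (q / 2), Num.min (Num.sqrt q) xi]%classic).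
  by case: ifP.
apply/idP/idP.
  rewrite inE/= in_itv/= le_min => /and4P[x0 xxi x2 q2].
  rewrite xxi andbT -(ger0_norm (ltW x0)) -sqrtr_sqr !ler_sqrt ?sqr_ge0// x2 andbT.
  by rewrite ler_pdivrMr// mulrC.
rewrite inE/= in_itv/= le_min => /and3P[ax xb xxi].
have x0 : 0 < x by apply: lt_le_trans ax; rewrite sqrtr_gt0 divr_gt0.
move: ax xb; rewrite /band x0 xxi -(ger0_norm (ltW x0)) -sqrtr_sqr !ler_sqrt ?sqr_ge0//.
by rewrite ler_pdivrMr// mulrC !sqrtr_sqr !ger0_norm ?(ltW x0)// => -> ->.
Qed.

Lemma measurable_rotated_integral :
  measurable_fun `[0%R, 2 * xi ^+ 2] (fun q : R =>
    \int[mu]_(p in `[0%R, Num.min q (2 * xi ^+ 2 - q)%R]) (rotated_kernel q p)%:E)%E.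
Proof.
apply: (eq_measurable_fun J); last exact: measurable_funTS.
by move=> q; rewrite inE/= in_itv/=; exact: J_inner.
Qed.

Lemma exit_integral_rotated : exit_integral phi c xi =
  (\int[mu]_(q in `[0%R, (2 * xi ^+ 2)%R])
    \int[mu]_(p in `[0%R, Num.min q (2 * xi ^+ 2 - q)%R]) (rotated_kernel q p)%:E)%E.
Proof.
transitivity (\int[mu]_x \int[mu]_q f (x, q))%E.
  rewrite /exit_integral integral_mkcond; apply: eq_integral => x _.
  rewrite /patch; case: ifPn => [|xn].
    rewrite inE/= in_itv/= => /andP[x0 xxi].
    have [x00|xn0] := eqVneq x 0.
      rewrite x00 set_itv1 integral_set1 integral0_eq// => q _.
      by rewrite /f /band /= ltxx.
    have x0' : 0 < x by rewrite lt_neqAle eq_sym xn0.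
    rewrite inner_x// integral_mkcond; apply: eq_integral => q _.
    rewrite /patch /f /band /= x0' xxi /=.
    have -> : (q \in `[x ^+ 2, 2 * x ^+ 2]%classic) = (x ^+ 2 <= q) && (q <= 2 * x ^+ 2).
      by apply/idP/idP; rewrite inE/= in_itv.
    by case: ifP.
  rewrite integral0_eq// => q _; rewrite /f /band /=.
  case: ifPn => // /and4P[x0 xxi _ _]; case/negP: xn.
  by rewrite inE/= in_itv/= (ltW x0).
rewrite (fubini_tonelli (m1 := mu) (m2 := mu) f)//.
rewrite [RHS]integral_mkcond; apply: eq_integral => q _.
rewrite /patch; case: ifPn => [|qn].
  by rewrite inE/= in_itv/= => /J_inner.
rewrite integral0_eq// => x _; rewrite /f /band /=.
case: ifPn => // /and4P[x0 xxi x2 q2]; case/negP: qn.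
rewrite inE/= in_itv/= (le_trans (sqr_ge0 x) x2)/= (le_trans q2)//.
by rewrite ler_pM2l// lerXn2r// nnegrE ltW.
Qed.

End Rotation.

(** * The bounds as single integrals *)

Section ClosedForm.
Context {R : realType}.
Notation mu := (@lebesgue_measure R).

(** The inner integral is elementary unless q = 0 or q is a root of nu - q + q^2/b. These
    exceptional points lie in a set of at most three points, and [integral_null_eq] lets the
    integrands differ there. *)
Lemma integral_quotient_ext (nu c k b m : R) : 0 < c -> 0 < k -> 0 < b ->
  (\int[mu]_(q in `[0%R, m]) \int[mu]_(p in `[0%R, q])
     ((k * q * c)^-1 * expR (p * (nu - q + q ^+ 2 / b) / c))%:E =
   \int[mu]_(q in `[0%R, m])
     (quotient_ext (fun q => expR (q * (nu - q + q ^+ 2 / b) / c) - 1)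
       (fun q => k * q * (nu - q + q ^+ 2 / b)) q)%:E)%E.
Proof.
(* For a negative discriminant the square root is 0 by default and the listed points are harmless
   extras: a root would make the discriminant the square of 2 q - b. *)
move=> c0 k0 b0; pose s := Num.sqrt (b ^+ 2 - 4 * b * nu).
have mN : measurable [set 0; (b + s) / 2; (b - s) / 2].
  by apply: measurableU => //; exact: measurableU.
have N0 : mu [set 0; (b + s) / 2; (b - s) / 2] = 0%E.
  apply: countable_lebesgue_measure0; apply: finite_set_countable.
  by rewrite !finite_setU; split => //; split.
apply: (@integral_null_eq _ _ R mu _ _ _ _ mN N0) => q; rewrite /= in_itv/= => /andP[q0 _] qN.
have qn0 : q != 0 by apply/eqP => q00; apply: qN; left; left.
pose k' := nu - q + q ^+ 2 / b.
have kn0 : k' != 0.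
  apply/eqP => k'0; apply: qN.
  have : (2 * q - b) ^+ 2 = s ^+ 2.
    have qE : (2 * q - b) ^+ 2 = b ^+ 2 - 4 * b * nu.
      have : b * k' = 0 by rewrite k'0 mulr0.
      rewrite /k' !mulrDr mulrCA divff ?lt0r_neq0// mulr1 => h.
      nra.
    by rewrite qE sqr_sqrtr// -qE sqr_ge0.
  move=> /eqP; rewrite eqf_sqr => /orP[]/eqP h.
    by left; right; rewrite -h; field.
  by right; rewrite -[s]opprK -h; field.
rewrite /quotient_ext !mulf_eq0 (negbTE qn0) (negbTE kn0) (gt_eqF k0)/=.
pose A : {poly R} := ((k * q * k')^-1)%:P; pose B : {poly R} := (k' / c) *: 'X.
transitivity (\int[mu]_(p in `[0%R, q]) (exp_poly (A^`() + A * B^`()) B p)%:E)%E.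
  apply: eq_integral => p _; congr (_%:E); rewrite /exp_poly.
  rewrite derivC add0r derivZ derivX hornerM !hornerZ hornerX !hornerC mulr1.
  congr (_ * expR _).
    by field; rewrite kn0 qn0 !lt0r_neq0.
  by rewrite -/k'; field; exact: lt0r_neq0.
rewrite integral_exp_poly//; congr (_%:E).
rewrite /exp_poly !hornerC !hornerZ !hornerX !mulr0 expR0 -mulrBr mulrC.
by congr ((expR _ - 1) * _); rewrite mulrC mulrA.
Qed.

End ClosedForm.

(** * The strict inequalities *)

Section Bounds.
Context {R : realType}.
Notation mu := (@lebesgue_measure R).

Lemma integral_disjoint_le (D A B : set R) (f : R -> \bar R) (e : R) :
  measurable D -> measurable A -> measurable B -> A `<=` D -> B `<=` D ->
  [disjoint A & B] ->
  measurable_fun D f -> (forall x, D x -> (0 <= f x)%E) ->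
  0 <= e -> (forall x, B x -> (e%:E <= f x)%E) ->
  (\int[mu]_(x in A) f x + e%:E * mu B <= \int[mu]_(x in D) f x)%E.
Proof.
move=> mD mA mB AD BD dAB mf f0 e0 ef.
have ABD : A `|` B `<=` D by move=> x [/AD|/BD].
apply: (@le_trans _ _ (\int[mu]_(x in A `|` B) f x)%E); last first.
  by apply: ge0_subset_integral => //; exact: measurableU.
rewrite ge0_integral_setU//; last 2 first.
  by apply: measurable_funS mf => //.
  by move=> x /ABD; exact: f0.
rewrite leeD2l// -integral_cst//; apply: ge0_integral_le => x Bx //=.
exact: ef.
Qed.

Variables (nu c xi : R).
Hypotheses (nu_ge0 : 0 <= nu) (c_gt0 : 0 < c) (xi_gt0 : 0 < xi).
Let m := xi ^+ 2.
Let m_gt0 : 0 < m. Proof. exact: exprn_gt0. Qed.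

Lemma measurable_rotated_kernel (q b : R) : 0 < q ->
  measurable_fun `[0%R, b] (rotated_kernel nu c q).
Proof.
move=> q0; apply: subspace_continuous_measurable_fun => //.
apply/subspace_continuousP => p; rewrite /= in_itv/= => /andP[p0 _].
by apply: cvg_within_filter; exact: continuous_rotated_kernel.
Qed.

Lemma rotated_kernel_ge0 q p : 0 <= q -> 0 <= p -> 0 <= rotated_kernel nu c q p.
Proof. by move=> q0 p0; rewrite mulr_ge0 ?expR_ge0// invr_ge0 mulr_ge0// addr_ge0. Qed.

Lemma rotated_integralZ (k q : R) : 0 <= k -> 0 <= q ->
  (k%:E * \int[mu]_(p in `[0%R, Num.min q (2 * m - q)%R]) (rotated_kernel nu c q p)%:E =
   \int[mu]_(p in `[0%R, Num.min q (2 * m - q)%R]) (k * rotated_kernel nu c q p)%:E)%E.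
Proof.
move=> k0 q0; have [q00|qn0] := eqVneq q 0.
  have -> : Num.min q (2 * m - q) = 0 by rewrite q00 subr0 min_l// mulr_ge0// ltW.
  by rewrite set_itv1 !integral_set1 mule0.
have {}q0 : 0 < q by rewrite lt_neqAle eq_sym qn0.
rewrite -ge0_integralZl//; first by apply/measurable_EFinP; exact: measurable_rotated_kernel.
by move=> p; rewrite /= in_itv/= => /andP[p0 _]; rewrite lee_fin rotated_kernel_ge0// ltW.
Qed.

Lemma exit_integralZ (k : R) : 0 <= k ->
  (k%:E * exit_integral (phi_pot nu) c xi =
   \int[mu]_(q in `[0%R, (2 * m)%R]) \int[mu]_(p in `[0%R, Num.min q (2 * m - q)%R])
      (k * rotated_kernel nu c q p)%:E)%E.
Proof.
move=> k0; rewrite exit_integral_rotated// -ge0_integralZl//.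
- apply: eq_integral => q; rewrite inE/= in_itv/= => /andP[q0 _].
  exact: rotated_integralZ.
- exact: measurable_rotated_integral.
- move=> q; rewrite /= in_itv/= => /andP[q0 _]; apply: integral_ge0 => p.
  by rewrite /= in_itv/= => /andP[p0 _]; rewrite lee_fin rotated_kernel_ge0.
Qed.

Let K q p := 2 / c * rotated_kernel nu c q p.
Let N q := (\int[mu]_(p in `[0%R, Num.min q (2 * m - q)%R]) (K q p)%:E)%E.

Let KE q p : 0 < q -> 0 <= p ->
  K q p = (2 * (p + q) * c)^-1 * expR (p * (nu - q + p ^+ 2 / 12 + q ^+ 2 / 4) / c).
Proof.
move=> q0 p0; rewrite /K /rotated_kernel mulrA; congr (_ * _).
by field; rewrite !lt0r_neq0// ltr_wpDl.
Qed.

Let K_ge0 q p : 0 <= q -> 0 <= p -> 0 <= K q p.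
Proof. by move=> q0 p0; rewrite mulr_ge0 ?rotated_kernel_ge0// divr_ge0// ltW. Qed.

Let N_ge0 q : 0 <= q -> (0 <= N q)%E.
Proof.
move=> q0; apply: integral_ge0 => p; rewrite /= in_itv/= => /andP[p0 _].
by rewrite lee_fin K_ge0.
Qed.

Let measurable_N : measurable_fun `[0%R, 2 * m] N.
Proof.
have := measurable_funeM (2 / c)%:E (@measurable_rotated_integral _ nu c xi c_gt0 xi_gt0).
apply: eq_measurable_fun => q; rewrite inE/= in_itv/= => /andP[q0 _].
by rewrite rotated_integralZ// divr_ge0// ltW.
Qed.

Let mean := ((2 / c)%:E * exit_integral (phi_pot nu) c xi)%E.

Let meanE : mean = (\int[mu]_(q in `[0%R, (2 * m)%R]) N q)%E.
Proof. by rewrite /mean exit_integralZ// divr_ge0// ltW. Qed.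

(** A common lower bound of the kernels on the rectangles lost in either comparison. The
    denominators there are at most 4 m c, and the exponents at least - p q / c, where p q <= 3 m^2
    because p <= 3/2 m and q <= 2 m. *)
Let e := (4 * m * c)^-1 * expR (- (3 * m ^+ 2 / c)).
Let e_gt0 : 0 < e.
Proof. by rewrite mulr_gt0 ?expR_gt0// invr_gt0 !mulr_gt0. Qed.

Let T_lower := (\int[mu]_(q in `[0%R, m]) \int[mu]_(p in `[0%R, q])
     ((4 * q * c)^-1 * expR (p * (nu - q + q ^+ 2 / 4) / c))%:E)%E.
Let T_upper := (\int[mu]_(q in `[0%R, (2 * m)%R]) \int[mu]_(p in `[0%R, q])
     ((2 * q * c)^-1 * expR (p * (nu - q + q ^+ 2 / 3) / c))%:E)%E.

Let e_le k q p r : 0 <= q <= 2 * m -> 0 <= p -> p * q <= 3 * m ^+ 2 -> 0 <= r ->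
  0 < k <= 4 * m * c -> e <= k^-1 * expR (p * (nu - q + r) / c).
Proof.
move=> /andP[q0 q2] p0 pq r0 /andP[k0 km].
apply: ler_pM; rewrite ?expR_ge0 ?invr_ge0//.
- by rewrite !mulr_ge0// ltW.
- by rewrite lef_pV2// posrE// !mulr_gt0.
rewrite ler_expR -mulNr ler_pM2r ?invr_gt0//.
have : 0 <= p * (nu + r) by rewrite mulr_ge0// addr_ge0.
by have := pq; lra.
Qed.

(** For q <= m the inner domains coincide, p <= q gives 2 (p + q) <= 4 q, and p^2/12 is dropped. The
    mean has in addition the rectangle 5/4 m <= q <= 3/2 m, 0 <= p <= m/2, inside its domain because
    2 m - q >= m/2 there. Finiteness turns this gain into a strict inequality. *)
Lemma lower_lt_exit_integral : mean \is a fin_num -> (T_lower < mean)%E.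
Proof.
move=> fmean.
pose A := `[0%R, m]%classic; pose B := `[5 / 4 * m, 3 / 2 * m]%classic.
have mg := m_gt0.
have AD : A `<=` `[0%R, 2 * m].
  by move=> q; rewrite /A/= !in_itv/= => /andP[-> q1]; lra.
have BD : B `<=` `[0%R, 2 * m].
  by move=> q; rewrite /B/= !in_itv/= => /andP[q0 q1]; apply/andP; split; lra.
have dAB : [disjoint A & B].
  apply/eqP; rewrite -subset0 => q []; rewrite /A /B/= !in_itv/= => /andP[_ q1] /andP[q2 _].
  by lra.
have N0 q : `[0%R, 2 * m]%classic q -> (0 <= N q)%E.
  by rewrite /= in_itv/= => /andP[q0 _]; exact: N_ge0.
have eB q : B q -> ((e * (m / 2))%:E <= N q)%E.
  rewrite /B/= in_itv/= => /andP[q1 q2].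
  have -> : ((e * (m / 2))%:E = \int[mu]_(p in `[0%R, (m / 2)%R]) (cst e%:E p))%E.
    have m2 : mu `[0%R, m / 2] = (m / 2)%:E.
      by rewrite lebesgue_measure_itv/= lte_fin divr_gt0// -EFinD subr0.
    by rewrite integral_cst// EFinM; congr (_ * _)%E; rewrite -m2.
  rewrite /N; apply: (@le_trans _ _ (\int[mu]_(p in `[0%R, (m / 2)%R]) (K q p)%:E)%E).
    apply: ge0_integral_le => p; first by rewrite lee_fin ltW.
    rewrite /= in_itv/= => /andP[p0 p1]; rewrite lee_fin KE//; last by lra.
    rewrite -addrA; apply: e_le => //.
    - by apply/andP; split; lra.
    - by nra.
    - by rewrite addr_ge0// divr_ge0// sqr_ge0.
    - apply/andP; split; first by rewrite !mulr_gt0//; lra.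
      by rewrite ler_pM2r//; lra.
  apply: ge0_subset_integral => //.
  - apply/measurable_EFinP; apply: measurable_funM => //.
    by apply: measurable_rotated_kernel; lra.
  - move=> p; rewrite /= in_itv/= => /andP[p0 _].
    by rewrite lee_fin K_ge0//; lra.
  - move=> p; rewrite /= !in_itv/= le_min => /andP[-> p1].
    by apply/andP; split; lra.
have ABm := integral_disjoint_le _ _ _ AD BD dAB measurable_N N0 _ eB.
have {}ABm : (\int[mu]_(q in A) N q + (e * (m / 2))%:E * mu B <= mean)%E.
  rewrite meanE; apply: ABm; [exact: measurable_itv|exact: measurable_itv|exact: measurable_itv|].
  by apply: mulr_ge0; apply: ltW => //; exact: divr_gt0.
have muB : mu B = (m / 4)%:E.
  rewrite /B lebesgue_measure_itv/= lte_fin ltr_pM2r// ifT; last by lra.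
  by rewrite -EFinD; congr (_%:E); lra.
apply: (@le_lt_trans _ _ (\int[mu]_(q in A) N q)%E).
  apply: ge0_integral_le => q; rewrite /A/= in_itv/= => /andP[q0 q1].
    apply: integral_ge0 => p _; rewrite lee_fin mulr_ge0 ?expR_ge0// invr_ge0.
    by rewrite !mulr_ge0// ltW.
  rewrite /N min_l; last by lra.
  have [->|qn0] := eqVneq q 0; first by rewrite set_itv1 !integral_set1.
  have {}q0 : 0 < q by rewrite lt_neqAle eq_sym qn0.
  apply: ge0_integral_le => p.
    rewrite lee_fin mulr_ge0 ?expR_ge0// invr_ge0.
    by rewrite !mulr_ge0// ltW.
  rewrite /= in_itv/= => /andP[p0 p1]; rewrite lee_fin KE//.
  apply: ler_pM; rewrite ?expR_ge0 ?invr_ge0//.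
  - by rewrite !mulr_ge0// ltW.
  - rewrite lef_pV2 ?posrE ?mulr_gt0//; first by rewrite ler_pM2r//; lra.
    by lra.
  - rewrite ler_expR ler_pM2r ?invr_gt0// ler_wpM2l//.
    by have := sqr_ge0 p; lra.
apply: lt_le_trans ABm; rewrite muB -EFinM lteDl.
  by rewrite lte_fin; apply: mulr_gt0; [apply: mulr_gt0 => //|]; exact: divr_gt0.
rewrite ge0_fin_numE.
  move: fmean; rewrite meanE ge0_fin_numE; last by apply: integral_ge0.
  by apply: le_lt_trans; apply: ge0_subset_integral => //; exact: measurable_itv.
by apply: integral_ge0 => q /AD; exact: N0.
Qed.

(** From p <= q follow 2 (p + q) >= 2 q and p^2/12 + q^2/4 <= q^2/3. The upper bound has in
    addition, for q >= 3/2 m, the values m/2 < p <= 3/2 m, which are at most q but exceed 2 m -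
    q. *)
Lemma exit_integral_lt_upper : mean \is a fin_num -> (mean < T_upper)%E.
Proof.
move=> fmean; have mg := m_gt0.
pose S := `[3 / 2 * m, 2 * m]%classic.
have SD : S `<=` `[0%R, 2 * m].
  by move=> q; rewrite /S/= !in_itv/= => /andP[q0 ->]; rewrite andbT; lra.
have N0 q : `[0%R, 2 * m]%classic q -> (0 <= N q)%E.
  by rewrite /= in_itv/= => /andP[q0 _]; exact: N_ge0.
have muS : mu S = (m / 2)%:E.
  rewrite /S lebesgue_measure_itv/= lte_fin ltr_pM2r// ifT; last by lra.
  by rewrite -EFinD; congr (_%:E); lra.
pose u q p := (2 * q * c)^-1 * expR (p * (nu - q + q ^+ 2 / 3) / c).
have u_ge0 q p : 0 <= q -> 0 <= u q p.
  by move=> q0; rewrite mulr_ge0 ?expR_ge0// invr_ge0 !mulr_ge0// ltW.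
have mu_ q D : measurable D -> measurable_fun D (u q).
  move=> mD; have -> : u q = exp_poly ((2 * q * c)^-1)%:P
      ((c^-1 * (nu - q + q ^+ 2 / 3)) *: 'X).
    apply/funext => p; rewrite /exp_poly hornerC hornerZ hornerX /u.
    by congr (_ * expR _); ring.
  exact: measurable_exp_poly.
have Ku q p : 0 < q -> 0 <= p <= q -> K q p <= u q p.
  move=> q0 /andP[p0 pq]; rewrite KE//; apply: ler_pM; rewrite ?expR_ge0 ?invr_ge0//.
  - by rewrite !mulr_ge0// ?addr_ge0// ltW.
  - rewrite lef_pV2 ?posrE ?mulr_gt0//; first by rewrite ler_pM2r//; lra.
    by rewrite ltr_wpDl.
  - rewrite ler_expR ler_pM2r ?invr_gt0// ler_wpM2l//.
    by have : p ^+ 2 <= q ^+ 2; [rewrite lerXn2r// nnegrE ltW|lra].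
(* For q in [S] the lost interval of p has length m, so its inner integral is at least e m. *)
pose g := (cst (e * m)%:E : R -> \bar R) \_ S.
have g0 q : (0 <= g q)%E.
  by rewrite /g /patch; case: ifP => // _; rewrite lee_fin; apply: mulr_ge0; exact: ltW.
have NU q : `[0%R, 2 * m]%classic q -> (N q + g q <= \int[mu]_(p in `[0%R, q]) (u q p)%:E)%E.
  rewrite /= in_itv/= => /andP[q0 q2].
  have [q00|qn0] := eqVneq q 0.
    have -> : N q = 0%E.
      rewrite /N; have -> : Num.min q (2 * m - q) = 0 by rewrite q00 subr0 min_l// mulr_ge0// ltW.
      by rewrite set_itv1 integral_set1.
    rewrite q00 set_itv1 integral_set1 add0e /g /patch ifF//.
    by apply/negP; rewrite inE /S/= in_itv/= => /andP[]; lra.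
  have {}q0 : 0 < q by rewrite lt_neqAle eq_sym qn0.
  have NA : (N q <= \int[mu]_(p in `[0%R, Num.min q (2 * m - q)%R]) (u q p)%:E)%E.
    apply: ge0_integral_le => p; rewrite /= in_itv/= le_min => /and3P[p0 p1 _].
      by rewrite lee_fin K_ge0// ltW.
    by rewrite lee_fin Ku// p0.
  have sub : `[0%R, Num.min q (2 * m - q)] `<=` `[0%R, q].
    by move=> p; rewrite /= !in_itv/= le_min => /and3P[-> ->].
  rewrite {1}/g /patch; case: ifPn => [|_]; last first.
    rewrite adde0; apply: le_trans NA _; apply: ge0_subset_integral => //.
      by apply/measurable_EFinP; exact: mu_.
    by move=> p _; rewrite lee_fin u_ge0// ltW.
  rewrite inE /S/= in_itv/= => /andP[q1 _].
  pose B := `]m / 2, 3 / 2 * m]%classic.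
  have muB : mu B = m%:E.
    rewrite /B lebesgue_measure_itv/= lte_fin ifT; last by lra.
    by rewrite -EFinD; congr (_%:E); lra.
  rewrite EFinM -muB; apply: le_trans (leeD2r _ NA) _.
  apply: integral_disjoint_le => //; first exact: measurable_itv.
  - by move=> p; rewrite /B /= !in_itv/= => /andP[p0 p1]; apply/andP; split; lra.
  - apply/eqP; rewrite -subset0 => p []; rewrite /B/= !in_itv/= le_min.
    by move=> /and3P[_ _ p1] /andP[p2 _]; lra.
  - by apply/measurable_EFinP; exact: mu_.
  - by move=> p _; rewrite lee_fin u_ge0// ltW.
  - exact: ltW.
  - move=> p; rewrite /B/= in_itv/= => /andP[p1 p2]; rewrite lee_fin.
    apply: e_le; rewrite ?divr_ge0 ?sqr_ge0//.
    + by apply/andP; split; lra.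
    + by lra.
    + by nra.
    + apply/andP; split; first by rewrite !mulr_gt0.
      by rewrite ler_pM2r//; lra.
have -> : T_upper = (\int[mu]_(q in `[0%R, (2 * m)%R]) \int[mu]_(p in `[0%R, q]) (u q p)%:E)%E by [].
apply: (@lt_le_trans _ _ (\int[mu]_(q in `[0%R, (2 * m)%R]) (N q + g q))%E); last first.
  by apply: ge0_integral_le => // q qD; rewrite adde_ge0//; exact: N0.
rewrite ge0_integralD//; last first.
  apply: measurable_funTS; apply/(measurable_restrictT _ (@measurable_itv R _)).
  exact: measurable_cst.
rewrite -meanE -integral_mkcondr setIC (setIidl SD) integral_cst; last exact: measurable_itv.
rewrite [X in (_ < _ + _ * X)%E]muS lteDl//.
by rewrite -EFinM lte_fin; apply: mulr_gt0; [exact: mulr_gt0|exact: divr_gt0].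
Qed.

End Bounds.

(** * Positivity of the threshold, and the theorem *)

Section Threshold.
Context {R : realType}.

Lemma admissible_threshold_gt0 (nu alpha xi : R) : 0 < nu -> nu < 1 ->
  admissible_threshold nu alpha xi -> 0 < xi.
Proof.
move=> nu0 nu1 [->|[Rmin [Rc [Rmax [[Rmin0 RminRc _ _] [Rcxi _]]]]]].
  rewrite /Rc0 sqrtr_gt0 subr_gt0 -[ltRHS]sqrtr1 ltr_sqrt//.
  by rewrite gtrBl.
exact: lt_trans Rmin0 (lt_trans RminRc Rcxi).
Qed.

End Threshold.

Theorem mainTheorem2 (d : measure_display) (Omega : measurableType d)
    (R : realType) (P : probability Omega R)
    (F : R -> set (set Omega)) (W z : R -> Omega -> R[i])
    (nu alpha omega xi : R)
    (nu_gt0 : 0 < nu) (nu_lt1 : nu < 1) (alpha_gt0 : 0 < alpha)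
    (W_wiener : complex_wiener_wrt P F W)
    (z_sol : sde_solution P F W (drift nu omega) alpha 0 z)
    (xi_thr : admissible_threshold nu alpha xi) :
  [/\ mean_escape_time P z xi =
        ((2 / alpha ^+ 2)%R%:E *
         \int[@lebesgue_measure R]_(x in `[0%R, xi])
           \int[@lebesgue_measure R]_(y in `[0%R, x])
             (y / x *
              expR ((nu * (x ^+ 2 - y ^+ 2) + (y ^+ 4 - x ^+ 4)
                     + (x ^+ 6 - y ^+ 6) / 3) / alpha ^+ 2))%R%:E)%E,
      mean_escape_time P z xi =
        ((alpha ^+ 2)^-1%R%:E *
         \int[@lebesgue_measure R]_(q in `[0%R, (2 * xi ^+ 2)%R])
           \int[@lebesgue_measure R]_(p in
               `[0%R, Num.min q (2 * xi ^+ 2 - q)%R])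
             ((2 * (p + q))^-1 *
              expR (p * (nu - q + p ^+ 2 / 12 + q ^+ 2 / 4)
                    / alpha ^+ 2))%R%:E)%E,
      (T_l nu alpha xi < mean_escape_time P z xi < T_u nu alpha xi)%E,
      T_l nu alpha xi =
        (\int[@lebesgue_measure R]_(q in `[0%R, (xi ^+ 2)%R])
          (quotient_ext
            (fun q => expR (q * (nu - q + q ^+ 2 / 4) / alpha ^+ 2) - 1)
            (fun q => 4 * q * (nu - q + q ^+ 2 / 4)) q)%R%:E)%E
    & T_u nu alpha xi =
        (\int[@lebesgue_measure R]_(q in `[0%R, (2 * xi ^+ 2)%R])
          (quotient_ext
            (fun q => expR (q * (nu - q + q ^+ 2 / 3) / alpha ^+ 2) - 1)
            (fun q => 2 * q * (nu - q + q ^+ 2 / 3)) q)%R%:E)%E].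
Proof.
have xi_gt0 := admissible_threshold_gt0 nu_gt0 nu_lt1 xi_thr.
have c_gt0 : 0 < alpha ^+ 2 by exact: exprn_gt0.
have meanE := mean_escape_timeE W_wiener z_sol alpha_gt0 xi_gt0.
have fmean : ((2 / alpha ^+ 2)%:E * exit_integral (phi_pot nu) (alpha ^+ 2) xi)%E \is a fin_num.
  by rewrite fin_numM// exit_integral_fin_num.
split.
- rewrite meanE /exit_integral; apply: (congr1 (mule _)).
  apply: eq_integral => x _; apply: eq_integral => y _; rewrite /exit_kernel.
  have -> // : (phi_pot nu).[x ^+ 2] - (phi_pot nu).[y ^+ 2] =
    nu * (x ^+ 2 - y ^+ 2) + (y ^+ 4 - x ^+ 4) + (x ^+ 6 - y ^+ 6) / 3.
  rewrite /phi_pot !(hornerD, hornerN, hornerZ, hornerX, hornerXn).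
  by field.
(* The factor 2 goes under the integral, where it turns the 4 of [rotated_kernel] into 2. *)
- rewrite meanE EFinM -muleA [(2%:E * _)%E]muleCA; apply: (congr1 (mule _)).
  rewrite exit_integralZ//; apply: eq_integral => q; rewrite inE/= in_itv/= => /andP[q0 _].
  apply: eq_integral => p; rewrite inE/= in_itv/= => /andP[p0 _].
  congr (_%:E); rewrite /rotated_kernel mulrA; congr (_ * _).
  by rewrite !invfM mulrA; congr (_ * _); field.
- rewrite meanE; apply/andP; split.
    exact: (lower_lt_exit_integral (ltW nu_gt0) c_gt0 xi_gt0 fmean).
  exact: (exit_integral_lt_upper (ltW nu_gt0) c_gt0 xi_gt0 fmean).
- exact: integral_quotient_ext.
- exact: integral_quotient_ext.
Qed.
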